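(* Let $F(w_1,w_2)$ be an odd holomorphic function in a neighbourhood of the origin of $\mathbb{C}^2$ with $F(w_1,w_2)=O(\|(w_1,w_2)\|^3)$, and let $f(z)=F(z,\bar z)$. Suppose $g$ (an even $C^1$ function near $0\in\mathbb{C}$ with $g(z)=o(z)$) satisfies the polynomial condition with respect to some polynomial. Let $h$ be a $C^1$ function defined near the origin with $h(z)=o(g(z))$. Then for every closed disk $D\subset\mathbb{C}$ centered at $0$ with sufficiently small radius, $$[\,z^2,\ (\bar z+f(z)+g(z)+h(z))^2\,;\,D\,]=C(D).$$
   Context: All functions defined near the origin are assumed to be of class $C^1$. For continuous functions $f_1,f_2$ on a compact set $D\subset\mathbb{C}$, $[f_1,f_2;D]$ denotes the uniform closure in $C(D)$ of the set of polynomials (with complex coefficients) in $f_1$ and $f_2$. Polynomial condition: let $g$ be an even $C^1$ function defined near $0\in\mathbb{C}$ with $g(z)=o(z)$ as $z\to 0$. We say $g$ satisfies the polynomial condition with respect to a holomorphic polynomial $p(\zeta_1,\zeta_2)$ if for every $C^1$ function $R$ defined near $0$ with $R(z)=o(g(z))$ as $z\to0$, both $\operatorname{Im} p(z,\bar z+g(z)+R(z))>0$ and $\operatorname{Im} p(z,\bar z-g(z)+R(z))<0$ hold for all $z\neq0$ sufficiently close to $0$. *)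

(* Defs.v *)
From Stdlib Require Import Reals List.
From Coquelicot Require Import Coquelicot.
Import ListNotations.
Open Scope R_scope.

Definition norm2 (w1 w2 : C) : R := sqrt (Cmod w1 ^ 2 + Cmod w2 ^ 2).

Definition poly2 := list (C * nat * nat).
Definition peval2 (P : poly2) (z1 z2 : C) : C :=
  fold_right (fun t acc => let '(c, i, j) := t in
     Cplus (Cmult c (Cmult (Cpow z1 i) (Cpow z2 j))) acc) (RtoC 0) P.

Definition real_diff_at (f : C -> C) (z a b : C) : Prop :=
  forall eps, 0 < eps -> exists delta, 0 < delta /\
    forall k : C, Cmod k < delta ->
      Cmod (Cminus (Cminus (f (Cplus z k)) (f z))
                   (Cplus (Cmult (RtoC (Re k)) a) (Cmult (RtoC (Im k)) b)))
        <= eps * Cmod k.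

Definition continuous_at_C (a : C -> C) (z : C) : Prop :=
  forall eps, 0 < eps -> exists delta, 0 < delta /\
    forall w, Cmod (Cminus w z) < delta -> Cmod (Cminus (a w) (a z)) < eps.

Definition C1_near0 (f : C -> C) : Prop :=
  exists r, 0 < r /\ exists a b : C -> C,
    forall z, Cmod z < r ->
      real_diff_at f z (a z) (b z) /\ continuous_at_C a z /\ continuous_at_C b z.

Definition cdiff2_at (F : C -> C -> C) (w1 w2 : C) : Prop :=
  exists A B : C, forall eps, 0 < eps -> exists delta, 0 < delta /\
    forall k1 k2 : C, norm2 k1 k2 < delta ->
      Cmod (Cminus (Cminus (F (Cplus w1 k1) (Cplus w2 k2)) (F w1 w2))
                   (Cplus (Cmult A k1) (Cmult B k2)))
        <= eps * norm2 k1 k2.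

Definition odd_holo_cubic_near0 (F : C -> C -> C) : Prop :=
  exists r, 0 < r /\
    (forall w1 w2, norm2 w1 w2 < r ->
        cdiff2_at F w1 w2 /\ F (Copp w1) (Copp w2) = Copp (F w1 w2)) /\
    exists M delta, 0 < delta /\
      forall w1 w2, norm2 w1 w2 < delta -> Cmod (F w1 w2) <= M * norm2 w1 w2 ^ 3.

Definition even_near0 (g : C -> C) : Prop :=
  exists r, 0 < r /\ forall z, Cmod z < r -> g (Copp z) = g z.

Definition little_o0 (u v : C -> C) : Prop :=
  forall eps, 0 < eps -> exists delta, 0 < delta /\
    forall z, Cmod z < delta -> Cmod (u z) <= eps * Cmod (v z).

Definition polynomial_condition (g : C -> C) (p : poly2) : Prop :=
  forall Rf : C -> C, C1_near0 Rf -> little_o0 Rf g ->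
    exists delta, 0 < delta /\
      forall z, z <> RtoC 0 -> Cmod z < delta ->
        0 < Im (peval2 p z (Cplus (Cplus (Cconj z) (g z)) (Rf z))) /\
        Im (peval2 p z (Cplus (Cminus (Cconj z) (g z)) (Rf z))) < 0.

Definition cdisk (r : R) (z : C) : Prop := Cmod z <= r.

Definition continuous_on (D : C -> Prop) (phi : C -> C) : Prop :=
  forall z, D z -> forall eps, 0 < eps -> exists delta, 0 < delta /\
    forall w, D w -> Cmod (Cminus w z) < delta -> Cmod (Cminus (phi w) (phi z)) < eps.

Definition uniform_poly_dense (f1 f2 : C -> C) (D : C -> Prop) : Prop :=
  forall phi : C -> C, continuous_on D phi ->
    forall eps, 0 < eps -> exists P : poly2,
      forall z, D z -> Cmod (Cminus (phi z) (peval2 P (f1 z) (f2 z))) < eps.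

(* Main.v *)
Require Import Defs.
From Stdlib Require Import Reals Lra Lia Psatz List Classical ClassicalEpsilon.
From Coquelicot Require Import Coquelicot.
Import ListNotations.
Open Scope R_scope.

(* Write [q = conj z + f + g + h], [D] for the disc and [A = [z ^ 2, q ^ 2; D]].

   - [z q] has real part at least a multiple of [|z| ^ 2], so it is the principal
     square root of [z ^ 2 q ^ 2]; square roots taken along a path of invertible
     elements stay in a uniform algebra, hence [z q] is in [A], and [A] contains
     [P (z, q)] for every even polynomial [P].
   - The map [(z, w) |-> (z, w + F z w)] is odd and biholomorphic near 0.  Its
     inverse sends [(z, q)] to [(z, v)] with [v = conj z + g + R], [R = o(g)] of
     class C^1.  By oddness [(- z, - q)] goes to [(- z, - v)], which is again of
     the form [(z', conj z' - g z' + R' z')] with [z' = - z].  The polynomial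
     condition applied to [R] and [R'] shows that
     [sigma = p (z, v) - p (- z, - v)] satisfies [Im sigma > 0] off 0.
   - [sigma] is a limit of odd polynomials in [(z, q)], so [sigma ^ 2] is in [A],
     and then so is its square root [sigma].  An even function of [(z, q)] times
     [sigma] is in [A] because [sigma] is, and an odd one because the product is
     even.  Hence [sigma [z, q; D]] is contained in [A].
   - [[z, q; D] = C(D)] since [q - conj z] has small Lipschitz constant: the
     functions [(1 + N (z - a) (q z - q a)) ^ -2], normalized, are approximate
     partitions of unity.  As [sigma] vanishes only at 0, [A = C(D)].

   That [v] is a limit of odd polynomials in [(z, q)] needs the approximation of
   [F] by polynomials; it comes from the Cauchy formula on squares, in the form
   [f w * winding w = int f z / (z - w) dz], where only [winding w <> 0] is used. *)

(** * Uniformly closed algebras and square roots *)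

(** The closure [[z, q; D]] is all of [C(D)] and so contains [v], but an approximation found there
    carries no parity, while [A] only offers even polynomials in [(z, q)]. What is needed is one
    polynomial that is close to [v] at [(z, q)] and close to [- v] at [(- z, - q)]. The closure is
    therefore also taken on two copies of the disc, the graph of [q] and its image under [- id].
    Summation over the two copies then leads back to [A]. This is why closed algebras are treated
    over an arbitrary set of points.

    No spectral theory is used: inverses, square roots and [v] are all limits of contractions that
    can be run inside the algebra. Likewise no power series: every quantitative fact on [F],
    including the Lipschitz bounds for its partial derivatives, is drawn from one Cauchy
    integral. *)

Lemma Rdiv_mult_cancel (a b : R) : b <> 0 -> a / b * b = a.
Proof. intros; field; auto. Qed.

Lemma Cmod_sqr (z : C) : Cmod z ^ 2 = Re z ^ 2 + Im z ^ 2.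
Proof.
destruct z as [x y]; unfold Cmod, Re, Im; simpl fst; simpl snd.
rewrite pow2_sqrt; [ring | nra].
Qed.

Lemma Im_le_Cmod (z : C) : Rabs (Im z) <= Cmod z.
Proof.
apply Rle_trans with (2 := Rmax_Cmod z), Rmax_r.
Qed.

Lemma Cmod_le_ReIm (z : C) : Cmod z <= Rabs (Re z) + Rabs (Im z).
Proof.
apply Rsqr_incr_0_var; [|generalize (Rabs_pos (Re z)) (Rabs_pos (Im z)); lra].
rewrite 2!Rsqr_pow2, Cmod_sqr.
rewrite <- (pow2_abs (Re z)), <- (pow2_abs (Im z)).
generalize (Rabs_pos (Re z)) (Rabs_pos (Im z)); nra.
Qed.

Lemma Cminus_diag (z : C) : (z - z)%C = 0%C.
Proof. ring. Qed.

Lemma Cminus_0_r (z : C) : (z - 0)%C = z.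
Proof. ring. Qed.

Ltac cmod_triangle := apply Rle_trans with (1 := Cmod_triangle _ _).

Ltac le_Rmin :=
  first [ apply Rle_refl
        | apply Rle_trans with (1 := Rmin_l _ _); le_Rmin
        | apply Rle_trans with (1 := Rmin_r _ _); le_Rmin ].

Lemma Cmod_minus_sym (a b : C) : Cmod (a - b) = Cmod (b - a).
Proof. rewrite <- Cmod_opp; f_equal; ring. Qed.

Lemma Cmod_minus_triangle (a b c : C) : Cmod (a - c) <= Cmod (a - b) + Cmod (b - c).
Proof. replace (a - c)%C with ((a - b) + (b - c))%C by ring; apply Cmod_triangle. Qed.

Lemma Cmod_triangle_inv (a b : C) : Cmod a - Cmod b <= Cmod (a - b).
Proof.
generalize (Cmod_triangle (a - b) b); replace (a - b + b)%C with a by ring; lra.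
Qed.

(** A predicate over a bare type of points, without topology, so that the same lemmas serve the disc
    and two copies of it. Bounds are hypotheses of the lemmas that use them. *)
Record closed_algebra {T : Type} (A : (T -> C) -> Prop) : Prop := {
  ca_const : forall c : C, A (fun _ => c);
  ca_add : forall f g, A f -> A g -> A (fun x => f x + g x)%C;
  ca_mul : forall f g, A f -> A g -> A (fun x => f x * g x)%C;
  ca_lim : forall f,
    (forall eps, 0 < eps -> exists g, A g /\ forall x, Cmod (f x - g x) <= eps) -> A f }.

(** Disposes of the empty set of points, so that later proofs may evaluate at some [x0] to learn the
    sign of a constant. *)
Lemma ca_empty {T : Type} (A : (T -> C) -> Prop) (f : T -> C) :
  closed_algebra A -> ~ inhabited T -> A f.
Proof.
intros HA HT; apply (ca_lim _ HA); intros eps _.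
exists (fun _ => RtoC 0); split; [apply (ca_const _ HA)|].
intros x; destruct HT; constructor; exact x.
Qed.

Lemma ca_ext {T : Type} (A : (T -> C) -> Prop) (f g : T -> C) :
  closed_algebra A -> A f -> (forall x, g x = f x) -> A g.
Proof.
intros HA Hf Hfg; apply (ca_lim _ HA); intros eps Heps; exists f; split; auto.
intros x; rewrite Hfg; rewrite Cminus_diag.
rewrite Cmod_0; lra.
Qed.

Lemma ca_scal {T : Type} (A : (T -> C) -> Prop) (c : C) (f : T -> C) :
  closed_algebra A -> A f -> A (fun x => c * f x)%C.
Proof.
intros HA Hf; apply (ca_mul _ HA (fun _ => c)); auto; apply (ca_const _ HA).
Qed.

Lemma ca_sub {T : Type} (A : (T -> C) -> Prop) (f g : T -> C) :
  closed_algebra A -> A f -> A g -> A (fun x => f x - g x)%C.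
Proof.
intros HA Hf Hg.
apply (ca_ext A (fun x => f x + RtoC (-1) * g x)%C); auto.
apply (ca_add _ HA); auto; apply ca_scal; auto.
intros x; ring.
Qed.

Lemma ca_pow {T : Type} (A : (T -> C) -> Prop) (f : T -> C) (n : nat) :
  closed_algebra A -> A f -> A (fun x => f x ^ n)%C.
Proof.
intros HA Hf; induction n as [|n IH]; simpl.
- apply (ca_const _ HA).
- apply (ca_mul _ HA); auto.
Qed.

Lemma pow_small (k E eps : R) : 0 <= k < 1 -> 0 < eps -> exists n, k ^ n * E <= eps.
Proof.
intros Hk Heps.
destruct (Rle_or_lt E 0) as [HE|HE].
- exists 0%nat; simpl; lra.
- destruct (pow_lt_1_zero k) with (y := eps / E) as [N HN].
  + rewrite Rabs_pos_eq; lra.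
  + apply Rdiv_lt_0_compat; lra.
  + exists N; specialize (HN N (le_n _)).
    rewrite Rabs_pos_eq in HN by (apply pow_le; lra).
    apply Rmult_lt_compat_r with (r := E) in HN; auto.
    rewrite Rdiv_mult_cancel in HN by lra; lra.
Qed.

(** Common frame of the iterations that follow: Neumann series, square roots, and the implicit
    equation for [v]. *)
Lemma ca_geometric_limit {T : Type} (A : (T -> C) -> Prop) (k E : R)
  (y : nat -> T -> C) (f : T -> C) :
  closed_algebra A -> 0 <= k < 1 ->
  (forall n, A (y n)) -> (forall n x, Cmod (f x - y n x) <= k ^ n * E) -> A f.
Proof.
intros HA Hk Hy Hb; apply (ca_lim _ HA); intros eps Heps.
destruct (pow_small k E eps Hk Heps) as [n Hn].
exists (y n); split; auto.
intros x; apply Rle_trans with (2 := Hn); auto.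
Qed.

(** Neumann series, run as [y |-> 1 + (1 - u) y]: its fixed point is [/ u] and each step multiplies
    the error by [1 - u]. *)
Lemma ca_inv_near_1 {T : Type} (A : (T -> C) -> Prop) (u : T -> C) (k : R) :
  closed_algebra A -> A u -> k < 1 -> (forall x, Cmod (1 - u x) <= k) ->
  A (fun x => / u x)%C.
Proof.
intros HA Hu Hk1 Hk.
destruct (classic (inhabited T)) as [[x0]|HT]; [|apply (ca_empty A); auto].
assert (Hk0 : 0 <= k < 1) by (generalize (Hk x0) (Cmod_ge_0 (1 - u x0)); lra).
assert (Hux : forall x, 1 - k <= Cmod (u x)).
{ intros x; generalize (Cmod_triangle_inv 1 (1 - u x)) (Hk x).
  rewrite Cmod_1; replace (1 - (1 - u x))%C with (u x) by ring; lra. }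
assert (Hu0 : forall x, u x <> 0%C).
{ intros x; apply Cmod_gt_0; generalize (Hux x); lra. }
pose (y := fix y n := match n with O => fun _ : T => RtoC 0
           | S n => fun x => (1 + (1 - u x) * y n x)%C end).
apply (ca_geometric_limit A k (/ (1 - k)) y); auto.
- induction n as [|n IH]; simpl.
  + apply (ca_const _ HA).
  + apply (ca_add _ HA); [apply (ca_const _ HA)|].
    apply (ca_mul _ HA); auto; apply ca_sub; auto; apply (ca_const _ HA).
- induction n as [|n IH]; intros x; simpl.
  + rewrite (Cminus_0_r (/ u x)).
    rewrite Cmod_inv, Rmult_1_l by auto.
    apply Rinv_le_contravar; [lra|auto].
  + replace (/ u x - (1 + (1 - u x) * y n x))%C
      with ((1 - u x) * (/ u x - y n x))%C by (field; auto).
    rewrite Cmod_mult, Rmult_assoc.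
    apply Rmult_le_compat; auto; apply Cmod_ge_0.
Qed.

(** A real multiple of [u] lies near 1: with [l = c / M^2], [|1 - l u|^2 = 1 - 2 l Re u + l^2 |u|^2
    <= 1 - c^2 / M^2]. *)
Lemma ca_inv_half_plane {T : Type} (A : (T -> C) -> Prop) (u : T -> C) (c M : R) :
  closed_algebra A -> A u -> 0 < c -> (forall x, c <= Re (u x)) ->
  (forall x, Cmod (u x) <= M) -> A (fun x => / u x)%C.
Proof.
intros HA Hu Hc Hre HM.
destruct (classic (inhabited T)) as [[x0]|HT]; [|apply (ca_empty A); auto].
assert (HcM : c <= M).
{ generalize (Hre x0) (HM x0) (re_le_Cmod (u x0)) (Rle_abs (Re (u x0))); lra. }
assert (Hq : 0 < c ^ 2 / M ^ 2 <= 1).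
{ split; [apply Rdiv_lt_0_compat; nra|].
  apply Rmult_le_reg_r with (M ^ 2); [nra|].
  unfold Rdiv; rewrite Rmult_assoc, Rinv_l by nra; nra. }
assert (Hl0 : c / M ^ 2 <> 0).
{ apply Rgt_not_eq, Rdiv_lt_0_compat; nra. }
assert (Hlc : RtoC (c / M ^ 2) <> 0%C).
{ intros E; apply RtoC_inj in E; auto. }
assert (Hu0 : forall x, u x <> 0%C).
{ intros x E; generalize (Hre x); rewrite E; simpl; lra. }
apply (ca_ext A (fun x => RtoC (c / M ^ 2) * / (RtoC (c / M ^ 2) * u x))%C); auto.
2: { intros x; field; split; auto. }
apply ca_scal; auto.
apply ca_inv_near_1 with (k := sqrt (1 - c ^ 2 / M ^ 2)); auto.
- apply ca_scal; auto.
- rewrite <- sqrt_1 at 2; apply sqrt_lt_1_alt; lra.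
- intros x; rewrite <- (sqrt_pow2 (Cmod _)) by apply Cmod_ge_0.
  apply sqrt_le_1_alt.
  rewrite Cmod_sqr; generalize (Cmod_sqr (u x)) (Hre x) (HM x) (Cmod_ge_0 (u x)).
  destruct (u x) as [a b]; unfold Re, Im; simpl.
  set (m := Cmod (a, b)); intros Hm Ha HmM Hm0.
  assert (Hl : 0 < c / (M * (M * 1))) by (apply Rdiv_lt_0_compat; nra).
  set (l := c / (M * (M * 1))) in *.
  assert (Hll : l * M ^ 2 = c) by (unfold l; field; lra).
  replace (c * (c * 1) / (M * (M * 1))) with (c * l) by (unfold l; field; lra).
  assert (Hm2 : a ^ 2 + b ^ 2 <= M ^ 2) by (simpl; nra).
  assert (l * (l * (a ^ 2 + b ^ 2)) <= l * c).
  { apply Rmult_le_compat_l; [lra|]; rewrite <- Hll; apply Rmult_le_compat_l; lra. }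
  assert (l * c <= l * a) by (apply Rmult_le_compat_l; lra).
  nra.
Qed.

(** With [U = 1 - S' / S], the element [w = 1 - S'^2 / S^2] of [A] equals [2 U - U^2], so [U] is a
    fixed point of [y |-> (w + y^2) / 2]. Started at 0, the iterates stay below 1/2 in modulus, and
    as [|U| <= 1/4] the error is at least halved each time. Closeness to [S] is what selects the
    branch. The inverse of [S'] belongs to the conclusion so that the step can be repeated. *)
Lemma ca_sqrt_step {T : Type} (A : (T -> C) -> Prop) (S S' : T -> C) :
  closed_algebra A -> A S -> A (fun x => / S x)%C -> A (fun x => S' x ^ 2)%C ->
  (forall x, S x <> 0%C) -> (forall x, Cmod (S' x - S x) <= / 4 * Cmod (S x)) ->
  A S' /\ A (fun x => / S' x)%C.
Proof.
intros HA HS HiS HS2 HS0 Hd.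
pose (U := fun x => (1 - S' x / S x)%C).
assert (HU : forall x, Cmod (U x) <= / 4).
{ intros x; unfold U.
  replace (1 - S' x / S x)%C with (- ((S' x - S x) / S x))%C by (field; auto).
  rewrite Cmod_opp, Cmod_div by auto.
  apply Rmult_le_reg_r with (Cmod (S x)); [apply Cmod_gt_0; auto|].
  unfold Rdiv; rewrite Rmult_assoc, Rinv_l; [rewrite Rmult_1_r; auto|].
  apply Rgt_not_eq, Cmod_gt_0; auto. }
pose (w := fun x => (1 - S' x ^ 2 * (/ S x * / S x))%C).
assert (Hw : A w).
{ apply ca_sub; auto; [apply (ca_const _ HA)|].
  apply (ca_mul _ HA); auto; apply (ca_mul _ HA); auto. }
assert (HwU : forall x, w x = (RtoC 2 * U x - U x * U x)%C).
{ intros x; unfold w, U; simpl; field; auto. }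
pose (y := fix y n := match n with O => fun _ : T => RtoC 0
           | Datatypes.S n => fun x => (/ 2 * (w x + y n x * y n x))%C end).
assert (Hhalf : Cmod (/ 2) = / 2).
{ rewrite Cmod_inv, Cmod_R, Rabs_pos_eq; try lra; intros E; apply RtoC_inj in E; lra. }
assert (Hyb : forall n x, Cmod (y n x) <= / 2).
{ induction n as [|n IH]; intros x; simpl; [rewrite Cmod_0; lra|].
  rewrite Cmod_mult, Hhalf, HwU.
  generalize (Cmod_triangle (2 * U x - U x * U x) (y n x * y n x))
    (Cmod_triangle (2 * U x) (- (U x * U x))) (IH x) (HU x)
    (Cmod_ge_0 (y n x)) (Cmod_ge_0 (U x)).
  rewrite Cmod_opp, !Cmod_mult, Cmod_R, (Rabs_pos_eq 2) by lra.
  unfold Cminus; nra. }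
assert (HAU : A U).
{ apply (ca_geometric_limit A (/ 2) 1 y); auto; [lra| |].
  - induction n as [|n IH]; simpl.
    + apply (ca_const _ HA).
    + apply ca_scal; auto; apply (ca_add _ HA); auto; apply (ca_mul _ HA); auto.
  - induction n as [|n IH]; intros x; simpl.
    + rewrite (Cminus_0_r (U x)); generalize (HU x); lra.
    + replace (U x - / 2 * (w x + y n x * y n x))%C
        with (/ 2 * ((U x + y n x) * (U x - y n x)))%C.
      2: { rewrite HwU; field; intros E; apply RtoC_inj in E; lra. }
      rewrite 2!Cmod_mult, Hhalf, Rmult_assoc.
      apply Rmult_le_compat_l; [lra|].
      generalize (IH x) (Cmod_triangle (U x) (y n x)) (HU x) (Hyb n x)
        (Cmod_ge_0 (U x - y n x)) (Cmod_ge_0 (U x + y n x)).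
      nra. }
assert (HAV : A (fun x => 1 - U x)%C).
{ apply ca_sub; auto; apply (ca_const _ HA). }
split.
- apply (ca_ext A (fun x => S x * (1 - U x))%C); auto.
  + apply (ca_mul _ HA); auto.
  + intros x; unfold U; field; auto.
- assert (HV : A (fun x => / (1 - U x))%C).
  { apply ca_inv_near_1 with (k := / 4); auto; [lra|].
    intros x; replace (1 - (1 - U x))%C with (U x) by ring; auto. }
  apply (ca_ext A (fun x => / S x * / (1 - U x))%C); auto.
  + apply (ca_mul _ HA); auto.
  + intros x.
    assert (Hv : (1 - U x)%C <> 0%C).
    { apply Cmod_gt_0; generalize (Cmod_triangle_inv 1 (U x)) (HU x).
      rewrite Cmod_1; lra. }
    assert (HS' : S' x = (S x * (1 - U x))%C) by (unfold U; field; auto).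
    rewrite HS'; field; split; auto.
Qed.

(** Principal square root by the half-angle formulas; on the negative real axis it is the root with
    positive imaginary part. *)
Definition Csqrt (w : C) : C :=
  (sqrt ((Cmod w + Re w) / 2),
   (if Rle_dec 0 (Im w) then 1 else -1) * sqrt ((Cmod w - Re w) / 2)).

Lemma Csqrt_sqr (w : C) : (Csqrt w ^ 2)%C = w.
Proof.
assert (H1 := re_le_Cmod w); assert (H2 := Cmod_sqr w).
destruct w as [a b]; unfold Csqrt; unfold Re, Im in *; simpl in *.
set (m := Cmod (a, b)) in *.
assert (Hm : -m <= a <= m) by (revert H1; unfold Rabs; destruct (Rcase_abs a); lra).
assert (E1 : sqrt ((m + a) / 2) * sqrt ((m + a) / 2) = (m + a) / 2) by (apply sqrt_sqrt; lra).
assert (E2 : sqrt ((m - a) / 2) * sqrt ((m - a) / 2) = (m - a) / 2) by (apply sqrt_sqrt; lra).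
assert (E3 : sqrt ((m + a) / 2) * sqrt ((m - a) / 2) = Rabs b / 2).
{ rewrite <- sqrt_mult by lra.
  replace ((m + a) / 2 * ((m - a) / 2)) with (Rsqr (b / 2)).
  - rewrite sqrt_Rsqr_abs; unfold Rdiv; rewrite Rabs_mult, (Rabs_pos_eq (/ 2)); lra.
  - unfold Rsqr; nra. }
unfold Cmult; simpl; revert E1 E2 E3.
set (p := sqrt ((m + a) / 2)); set (q := sqrt ((m - a) / 2)); intros E1 E2 E3.
destruct (Rle_dec 0 b) as [Hb|Hb].
- rewrite Rabs_pos_eq in E3 by auto; f_equal; nra.
- rewrite Rabs_left in E3 by lra; f_equal; nra.
Qed.

Lemma Csqrt_Re_ge0 (w : C) : 0 <= Re (Csqrt w).
Proof. unfold Csqrt, Re; simpl; apply sqrt_pos. Qed.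

(* [Csqrt (s ^ 2 + t)] for [t] decreasing from infinity is a path of square roots
   of elements of the algebra, along which [ca_sqrt_step] applies. *)
Lemma ca_sqrt {T : Type} (A : (T -> C) -> Prop) (s : T -> C) (M : R) :
  closed_algebra A -> A (fun x => s x ^ 2)%C -> (forall x, Cmod (s x) <= M) ->
  (forall x, 0 <= Re (s x)) ->
  (forall eta, 0 < eta -> exists delta, 0 < delta /\
     forall x, eta <= Cmod (s x) -> delta <= Re (s x)) ->
  A s.
Proof.
intros HA Hs2 HM Hre Hlow.
apply (ca_lim _ HA); intros eps Heps.
(* The path stops at [t = eta]. There [|W - s| |W + s| = eta] and [|W - s| <= |W + s|], which gives
   [|W - s| <= eps]. *)
set (eta := eps ^ 2).
assert (Heta : 0 < eta) by (unfold eta; nra).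
pose (W := fun (t : R) x => Csqrt (s x ^ 2 + RtoC t)).
assert (W2 : forall t x, (W t x ^ 2)%C = (s x ^ 2 + RtoC t)%C)
  by (intros; apply Csqrt_sqr).
assert (AW2 : forall t, A (fun x => W t x ^ 2)%C).
{ intros t; apply (ca_ext A (fun x => s x ^ 2 + RtoC t)%C); auto.
  apply (ca_add _ HA); auto; apply (ca_const _ HA). }
assert (W0 : forall t x, 0 <= Re (W t x)) by (intros; apply Csqrt_Re_ge0).
destruct (Hlow (sqrt (eta / 2))) as [delta [Hdelta Hd]]; [apply sqrt_lt_R0; lra|].
set (c := Rmin (sqrt (eta / 2)) delta).
assert (Hc : 0 < c) by (apply Rmin_pos; auto; apply sqrt_lt_R0; lra).
assert (Hc1 : c ^ 2 <= eta / 2).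
{ rewrite <- (pow2_sqrt (eta / 2)) by lra; apply pow_incr; split; [lra|apply Rmin_l]. }
assert (Hc2 : c <= delta) by apply Rmin_r.
(* A lower bound for the real part, uniform along the path. If [|s|] is large, then [Re s >= delta],
   and adding [t >= 0] to the square cannot decrease the real part of the root: otherwise both
   [a^2 < u^2] and [b^2 < v^2], against [a b = u v]. If [|s|^2 < eta / 2], then [s^2 + t] itself has
   real part at least [eta / 2]. *)
assert (WRe : forall t x, eta <= t -> c <= Re (W t x)).
{ intros t x Ht.
  apply Rsqr_incr_0_var; [|apply W0].
  rewrite 2!Rsqr_pow2.
  generalize (W2 t x) (W0 t x) (Hre x) (Cmod_sqr (s x)) (Hd x) (Cmod_ge_0 (s x)).
  destruct (W t x) as [a b]; destruct (s x) as [u v]; unfold Re, Im; simpl fst; simpl snd.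
  unfold Cpow, Cmult, Cplus; simpl.
  intros E Ha Hu Hm Hdx Hm0.
  injection E as E1 E2.
  assert (E1' : a * a - b * b = u * u - v * v + t) by lra.
  assert (E2' : a * b = u * v) by lra.
  destruct (Rle_or_lt (sqrt (eta / 2)) (Cmod (u, v))) as [Hbig|Hsmall].
  - specialize (Hdx Hbig).
    assert (Hua : u <= a).
    { destruct (Rle_or_lt u a) as [H|H]; auto; exfalso.
      assert (a * a < u * u) by nra.
      assert (b * b < v * v) by lra.
      assert (a * a * (b * b) < u * u * (v * v) \/ u * u * (v * v) = 0).
      { destruct (Req_dec v 0); [right; nra|left; apply Rmult_le_0_lt_compat; nra]. }
      replace (a * a * (b * b)) with ((a * b) * (a * b)) in H2 by ring.
      replace (u * u * (v * v)) with ((u * v) * (u * v)) in H2 by ring.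
      rewrite E2' in H2; destruct H2; [lra|].
      assert (0 < u) by lra. assert (0 < v * v) by nra. nra. }
    nra.
  - assert (Cmod (u, v) ^ 2 <= eta / 2).
    { rewrite <- (pow2_sqrt (eta / 2)) by lra; apply pow_incr; lra. }
    nra. }
assert (Wmod : forall t x, eta <= t -> c <= Cmod (W t x)).
{ intros t x Ht; generalize (WRe t x Ht) (re_le_Cmod (W t x)) (Rle_abs (Re (W t x))); lra. }
assert (Wn0 : forall t x, eta <= t -> W t x <> 0%C).
{ intros t x Ht; apply Cmod_gt_0; generalize (Wmod t x Ht); lra. }
pose (P := fun t => A (W t) /\ A (fun x => / W t x)%C).
(* For large [t] the root is close to the constant [sqrt t]: [|W - sqrt t| |W + sqrt t| = |s|^2 <= t
   / 4] and the second factor is at least [sqrt t]. *)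
assert (Hstart : forall t, eta <= t -> 4 * M ^ 2 <= t -> P t).
{ intros t Ht HtM.
  assert (Hst : 0 < sqrt t) by (apply sqrt_lt_R0; lra).
  assert (Hss : sqrt t * sqrt t = t) by (apply sqrt_sqrt; lra).
  apply (ca_sqrt_step A (fun _ => RtoC (sqrt t)) (W t)); auto; try apply (ca_const _ HA).
  - intros _ E; apply RtoC_inj in E; lra.
  - intros x; rewrite Cmod_R, (Rabs_pos_eq (sqrt t)) by lra.
    assert (E : ((W t x - RtoC (sqrt t)) * (W t x + RtoC (sqrt t)))%C = (s x ^ 2)%C).
    { transitivity (W t x ^ 2 - RtoC (sqrt t) * RtoC (sqrt t))%C; [simpl; ring|].
      rewrite W2, <- RtoC_mult, Hss; ring. }
    apply (f_equal Cmod) in E; rewrite Cmod_mult, Cmod_pow in E.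
    assert (Hplus : sqrt t <= Cmod (W t x + RtoC (sqrt t))).
    { generalize (re_le_Cmod (W t x + RtoC (sqrt t))) (Rle_abs (Re (W t x + RtoC (sqrt t)))).
      rewrite re_plus, re_RtoC; generalize (W0 t x); lra. }
    assert (Cmod (s x) ^ 2 <= M ^ 2) by (apply pow_incr; split; [apply Cmod_ge_0|auto]).
    generalize (Cmod_ge_0 (W t x - RtoC (sqrt t))); nra. }
(* Consecutive roots satisfy [|W t - W (t + d)| |W t + W (t + d)| = d] with second factor at least
   [2 c], so they differ by at most [c / 4], the tolerance of [ca_sqrt_step]. *)
set (d := c ^ 2 / 2).
assert (Hdpos : 0 < d) by (unfold d; nra).
assert (Hstep : forall t, eta <= t -> P (t + d) -> P t).
{ intros t Ht [H1 H2].
  assert (Ht' : eta <= t + d) by lra.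
  apply (ca_sqrt_step A (W (t + d)) (W t)); auto.
  intros x.
  assert (E : ((W t x - W (t + d)%R x) * (W t x + W (t + d)%R x))%C = RtoC (- d)).
  { transitivity (W t x ^ 2 - W (t + d)%R x ^ 2)%C; [simpl; ring|].
    rewrite 2!W2, RtoC_plus, RtoC_opp; ring. }
  apply (f_equal Cmod) in E; rewrite Cmod_mult, Cmod_R, Rabs_Ropp, Rabs_pos_eq in E by lra.
  assert (Hplus : 2 * c <= Cmod (W t x + W (t + d)%R x)).
  { generalize (re_le_Cmod (W t x + W (t + d)%R x)) (Rle_abs (Re (W t x + W (t + d)%R x))).
    rewrite re_plus; generalize (WRe t x Ht) (WRe (t + d) x Ht'); lra. }
  generalize (Cmod_ge_0 (W t x - W (t + d)%R x)) (Wmod (t + d) x Ht').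
  unfold d in *; nra. }
assert (Hdesc : forall n, P (eta + INR n * d) -> P eta).
{ induction n as [|n IH]; intros Hn.
  - simpl in Hn; replace (eta + 0 * d) with eta in Hn by ring; auto.
  - apply IH, Hstep.
    + generalize (pos_INR n); nra.
    + rewrite S_INR in Hn; replace (eta + INR n * d + d) with (eta + (INR n + 1) * d) by ring; auto. }
destruct (INR_unbounded (4 * M ^ 2 / d)) as [n Hn].
assert (HP : P eta).
{ apply (Hdesc n), Hstart.
  - generalize (pos_INR n); nra.
  - apply Rmult_gt_compat_r with (r := d) in Hn; auto.
    rewrite Rdiv_mult_cancel in Hn by lra; lra. }
exists (W eta); split; [apply HP|].
intros x.
assert (E : ((W eta x - s x) * (W eta x + s x))%C = RtoC eta).
{ transitivity (W eta x ^ 2 - s x ^ 2)%C; [simpl; ring|]. rewrite W2; ring. }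
apply (f_equal Cmod) in E; rewrite Cmod_mult, Cmod_R, Rabs_pos_eq in E by lra.
(* Equivalent to [Re (W conj s) >= 0]. The real parts are nonnegative, and the imaginary parts have
   nonnegative product because [a b = u v] with [a > 0] and [u >= 0]. *)
assert (Hcmp : Cmod (W eta x - s x) <= Cmod (W eta x + s x)).
{ apply Rsqr_incr_0_var; [|apply Cmod_ge_0].
  rewrite 2!Rsqr_pow2, 2!Cmod_sqr.
  generalize (W2 eta x) (WRe eta x (Rle_refl _)) (Hre x).
  destruct (W eta x) as [a b]; destruct (s x) as [u v]; unfold Re, Im; simpl fst; simpl snd.
  unfold Cpow, Cmult, Cplus; simpl.
  intros E' Ha Hu; injection E' as E1 E2.
  assert (E2' : a * b = u * v) by lra.
  assert (0 <= b * v).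
  { assert (0 <= a * (b * v)) by (replace (a * (b * v)) with (u * (v * v)) by (rewrite <- (Rmult_assoc a), E2'; ring); apply Rmult_le_pos; nra).
    apply Rmult_le_reg_l with a; lra. }
  nra. }
rewrite Cmod_minus_sym.
assert (Heta2 : eta = eps * eps) by (unfold eta; ring).
rewrite Heta2 in E at 3.
destruct (Rle_or_lt (Cmod (W eta x - s x)) eps) as [H|H]; auto.
exfalso; revert E Hcmp H; set (p := Cmod _); set (q := Cmod _); intros; nra.
Qed.

(** * Integration over rectangles and Goursat's lemma *)

Lemma continuous_at_C_path (f : C -> C) (p : R -> C) (t : R) :
  continuous_at_C f (p t) -> (forall s s', Cmod (p s - p s') <= Rabs (s - s')) ->
  continuous (fun s => Re (f (p s))) t /\ continuous (fun s => Im (f (p s))) t.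
Proof.
intros Hf Hp.
assert (H : forall eps : posreal, exists delta : posreal, forall s, Rabs (s - t) < delta ->
  Cmod (f (p s) - f (p t)) < eps).
{ intros eps; destruct (Hf eps (cond_pos eps)) as [d [Hd H]].
  exists (mkposreal d Hd); intros s Hs; apply H.
  apply Rle_lt_trans with (1 := Hp _ _); exact Hs. }
split; intros P [eps HP]; destruct (H eps) as [d Hd]; exists d; intros s Hs; apply HP;
  specialize (Hd s Hs).
- change (Rabs (Re (f (p s) - f (p t))) < eps).
  apply Rle_lt_trans with (2 := Hd), re_le_Cmod.
- change (Rabs (Im (f (p s) - f (p t))) < eps).
  apply Rle_lt_trans with (2 := Hd), Im_le_Cmod.
Qed.

Definition continuous_CR (g : R -> C) (t : R) : Prop :=
  continuous (fun s => Re (g s)) t /\ continuous (fun s => Im (g s)) t.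

Definition CInt (g : R -> C) (a b : R) : C :=
  (RInt (fun t => Re (g t)) a b, RInt (fun t => Im (g t)) a b).

Lemma ex_CInt (g : R -> C) (a b : R) :
  a <= b -> (forall t, a <= t <= b -> continuous_CR g t) ->
  ex_RInt (fun t => Re (g t)) a b /\ ex_RInt (fun t => Im (g t)) a b.
Proof.
intros Hab H; split; apply (ex_RInt_continuous (V := R_CompleteNormedModule));
  rewrite Rmin_left, Rmax_right by auto; intros t Ht; apply (H t Ht).
Qed.

Lemma CInt_Chasles (g : R -> C) (a b c : R) :
  a <= b <= c -> (forall t, a <= t <= c -> continuous_CR g t) ->
  CInt g a c = (CInt g a b + CInt g b c)%C.
Proof.
intros Habc H.
destruct (ex_CInt g a b) as [H1 H2]; [lra|intros; apply H; lra|].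
destruct (ex_CInt g b c) as [H3 H4]; [lra|intros; apply H; lra|].
unfold CInt, Cplus; simpl; f_equal; symmetry; apply (RInt_Chasles (V := R_CompleteNormedModule)); auto.
Qed.

Lemma CInt_ext (g h : R -> C) (a b : R) :
  a <= b -> (forall t, a <= t <= b -> g t = h t) -> CInt g a b = CInt h a b.
Proof.
intros Hab H; unfold CInt; f_equal; apply RInt_ext;
  rewrite Rmin_left, Rmax_right by auto; intros t Ht; rewrite H; auto; lra.
Qed.

Lemma Cminus_plus_cancel (a b : C) : a = (a - b + b)%C.
Proof. ring. Qed.

Lemma CInt_const (c : C) (a b : R) : CInt (fun _ => c) a b = (RtoC (b - a) * c)%C.
Proof.
unfold CInt; rewrite 2!RInt_const; destruct c as [x y].
unfold scal; simpl; unfold mult; simpl; unfold Cmult; simpl; f_equal; ring.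
Qed.

Lemma CInt_plus (g h : R -> C) (a b : R) :
  a <= b -> (forall t, a <= t <= b -> continuous_CR g t) ->
  (forall t, a <= t <= b -> continuous_CR h t) ->
  CInt (fun t => g t + h t)%C a b = (CInt g a b + CInt h a b)%C.
Proof.
intros Hab Hg Hh.
destruct (ex_CInt g a b Hab Hg) as [H1 H2].
destruct (ex_CInt h a b Hab Hh) as [H3 H4].
unfold CInt, Cplus; simpl; f_equal.
- rewrite <- (RInt_plus (V := R_CompleteNormedModule)); auto.
- rewrite <- (RInt_plus (V := R_CompleteNormedModule)); auto.
Qed.

Lemma CInt_scal (c : C) (g : R -> C) (a b : R) :
  a <= b -> (forall t, a <= t <= b -> continuous_CR g t) ->
  CInt (fun t => c * g t)%C a b = (c * CInt g a b)%C.
Proof.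
intros Hab Hg.
destruct (ex_CInt g a b Hab Hg) as [H1 H2].
assert (H1' := fun k => ex_RInt_scal (V := R_CompleteNormedModule) _ a b k H1).
assert (H2' := fun k => ex_RInt_scal (V := R_CompleteNormedModule) _ a b k H2).
destruct c as [u v]; apply injective_projections.
- transitivity (RInt (fun t => minus (scal u (Re (g t))) (scal v (Im (g t)))) a b);
    [reflexivity|].
  rewrite (RInt_minus (V := R_CompleteNormedModule)), !(RInt_scal (V := R_CompleteNormedModule));
    auto; reflexivity.
- transitivity (RInt (fun t => plus (scal u (Im (g t))) (scal v (Re (g t)))) a b);
    [reflexivity|].
  rewrite (RInt_plus (V := R_CompleteNormedModule)), !(RInt_scal (V := R_CompleteNormedModule));
    auto; reflexivity.
Qed.

(** The integral is taken componentwise and the two components are estimated separately, whence the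
    factor 2. *)
Lemma CInt_bound (g : R -> C) (a b M : R) :
  a <= b -> (forall t, a <= t <= b -> continuous_CR g t) ->
  (forall t, a <= t <= b -> Cmod (g t) <= M) ->
  Cmod (CInt g a b) <= 2 * M * (b - a).
Proof.
intros Hab Hg HM.
destruct (ex_CInt g a b Hab Hg) as [H1 H2].
apply Rle_trans with (1 := Cmod_le_ReIm _); unfold CInt, Re, Im; simpl.
assert (Rabs (RInt (fun t => Re (g t)) a b) <= (b - a) * M).
{ apply abs_RInt_le_const; auto; intros t Ht.
  apply Rle_trans with (1 := re_le_Cmod _); auto. }
assert (Rabs (RInt (fun t => Im (g t)) a b) <= (b - a) * M).
{ apply abs_RInt_le_const; auto; intros t Ht.
  apply Rle_trans with (1 := Im_le_Cmod _); auto. }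
unfold Re, Im in *; lra.
Qed.

(** * Complex differentiability in one variable *)

Definition cdiff (f : C -> C) (z l : C) : Prop :=
  forall eps, 0 < eps -> exists delta, 0 < delta /\ forall k,
    Cmod k < delta -> Cmod (f (z + k) - f z - l * k)%C <= eps * Cmod k.

Lemma cdiff_locally_lipschitz (f : C -> C) (z l : C) :
  cdiff f z l -> exists delta, 0 < delta /\
    forall w, Cmod (w - z) < delta -> Cmod (f w - f z) <= (Cmod l + 1) * Cmod (w - z).
Proof.
intros H; destruct (H 1 Rlt_0_1) as [d [Hd H1]]; exists d; split; auto.
intros w Hw; specialize (H1 (w - z)%C Hw).
replace (z + (w - z))%C with w in H1 by ring.
generalize (Cmod_triangle (f w - f z - l * (w - z)) (l * (w - z))).
rewrite Cmod_mult; replace (f w - f z - l * (w - z) + l * (w - z))%C with (f w - f z)%C by ring.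
lra.
Qed.

Lemma locally_lipschitz_continuous (f : C -> C) (z : C) (L d : R) :
  0 < d -> (forall w, Cmod (w - z) < d -> Cmod (f w - f z) <= L * Cmod (w - z)) ->
  continuous_at_C f z.
Proof.
intros Hd H eps Heps.
assert (Hpos : 0 < eps / (Rabs L + 1)).
{ apply Rdiv_lt_0_compat; auto; generalize (Rabs_pos L); lra. }
exists (Rmin d (eps / (Rabs L + 1))); split; [apply Rmin_pos; auto|].
intros w Hw.
assert (Hw1 := Rlt_le_trans _ _ _ Hw (Rmin_l _ _)).
assert (Hw2 := Rlt_le_trans _ _ _ Hw (Rmin_r _ _)).
apply Rle_lt_trans with (1 := H w Hw1).
apply Rle_lt_trans with ((Rabs L + 1) * Cmod (w - z)).
- apply Rmult_le_compat_r; [apply Cmod_ge_0|generalize (Rle_abs L); lra].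
- apply Rmult_lt_compat_r with (r := Rabs L + 1) in Hw2; [|generalize (Rabs_pos L); lra].
  replace (eps / (Rabs L + 1) * (Rabs L + 1)) with eps in Hw2
    by (field; generalize (Rabs_pos L); lra).
  lra.
Qed.

Lemma cdiff_continuous (f : C -> C) (z l : C) : cdiff f z l -> continuous_at_C f z.
Proof.
intros H; destruct (cdiff_locally_lipschitz f z l H) as [d [Hd H1]].
apply locally_lipschitz_continuous with (Cmod l + 1) d; auto.
Qed.

Lemma cdiff_ext_loc (f g : C -> C) (z l : C) (d : R) :
  0 < d -> (forall w, Cmod (w - z) < d -> g w = f w) -> cdiff f z l -> cdiff g z l.
Proof.
intros Hd H Hf eps Heps; destruct (Hf eps Heps) as [d' [Hd' Hf']].
exists (Rmin d d'); split; [apply Rmin_pos; auto|].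
intros k Hk.
assert (Hk1 := Rlt_le_trans _ _ _ Hk (Rmin_l _ _)).
rewrite 2!H.
- apply Hf', (Rlt_le_trans _ _ _ Hk), Rmin_r.
- rewrite Cminus_diag; rewrite Cmod_0; auto.
- replace (z + k - z)%C with k by ring; auto.
Qed.

Lemma cdiff_const (c z : C) : cdiff (fun _ => c) z 0.
Proof.
intros eps Heps; exists 1; split; [lra|]; intros k _.
replace (c - c - 0 * k)%C with (RtoC 0) by ring; rewrite Cmod_0.
generalize (Cmod_ge_0 k); nra.
Qed.

Lemma cdiff_minus (f g : C -> C) (z a b : C) :
  cdiff f z a -> cdiff g z b -> cdiff (fun w => f w - g w)%C z (a - b)%C.
Proof.
intros Hf Hg eps Heps.
destruct (Hf (eps / 2)) as [d1 [Hd1 H1]]; [lra|].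
destruct (Hg (eps / 2)) as [d2 [Hd2 H2]]; [lra|].
exists (Rmin d1 d2); split; [apply Rmin_pos; auto|].
intros k Hk.
specialize (H1 k (Rlt_le_trans _ _ _ Hk (Rmin_l _ _))).
specialize (H2 k (Rlt_le_trans _ _ _ Hk (Rmin_r _ _))).
replace (f (z + k) - g (z + k) - (f z - g z) - (a - b) * k)%C
  with ((f (z + k) - f z - a * k) + - (g (z + k) - g z - b * k))%C by ring.
cmod_triangle; rewrite Cmod_opp; lra.
Qed.

(** The quotient rule, with the derivative written so that the remainder is that of [f] minus a term
    quadratic in [k], all divided by [z + k - w]. *)
Lemma cdiff_div_shift (f : C -> C) (z a w : C) :
  cdiff f z a -> z <> w ->
  cdiff (fun u => f u / (u - w))%C z ((a - f z / (z - w)) / (z - w))%C.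
Proof.
intros Hf Hzw.
assert (Hz0 : (z - w)%C <> 0%C).
{ intros E; apply Hzw; replace z with ((z - w) + w)%C by ring; rewrite E; ring. }
set (m := Cmod (z - w)).
assert (Hm : 0 < m) by (apply Cmod_gt_0; auto).
set (b := Cmod (a - f z / (z - w))).
assert (Hb : 0 <= b) by apply Cmod_ge_0.
intros eps Heps.
destruct (Hf (eps * m / 4)) as [d [Hd H1]]; [apply Rdiv_lt_0_compat; nra|].
set (d2 := eps * (m * m) / (4 * (b + 1))).
assert (Hd2 : 0 < d2) by (apply Rdiv_lt_0_compat; [apply Rmult_lt_0_compat; nra|lra]).
exists (Rmin d (Rmin (m / 2) d2)); split; [repeat apply Rmin_pos; auto; lra|].
intros k Hk.
assert (Hk1 := Rlt_le_trans _ _ _ Hk (Rmin_l _ _)).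
assert (Hk2 := Rlt_le_trans _ _ _ Hk (Rmin_r _ _)).
assert (Hk3 := Rlt_le_trans _ _ _ Hk2 (Rmin_l _ _)).
assert (Hk4 := Rlt_le_trans _ _ _ Hk2 (Rmin_r _ _)).
specialize (H1 k Hk1).
assert (Hp : m / 2 <= Cmod (z + k - w)).
{ generalize (Cmod_triangle_inv (z - w) (- k)); rewrite Cmod_opp.
  replace (z - w - - k)%C with (z + k - w)%C by ring; fold m; lra. }
assert (Hp0 : (z + k - w)%C <> 0%C) by (apply Cmod_gt_0; lra).
replace (f (z + k) / (z + k - w) - f z / (z - w) - (a - f z / (z - w)) / (z - w) * k)%C
  with (((f (z + k) - f z - a * k) - (a - f z / (z - w)) * (k * k) / (z - w)) / (z + k - w))%C
  by (field; auto).
rewrite Cmod_div by auto.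
apply Rmult_le_reg_r with (Cmod (z + k - w)); [lra|].
rewrite Rdiv_mult_cancel by lra.
cmod_triangle.
rewrite Cmod_opp, Cmod_div, 2!Cmod_mult by auto; fold b; fold m.
assert (b * (Cmod k * Cmod k) / m <= eps * m / 4 * Cmod k).
{ apply Rmult_le_reg_r with m; auto.
  rewrite Rdiv_mult_cancel by lra.
  assert (b * Cmod k <= eps * (m * m) / 4).
  { apply Rle_trans with (b * d2).
    - apply Rmult_le_compat_l; lra.
    - apply Rmult_le_reg_r with (b + 1); [lra|].
      unfold d2; replace (b * (eps * (m * m) / (4 * (b + 1))) * (b + 1))
        with (b * (eps * (m * m) / 4)) by (field; lra).
      assert (0 <= eps * (m * m) / 4) by nra. nra. }
  generalize (Cmod_ge_0 k); nra. }
generalize (Cmod_ge_0 k); intros Hk0.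
assert (eps * Cmod k * (m / 2) <= eps * Cmod k * Cmod (z + k - w)) by (apply Rmult_le_compat_l; nra).
nra.
Qed.

(** * Counterclockwise boundary integrals over rectangles *)

Definition RectInt (f : C -> C) (x1 x2 y1 y2 : R) : C :=
  (CInt (fun x => f (x, y1)) x1 x2 + Ci * CInt (fun y => f (x2, y)) y1 y2
   - CInt (fun x => f (x, y2)) x1 x2 - Ci * CInt (fun y => f (x1, y)) y1 y2)%C.

Definition on_rect (P : C -> Prop) (x1 x2 y1 y2 : R) : Prop :=
  forall x y, x1 <= x <= x2 -> y1 <= y <= y2 -> P (x, y).

(** Restricted to the boundary because the Cauchy kernel is singular inside the rectangle. *)
Definition on_edges (P : C -> Prop) (x1 x2 y1 y2 : R) : Prop :=
  forall x y, x1 <= x <= x2 -> y1 <= y <= y2 ->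
    x = x1 \/ x = x2 \/ y = y1 \/ y = y2 -> P (x, y).

Lemma on_rect_edges (P : C -> Prop) x1 x2 y1 y2 :
  on_rect P x1 x2 y1 y2 -> on_edges P x1 x2 y1 y2.
Proof. intros H x y Hx Hy _; auto. Qed.

Lemma continuous_CR_h (f : C -> C) (x y : R) :
  continuous_at_C f (x, y) -> continuous_CR (fun s => f (s, y)) x.
Proof.
intros H; apply (continuous_at_C_path f (fun s => (s, y)) x H).
intros s s'; apply Rle_trans with (1 := Cmod_le_ReIm _); unfold Re, Im; simpl.
replace (y + - y) with 0 by ring; rewrite Rabs_R0, Rplus_0_r; apply Rle_refl.
Qed.

Lemma continuous_CR_v (f : C -> C) (x y : R) :
  continuous_at_C f (x, y) -> continuous_CR (fun s => f (x, s)) y.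
Proof.
intros H; apply (continuous_at_C_path f (fun s => (x, s)) y H).
intros s s'; apply Rle_trans with (1 := Cmod_le_ReIm _); unfold Re, Im; simpl.
replace (x + - x) with 0 by ring; rewrite Rabs_R0, Rplus_0_l; apply Rle_refl.
Qed.

Ltac edge_cont H :=
  intros; first [apply continuous_CR_h | apply continuous_CR_v]; apply H; lra.

Lemma RectInt_split_x (f : C -> C) x1 m x2 y1 y2 :
  x1 <= m <= x2 -> y1 <= y2 -> on_edges (continuous_at_C f) x1 x2 y1 y2 ->
  RectInt f x1 x2 y1 y2 = (RectInt f x1 m y1 y2 + RectInt f m x2 y1 y2)%C.
Proof.
intros Hx Hy H; unfold RectInt.
rewrite (CInt_Chasles (fun x => f (x, y1)) x1 m x2) by (auto; edge_cont H).
rewrite (CInt_Chasles (fun x => f (x, y2)) x1 m x2) by (auto; edge_cont H).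
ring.
Qed.

Lemma RectInt_split_y (f : C -> C) x1 x2 y1 m y2 :
  x1 <= x2 -> y1 <= m <= y2 -> on_edges (continuous_at_C f) x1 x2 y1 y2 ->
  RectInt f x1 x2 y1 y2 = (RectInt f x1 x2 y1 m + RectInt f x1 x2 m y2)%C.
Proof.
intros Hx Hy H; unfold RectInt.
rewrite (CInt_Chasles (fun y => f (x1, y)) y1 m y2) by (auto; edge_cont H).
rewrite (CInt_Chasles (fun y => f (x2, y)) y1 m y2) by (auto; edge_cont H).
ring.
Qed.

Lemma RectInt_plus (f g : C -> C) x1 x2 y1 y2 :
  x1 <= x2 -> y1 <= y2 -> on_edges (continuous_at_C f) x1 x2 y1 y2 ->
  on_edges (continuous_at_C g) x1 x2 y1 y2 ->
  RectInt (fun z => f z + g z)%C x1 x2 y1 y2 =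
    (RectInt f x1 x2 y1 y2 + RectInt g x1 x2 y1 y2)%C.
Proof.
intros Hx Hy Hf Hg; unfold RectInt.
rewrite (CInt_plus (fun x => f (x, y1)) (fun x => g (x, y1))) by (auto; (edge_cont Hf || edge_cont Hg)).
rewrite (CInt_plus (fun x => f (x, y2)) (fun x => g (x, y2))) by (auto; (edge_cont Hf || edge_cont Hg)).
rewrite (CInt_plus (fun y => f (x1, y)) (fun y => g (x1, y))) by (auto; (edge_cont Hf || edge_cont Hg)).
rewrite (CInt_plus (fun y => f (x2, y)) (fun y => g (x2, y))) by (auto; (edge_cont Hf || edge_cont Hg)).
ring.
Qed.

Lemma RectInt_scal (c : C) (f : C -> C) x1 x2 y1 y2 :
  x1 <= x2 -> y1 <= y2 -> on_edges (continuous_at_C f) x1 x2 y1 y2 ->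
  RectInt (fun z => c * f z)%C x1 x2 y1 y2 = (c * RectInt f x1 x2 y1 y2)%C.
Proof.
intros Hx Hy Hf; unfold RectInt.
rewrite (CInt_scal c (fun x => f (x, y1))) by (auto; edge_cont Hf).
rewrite (CInt_scal c (fun x => f (x, y2))) by (auto; edge_cont Hf).
rewrite (CInt_scal c (fun y => f (x1, y))) by (auto; edge_cont Hf).
rewrite (CInt_scal c (fun y => f (x2, y))) by (auto; edge_cont Hf).
ring.
Qed.

Lemma RectInt_ext (f g : C -> C) x1 x2 y1 y2 :
  x1 <= x2 -> y1 <= y2 -> on_edges (fun z => f z = g z) x1 x2 y1 y2 ->
  RectInt f x1 x2 y1 y2 = RectInt g x1 x2 y1 y2.
Proof.
intros Hx Hy H; unfold RectInt.
rewrite (CInt_ext (fun x => f (x, y1)) (fun x => g (x, y1))) by (auto; intros; apply H; lra).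
rewrite (CInt_ext (fun x => f (x, y2)) (fun x => g (x, y2))) by (auto; intros; apply H; lra).
rewrite (CInt_ext (fun y => f (x1, y)) (fun y => g (x1, y))) by (auto; intros; apply H; lra).
rewrite (CInt_ext (fun y => f (x2, y)) (fun y => g (x2, y))) by (auto; intros; apply H; lra).
reflexivity.
Qed.

Lemma RectInt_bound (f : C -> C) x1 x2 y1 y2 M :
  x1 <= x2 -> y1 <= y2 -> on_edges (continuous_at_C f) x1 x2 y1 y2 ->
  on_edges (fun z => Cmod (f z) <= M) x1 x2 y1 y2 ->
  Cmod (RectInt f x1 x2 y1 y2) <= 4 * M * ((x2 - x1) + (y2 - y1)).
Proof.
intros Hx Hy Hf HM; unfold RectInt.
assert (B1 := CInt_bound (fun x => f (x, y1)) x1 x2 M Hx ltac:(edge_cont Hf) ltac:(intros; apply HM; lra)).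
assert (B2 := CInt_bound (fun x => f (x, y2)) x1 x2 M Hx ltac:(edge_cont Hf) ltac:(intros; apply HM; lra)).
assert (B3 := CInt_bound (fun y => f (x1, y)) y1 y2 M Hy ltac:(edge_cont Hf) ltac:(intros; apply HM; lra)).
assert (B4 := CInt_bound (fun y => f (x2, y)) y1 y2 M Hy ltac:(edge_cont Hf) ltac:(intros; apply HM; lra)).
assert (Hi : forall c, Cmod (Ci * c) = Cmod c) by (intros; rewrite Cmod_mult, Cmod_Ci; ring).
revert B1 B2 B3 B4.
set (I1 := CInt _ x1 x2); set (I2 := CInt _ x1 x2); set (I3 := CInt _ y1 y2); set (I4 := CInt _ y1 y2).
intros.
generalize (Cmod_triangle (I1 + Ci * I4 - I2) (- (Ci * I3)))
  (Cmod_triangle (I1 + Ci * I4) (- I2)) (Cmod_triangle I1 (Ci * I4)).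
rewrite !Cmod_opp, !Hi; unfold Cminus; lra.
Qed.

Lemma RInt_affine (a b x1 x2 : R) :
  RInt (fun t => a + b * t) x1 x2 = a * (x2 - x1) + b * (x2 ^ 2 - x1 ^ 2) / 2.
Proof.
apply is_RInt_unique.
replace (a * (x2 - x1) + b * (x2 ^ 2 - x1 ^ 2) / 2)
  with (minus (a * x2 + b * x2 ^ 2 / 2) (a * x1 + b * x1 ^ 2 / 2)).
2: { unfold minus, plus, opp; simpl; field. }
apply (is_RInt_derive (V := R_CompleteNormedModule) (fun t => a * t + b * t ^ 2 / 2)).
- intros; auto_derive; auto; field.
- intros; apply (ex_derive_continuous (fun t => a + b * t)); auto_derive; auto.
Qed.

Ltac expand := intros; unfold Re, Im, Cplus, Cmult; simpl; ring.

(** Computed edge by edge; in [goursat] it removes the first-order part of [f] at the limit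
    point. *)
Lemma RectInt_affine (a b : C) x1 x2 y1 y2 :
  RectInt (fun z => a + b * z)%C x1 x2 y1 y2 = 0%C.
Proof.
destruct a as [a1 a2]; destruct b as [b1 b2].
unfold RectInt, CInt.
assert (E : forall (f : R -> R) (c d : R) u v, (forall t, f t = c + d * t) ->
  RInt f u v = c * (v - u) + d * (v ^ 2 - u ^ 2) / 2).
{ intros f c d u v H; rewrite <- RInt_affine; apply RInt_ext; intros; apply H. }
rewrite (E (fun t => Re ((a1, a2) + (b1, b2) * (t, y1))) (a1 - b2 * y1) b1) by expand.
rewrite (E (fun t => Im ((a1, a2) + (b1, b2) * (t, y1))) (a2 + b1 * y1) b2) by expand.
rewrite (E (fun t => Re ((a1, a2) + (b1, b2) * (t, y2))) (a1 - b2 * y2) b1) by expand.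
rewrite (E (fun t => Im ((a1, a2) + (b1, b2) * (t, y2))) (a2 + b1 * y2) b2) by expand.
rewrite (E (fun t => Re ((a1, a2) + (b1, b2) * (x1, t))) (a1 + b1 * x1) (- b2)) by expand.
rewrite (E (fun t => Im ((a1, a2) + (b1, b2) * (x1, t))) (a2 + b2 * x1) b1) by expand.
rewrite (E (fun t => Re ((a1, a2) + (b1, b2) * (x2, t))) (a1 + b1 * x2) (- b2)) by expand.
rewrite (E (fun t => Im ((a1, a2) + (b1, b2) * (x2, t))) (a2 + b2 * x2) b1) by expand.
unfold Cminus, Cplus, Cmult, Copp, Ci, RtoC; simpl; f_equal; field.
Qed.

Lemma nested_intervals (a b : nat -> R) :
  (forall n, a n <= a (S n)) -> (forall n, b (S n) <= b n) -> (forall n, a n <= b n) ->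
  exists x, forall n, a n <= x <= b n.
Proof.
intros Ha Hb Hab.
assert (Ha' : forall n k, a n <= a (k + n)%nat).
{ intros n; induction k; simpl; [lra|]; generalize (Ha (k + n)%nat); lra. }
assert (Hb' : forall n k, b (k + n)%nat <= b n).
{ intros n; induction k; simpl; [lra|]; generalize (Hb (k + n)%nat); lra. }
assert (H : forall n m, a m <= b n).
{ intros n m; destruct (Nat.le_ge_cases m n) as [L|L].
  - generalize (Ha' m (n - m)%nat) (Hab n); replace (n - m + m)%nat with n by lia; lra.
  - generalize (Hb' n (m - n)%nat) (Hab m); replace (m - n + n)%nat with m by lia; lra. }
destruct (completeness (fun x => exists n, x = a n)) as [x [Hx1 Hx2]].
- exists (b 0%nat); intros x [n ->]; auto.
- exists (a 0%nat); exists 0%nat; auto.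
- exists x; intros n; split; [apply Hx1; exists n; auto|].
  apply Hx2; intros y [m ->]; auto.
Qed.

(** Bisection: a nonzero integral would leave nested rectangles on which the integral exceeds [eps]
    times the square of the half-perimeter. At their common point, [f] minus its first-order part is
    too small for that. *)
Lemma goursat (f : C -> C) x1 x2 y1 y2 :
  x1 <= x2 -> y1 <= y2 -> on_rect (fun z => exists l, cdiff f z l) x1 x2 y1 y2 ->
  RectInt f x1 x2 y1 y2 = 0%C.
Proof.
intros Hx Hy Hf.
destruct (classic (RectInt f x1 x2 y1 y2 = 0%C)) as [|Hne]; auto; exfalso.
assert (Hpos : 0 < Cmod (RectInt f x1 x2 y1 y2)) by (apply Cmod_gt_0; auto).
set (w := x2 - x1); set (h := y2 - y1).
assert (Hw : 0 <= w) by (unfold w; lra).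
assert (Hh : 0 <= h) by (unfold h; lra).
(* The [+ 1] in the denominator of the witness covers degenerate rectangles and makes the inequality
   strict. *)
assert (Heps : exists eps, 0 < eps /\ eps * (w + h) ^ 2 < Cmod (RectInt f x1 x2 y1 y2)).
{ set (m := Cmod (RectInt f x1 x2 y1 y2)) in *.
  assert (Hq : 0 < (w + h) ^ 2 + 1) by nra.
  exists (m / ((w + h) ^ 2 + 1)); split; [apply Rdiv_lt_0_compat; auto|].
  apply Rmult_lt_reg_r with ((w + h) ^ 2 + 1); auto.
  replace (m / ((w + h) ^ 2 + 1) * (w + h) ^ 2 * ((w + h) ^ 2 + 1)) with (m * (w + h) ^ 2)
    by (field; lra).
  nra. }
destruct Heps as [eps [Heps Hbad0]].
assert (Hc : on_rect (continuous_at_C f) x1 x2 y1 y2).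
{ intros x y Hxx Hyy; destruct (Hf x y Hxx Hyy) as [l Hl]; apply cdiff_continuous with l; auto. }
pose (u := fun n => (/ 2) ^ n).
assert (Hu0 : forall n, 0 < u n) by (intros n; apply pow_lt; lra).
assert (HuS : forall n, u (S n) = u n / 2) by (intros n; unfold u; simpl; field).
pose (In := fun n (p : R * R) => x1 <= fst p /\ fst p + w * u n <= x2 /\
                       y1 <= snd p /\ snd p + h * u n <= y2).
pose (J := fun n (p : R * R) =>
  RectInt f (fst p) (fst p + w * u n) (snd p) (snd p + h * u n)).
pose (Bad := fun n (p : R * R) => In n p /\ eps * ((w + h) * u n) ^ 2 < Cmod (J n p)).
(* The implication stands under the existential so that choice yields a total function [next]; a
   rectangle that is not bad is sent to itself. *)
assert (Step : forall n p, exists p', Bad n p -> Bad (S n) p' /\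
   fst p <= fst p' /\ fst p' + w * u (S n) <= fst p + w * u n /\
   snd p <= snd p' /\ snd p' + h * u (S n) <= snd p + h * u n).
{ intros n [x y].
  destruct (classic (Bad n (x, y))) as [HB|HB]; [|exists (x, y); tauto].
  destruct HB as [[I1 [I2 [I3 I4]]] HB]; simpl in *.
  set (a := w * u n) in *; set (b := h * u n) in *.
  assert (Ha : 0 <= a) by (unfold a; generalize (Hu0 n); nra).
  assert (Hb : 0 <= b) by (unfold b; generalize (Hu0 n); nra).
  assert (Ea : w * u (S n) = a / 2) by (unfold a; rewrite HuS; field).
  assert (Eb : h * u (S n) = b / 2) by (unfold b; rewrite HuS; field).
  assert (HJ : J n (x, y) = (J (S n) (x, y) + J (S n) (x, (y + b / 2)%R)
     + (J (S n) ((x + a / 2)%R, y) + J (S n) ((x + a / 2)%R, (y + b / 2)%R)))%C).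
  { unfold J; simpl fst; simpl snd; rewrite Ea, Eb; fold a; fold b.
    replace (x + a / 2 + a / 2) with (x + a) by field.
    replace (y + b / 2 + b / 2) with (y + b) by field.
    rewrite (RectInt_split_x f x (x + a / 2) (x + a)); try lra.
    2: { intros ? ? ? ? _; apply Hc; lra. }
    rewrite (RectInt_split_y f x (x + a / 2) y (y + b / 2) (y + b)); try lra.
    2: { intros ? ? ? ? _; apply Hc; lra. }
    rewrite (RectInt_split_y f (x + a / 2) (x + a) y (y + b / 2) (y + b)); try lra.
    2: { intros ? ? ? ? _; apply Hc; lra. }
    reflexivity. }
  assert (HQ : forall p, Bad (S n) p \/ ~ Bad (S n) p) by (intros; apply classic).
  assert (Hnb : forall p, In (S n) p -> ~ Bad (S n) p ->
     Cmod (J (S n) p) <= eps * ((w + h) * u n) ^ 2 / 4).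
  { intros p Hp Hn; apply Rnot_lt_le; intros Hlt; apply Hn; split; auto.
    apply Rle_lt_trans with (2 := Hlt); rewrite HuS.
    apply Req_le; field. }
  assert (K1 : In (S n) (x, y)) by (unfold In; simpl fst; simpl snd; lra).
  assert (K2 : In (S n) (x, y + b / 2)) by (unfold In; simpl fst; simpl snd; lra).
  assert (K3 : In (S n) (x + a / 2, y)) by (unfold In; simpl fst; simpl snd; lra).
  assert (K4 : In (S n) (x + a / 2, y + b / 2)) by (unfold In; simpl fst; simpl snd; lra).
  destruct (HQ (x, y)) as [B1|B1]; [exists (x, y); simpl fst; simpl snd; intros _; split; auto; lra|].
  destruct (HQ (x, y + b / 2)) as [B2|B2]; [eexists; intros _; split; [exact B2|]; simpl fst; simpl snd; lra|].
  destruct (HQ (x + a / 2, y)) as [B3|B3]; [eexists; intros _; split; [exact B3|]; simpl fst; simpl snd; lra|].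
  destruct (HQ (x + a / 2, y + b / 2)) as [B4|B4]; [eexists; intros _; split; [exact B4|]; simpl fst; simpl snd; lra|].
  exfalso.
  apply Hnb in B1; auto; apply Hnb in B2; auto; apply Hnb in B3; auto; apply Hnb in B4; auto.
  apply (f_equal Cmod) in HJ.
  generalize (Cmod_triangle (J (S n) (x, y) + J (S n) (x, (y + b / 2)%R))
     (J (S n) ((x + a / 2)%R, y) + J (S n) ((x + a / 2)%R, (y + b / 2)%R)))
   (Cmod_triangle (J (S n) (x, y)) (J (S n) (x, (y + b / 2)%R)))
   (Cmod_triangle (J (S n) ((x + a / 2)%R, y)) (J (S n) ((x + a / 2)%R, (y + b / 2)%R))).
  rewrite <- HJ; lra. }
pose (next := fun n p => proj1_sig (constructive_indefinite_description _ (Step n p))).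
assert (Hnext : forall n p, Bad n p -> Bad (S n) (next n p) /\
   fst p <= fst (next n p) /\ fst (next n p) + w * u (S n) <= fst p + w * u n /\
   snd p <= snd (next n p) /\ snd (next n p) + h * u (S n) <= snd p + h * u n).
{ intros n p; unfold next; destruct (constructive_indefinite_description _ (Step n p)); auto. }
pose (q := fix q n := match n with O => (x1, y1) | S m => next m (q m) end).
assert (HB : forall n, Bad n (q n)).
{ induction n as [|n IH]; [|apply (Hnext n (q n) IH)].
  assert (Eu : u 0%nat = 1) by reflexivity.
  split; [unfold In; simpl fst; simpl snd; rewrite Eu; unfold w, h; lra|].
  unfold J; simpl fst; simpl snd; rewrite Eu, !Rmult_1_r.
  unfold w at 2; unfold h at 2; replace (x1 + (x2 - x1)) with x2 by ring.
  replace (y1 + (y2 - y1)) with y2 by ring; exact Hbad0. }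
destruct (nested_intervals (fun n => fst (q n)) (fun n => fst (q n) + w * u n)) as [X HX].
{ intros n; simpl; apply (Hnext n (q n) (HB n)). }
{ intros n; simpl q; apply (Hnext n (q n) (HB n)). }
{ intros n; generalize (Hu0 n); nra. }
destruct (nested_intervals (fun n => snd (q n)) (fun n => snd (q n) + h * u n)) as [Y HY].
{ intros n; simpl; apply (Hnext n (q n) (HB n)). }
{ intros n; simpl q; apply (Hnext n (q n) (HB n)). }
{ intros n; generalize (Hu0 n); nra. }
destruct (Hf X Y) as [l Hl].
{ destruct (HB 0%nat) as [[I1 [I2 _]] _]; specialize (HX 0%nat); lra. }
{ destruct (HB 0%nat) as [[_ [_ [I3 I4]]] _]; specialize (HY 0%nat); lra. }
(* [eps / 4] compensates the factor 4 of [RectInt_bound]; [d / 2] on the next line makes the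
   distance to [(X, Y)] strictly less than [d]. *)
destruct (Hl (eps / 4)) as [d [Hd Hl']]; [lra|].
destruct (pow_small (/ 2) (w + h) (d / 2)) as [n Hn]; [lra|lra|].
fold (u n) in Hn.
destruct (HB n) as [[I1 [I2 [I3 I4]]] HBn].
specialize (HX n); specialize (HY n); revert HBn; apply Rle_not_lt.
unfold J; revert I1 I2 I3 I4 HX HY; destruct (q n) as [x y]; simpl fst; simpl snd; intros.
set (a := w * u n) in *; set (b := h * u n) in *.
assert (Ha : 0 <= a) by (unfold a; generalize (Hu0 n); nra).
assert (Hb : 0 <= b) by (unfold b; generalize (Hu0 n); nra).
assert (Hab : (w + h) * u n = a + b) by (unfold a, b; ring).
rewrite Hab; assert (Hdn : a + b <= d / 2) by lra.
pose (z0 := (X, Y) : C).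
assert (Haff : forall z, cdiff (fun z => (f z0 - l * z0) + l * z)%C z l).
{ intros z e He; exists 1; split; [lra|]; intros k _.
  replace (_ - _ - _)%C with (RtoC 0) by ring; rewrite Cmod_0; generalize (Cmod_ge_0 k); nra. }
assert (Hcr : on_rect (continuous_at_C (fun z => f z - ((f z0 - l * z0) + l * z)))%C x (x + a) y (y + b)).
{ intros s t Hs Ht; destruct (Hf s t) as [l' Hl2]; try lra.
  eapply cdiff_continuous, cdiff_minus; [exact Hl2|apply Haff]. }
assert (E : RectInt f x (x + a) y (y + b)
  = RectInt (fun z => f z - ((f z0 - l * z0) + l * z))%C x (x + a) y (y + b)).
{ transitivity (RectInt (fun z => (f z - ((f z0 - l * z0) + l * z)) + ((f z0 - l * z0) + l * z))%C x (x + a) y (y + b)).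
  - apply RectInt_ext; try lra; intros s t _ _ _. apply Cminus_plus_cancel.
  - rewrite RectInt_plus; try lra.
    + rewrite RectInt_affine; ring.
    + apply on_rect_edges; auto.
    + intros s t _ _ _; eapply cdiff_continuous, Haff. }
rewrite E.
apply Rle_trans with (4 * (eps / 4 * (a + b)) * (x + a - x + (y + b - y))); [|right; field].
apply RectInt_bound; try lra; [apply on_rect_edges; auto|].
intros s t Hs Ht _.
pose (z1 := (s, t) : C); change (f (s, t)) with (f z1).
change (Cmod (f z1 - (f z0 - l * z0 + l * z1)) <= eps / 4 * (a + b)).
assert (Hk : Cmod (z1 - z0) <= a + b).
{ apply Rle_trans with (1 := Cmod_le_ReIm _); unfold Re, Im; simpl.
  apply Rplus_le_compat; apply Rabs_le; lra. }
specialize (Hl' (z1 - z0)%C ltac:(lra)).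
change (Cmod (f (z0 + (z1 - z0))%C - f z0 - l * (z1 - z0)) <= eps / 4 * Cmod (z1 - z0)) in Hl'.
clearbody z1 z0.
replace (z0 + (z1 - z0))%C with z1 in Hl' by ring.
replace (f z1 - (f z0 - l * z0 + l * z1))%C
  with (f z1 - f z0 - l * (z1 - z0))%C by ring.
apply Rle_trans with (1 := Hl'); apply Rmult_le_compat_l; lra.
Qed.

(** * The Cauchy formula on squares *)

(** Cut out a square of half-side [s] about the point. The four rectangles around it contribute 0 by
    [goursat], and the square contributes [O(s)] since [f] is bounded near the point. *)
Lemma goursat_exceptional_point (f : C -> C) (x1 x2 y1 y2 u v d M : R) :
  x1 < u < x2 -> y1 < v < y2 -> 0 < d ->
  on_rect (fun z => z <> (u, v) -> exists l, cdiff f z l) x1 x2 y1 y2 ->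
  (forall z, z <> (u, v) -> Cmod (z - (u, v)) < d -> Cmod (f z) <= M) ->
  RectInt f x1 x2 y1 y2 = 0%C.
Proof.
intros Hu Hv Hd Hf HM.
assert (Hne : forall x y, x <> u \/ y <> v -> ((x, y) : C) <> (u, v)).
{ intros x y H E; injection E as E1 E2; lra. }
assert (Hc : on_rect (fun z => z <> (u, v) -> continuous_at_C f z) x1 x2 y1 y2).
{ intros x y Hx Hy Hn; destruct (Hf x y Hx Hy Hn) as [l Hl]; apply cdiff_continuous with l; auto. }
apply Cmod_eq_0, Rle_antisym; [|apply Cmod_ge_0].
apply le_epsilon; intros eps Heps; rewrite Rplus_0_l.
set (N := Rabs M + 1).
assert (HN : 0 < N) by (unfold N; generalize (Rabs_pos M); lra).
(* [d / 4] keeps the small square where [f] is bounded, [eps / (16 N)] makes its contribution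
   [16 N s] at most [eps], and the other terms keep it inside the rectangle. *)
set (s := Rmin (Rmin (d / 4) (eps / (16 * N)))
  (Rmin (Rmin ((u - x1) / 2) ((x2 - u) / 2)) (Rmin ((v - y1) / 2) ((y2 - v) / 2)))).
assert (Hs : 0 < s).
{ assert (0 < eps / (16 * N)) by (apply Rdiv_lt_0_compat; lra).
  unfold s; repeat apply Rmin_pos; lra. }
assert (Hs1 : s <= d / 4) by (unfold s; le_Rmin).
assert (Hs2 : s <= eps / (16 * N)) by (unfold s; le_Rmin).
assert (Hs3 : s <= (u - x1) / 2) by (unfold s; le_Rmin).
assert (Hs4 : s <= (x2 - u) / 2) by (unfold s; le_Rmin).
assert (Hs5 : s <= (v - y1) / 2) by (unfold s; le_Rmin).
assert (Hs6 : s <= (y2 - v) / 2) by (unfold s; le_Rmin).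
clearbody s.
assert (E : RectInt f x1 x2 y1 y2 = RectInt f (u - s) (u + s) (v - s) (v + s)).
{ rewrite (RectInt_split_x f x1 (u - s) x2); try lra.
  2: { intros x y Hx Hy Hxy; apply Hc; auto; apply Hne; lra. }
  rewrite (RectInt_split_x f (u - s) (u + s) x2); try lra.
  2: { intros x y Hx Hy Hxy; apply Hc; auto; [lra|]; apply Hne; lra. }
  rewrite (goursat f x1 (u - s)); try lra.
  2: { intros x y Hx Hy; apply Hf; auto; [lra|]; apply Hne; lra. }
  rewrite (goursat f (u + s) x2); try lra.
  2: { intros x y Hx Hy; apply Hf; auto; [lra|]; apply Hne; lra. }
  rewrite (RectInt_split_y f (u - s) (u + s) y1 (v - s) y2); try lra.
  2: { intros x y Hx Hy Hxy; apply Hc; auto; [lra|]; apply Hne; lra. }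
  rewrite (RectInt_split_y f (u - s) (u + s) (v - s) (v + s) y2); try lra.
  2: { intros x y Hx Hy Hxy; apply Hc; auto; [lra|lra|]; apply Hne; lra. }
  rewrite (goursat f (u - s) (u + s) y1 (v - s)); try lra.
  2: { intros x y Hx Hy; apply Hf; auto; [lra|lra|]; apply Hne; lra. }
  rewrite (goursat f (u - s) (u + s) (v + s) y2); try lra.
  2: { intros x y Hx Hy; apply Hf; auto; [lra|lra|]; apply Hne; lra. }
  ring. }
rewrite E.
apply Rle_trans with (4 * N * ((u + s) - (u - s) + ((v + s) - (v - s)))).
- apply RectInt_bound; try lra.
  + intros x y Hx Hy Hxy; apply Hc; try lra; apply Hne; lra.
  + intros x y Hx Hy Hxy.
    apply Rle_trans with M; [|unfold N; generalize (Rle_abs M); lra].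
    apply HM; [apply Hne; lra|].
    apply Rle_lt_trans with (1 := Cmod_le_ReIm _); unfold Re, Im; simpl.
    assert (Rabs (x + - u) <= s) by (apply Rabs_le; lra).
    assert (Rabs (y + - v) <= s) by (apply Rabs_le; lra).
    lra.
- apply Rmult_le_compat_r with (r := 16 * N) in Hs2; [|lra].
  rewrite Rdiv_mult_cancel in Hs2 by lra; lra.
Qed.

Definition SqInt (r : R) (f : C -> C) : C := RectInt f (-r) r (-r) r.

Definition on_square (r : R) (P : C -> Prop) : Prop := on_rect P (-r) r (-r) r.

Lemma Cmod_le_square (r : R) (w : C) :
  Cmod w <= r -> - r <= fst w <= r /\ - r <= snd w <= r.
Proof.
intros H.
assert (H1 := re_le_Cmod w); assert (H2 := Im_le_Cmod w); unfold Re, Im in *.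
generalize (Rle_abs (fst w)) (Rle_abs (- fst w)) (Rle_abs (snd w)) (Rle_abs (- snd w)).
rewrite 2!Rabs_Ropp; lra.
Qed.

Lemma square_edge_dist (r : R) (w : C) :
  0 < r -> Cmod w <= r / 2 -> on_edges (fun z => r / 2 <= Cmod (z - w)) (- r) r (- r) r.
Proof.
intros HR Hw x y Hx Hy Hxy.
destruct (Cmod_le_square _ _ Hw) as [H1 H2].
assert (H3 := re_le_Cmod ((x, y) - w)); assert (H4 := Im_le_Cmod ((x, y) - w)).
destruct w as [u v]; simpl in H1, H2; unfold Re, Im in *; simpl in H3, H4.
assert (r / 2 <= Rabs (x + - u) \/ r / 2 <= Rabs (y + - v)).
{ unfold Rabs; destruct (Rcase_abs (x + - u)); destruct (Rcase_abs (y + - v)); lra. }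
simpl; lra.
Qed.

Lemma Cdiv_minus_const (p a d : C) : ((p - a) / d = p / d + - a * (1 / d))%C.
Proof. unfold Cdiv; ring. Qed.

(** The difference quotient [(f z - f w) / (z - w)] is bounded near [w], because differentiability
    makes [f] Lipschitz there; hence its integral vanishes even though [w] is exceptional. *)
Lemma cauchy_formula (r : R) (f : C -> C) (w : C) :
  0 < r -> on_square r (fun z => exists l, cdiff f z l) -> Cmod w <= r / 2 ->
  SqInt r (fun z => f z / (z - w))%C = (f w * SqInt r (fun z => 1 / (z - w)))%C.
Proof.
intros HR Hf Hw.
destruct (Cmod_le_square _ _ Hw) as [Hw1 Hw2].
assert (Hedge := square_edge_dist r w HR Hw).
assert (Hn : on_edges (fun z => z <> w) (- r) r (- r) r).
{ intros x y Hx Hy Hxy E; specialize (Hedge x y Hx Hy Hxy); simpl in Hedge.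
  rewrite E in Hedge; rewrite Cminus_diag in Hedge.
  rewrite Cmod_0 in Hedge; lra. }
assert (Hcd : forall (h : C -> C) z l, cdiff h z l -> z <> w -> continuous_at_C (fun z => h z / (z - w))%C z).
{ intros h z l Hh Hz; eapply cdiff_continuous, cdiff_div_shift; eauto. }
assert (H0 : SqInt r (fun z => (f z - f w) / (z - w))%C = 0%C).
{ destruct (Hf (fst w) (snd w)) as [l Hl]; try lra.
  rewrite <- surjective_pairing in Hl.
  destruct (cdiff_locally_lipschitz f w l Hl) as [d [Hd Hlip]].
  unfold SqInt; apply goursat_exceptional_point with (fst w) (snd w) d (Cmod l + 1); try lra.
  - rewrite <- surjective_pairing; intros x y Hx Hy Hxy.
    destruct (Hf x y Hx Hy) as [l' Hl'].
    eexists; apply cdiff_div_shift; auto.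
    apply (cdiff_minus f (fun _ => f w)); [exact Hl'|apply cdiff_const].
  - rewrite <- surjective_pairing; intros z Hz Hzd.
    assert (Hz0 : (z - w)%C <> 0%C).
    { intros E; apply Hz; replace z with ((z - w) + w)%C by ring; rewrite E; apply Cplus_0_l. }
    rewrite Cmod_div by auto.
    apply Cmod_gt_0 in Hz0.
    apply Rmult_le_reg_r with (Cmod (z - w)); auto.
    rewrite Rdiv_mult_cancel by lra; auto. }
assert (Hc1 : on_edges (continuous_at_C (fun z => 1 / (z - w)))%C (-r) r (-r) r).
{ intros x y Hx Hy Hxy; apply (Hcd (fun _ => RtoC 1) _ 0%C); [apply cdiff_const|apply Hn; auto]. }
assert (Hc2 : on_edges (continuous_at_C (fun z => f z / (z - w)))%C (-r) r (-r) r).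
{ intros x y Hx Hy Hxy; destruct (Hf x y Hx Hy) as [l Hl].
  apply (Hcd f _ l); [auto|apply Hn; auto]. }
assert (Hc3 : on_edges (continuous_at_C (fun z => (- f w) * (1 / (z - w))))%C (-r) r (-r) r).
{ intros x y Hx Hy Hxy; apply cdiff_continuous with ((0 - (- f w) / ((x, y) - w)) / ((x, y) - w))%C.
  apply (cdiff_ext_loc (fun z => (- f w) / (z - w))%C _ _ _ 1); [lra| |].
  - intros z _; unfold Cdiv; ring.
  - apply (cdiff_div_shift (fun _ => - f w)%C); [apply cdiff_const|apply Hn; auto]. }
assert (E : SqInt r (fun z => (f z - f w) / (z - w))%C
  = (SqInt r (fun z => f z / (z - w)) + - f w * SqInt r (fun z => 1 / (z - w)))%C).
{ unfold SqInt; rewrite <- RectInt_scal, <- RectInt_plus; auto; try lra.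
  apply RectInt_ext; try lra.
  intros x y _ _ _; apply Cdiv_minus_const. }
rewrite H0 in E.
replace (SqInt r (fun z => f z / (z - w))%C) with
  (SqInt r (fun z => f z / (z - w)) + - f w * SqInt r (fun z => 1 / (z - w))
   + f w * SqInt r (fun z => 1 / (z - w)))%C by ring.
rewrite <- E; ring.
Qed.

Lemma RInt_lower_bound (f : R -> R) (a b m : R) :
  a <= b -> (forall t, a <= t <= b -> continuous f t) ->
  (forall t, a <= t <= b -> m <= f t) -> m * (b - a) <= RInt f a b.
Proof.
intros Hab Hf Hm.
replace (m * (b - a)) with (RInt (fun _ => m) a b).
2: { rewrite RInt_const; unfold scal; simpl; unfold mult; simpl; ring. }
apply RInt_le; auto.
- apply ex_RInt_const.
- apply (ex_RInt_continuous (V := R_CompleteNormedModule)).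
  rewrite Rmin_left, Rmax_right by auto; auto.
- intros; apply Hm; lra.
Qed.

Lemma Re_Cinv_pair (p q : R) : Re (1 / ((p, q) : C))%C = p / (p ^ 2 + q ^ 2).
Proof. unfold Re, Cdiv, Cinv, Cmult, RtoC; simpl; unfold Rdiv; ring. Qed.

Lemma Im_Cinv_pair (p q : R) : Im (1 / ((p, q) : C))%C = - q / (p ^ 2 + q ^ 2).
Proof. unfold Im, Cdiv, Cinv, Cmult, RtoC; simpl; unfold Rdiv; ring. Qed.

Ltac edge_value :=
  unfold opp; simpl; unfold Rdiv; rewrite ?Ropp_mult_distr_l;
  first [reflexivity | f_equal; [ring | f_equal; ring]].

Definition winding (r : R) (w : C) : C := SqInt r (fun z => 1 / (z - w))%C.

(* On each edge the argument of [z - w] increases at rate at least [1 / (8 r)]. *)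
Lemma winding_Im (r : R) (w : C) :
  0 < r -> Cmod w <= r / 2 -> 1 <= Im (winding r w).
Proof.
intros HR Hw.
assert (Hedge := square_edge_dist r w HR Hw).
assert (Hc : on_edges (continuous_at_C (fun z => 1 / (z - w)))%C (-r) r (-r) r).
{ intros x y Hx Hy Hxy; eapply cdiff_continuous, (cdiff_div_shift (fun _ => RtoC 1));
    [apply cdiff_const|].
  intros E; specialize (Hedge x y Hx Hy Hxy); simpl in Hedge.
  rewrite E in Hedge; rewrite Cminus_diag in Hedge.
  rewrite Cmod_0 in Hedge; lra. }
destruct (Cmod_le_square _ _ Hw) as [Hw1 Hw2].
unfold winding, SqInt, RectInt, CInt, Cplus, Cminus, Cmult, Copp, Ci; simpl.
destruct w as [u v]; simpl in *.
(* [p] is the distance from [w] to the line of the edge, between [r / 2] and [3 r / 2], and [q] the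
   offset along it. Each edge, of length [2 r], then contributes at least [1 / 4] to the imaginary
   part. *)
assert (Hm : forall p q, r / 2 <= p -> Rabs q <= 3 * r / 2 -> p <= 3 * r / 2 ->
  / (8 * r) <= p / (p ^ 2 + q ^ 2)).
{ intros p q Hp Hq Hp'; apply Rabs_le_between in Hq.
  assert (Hpq : 0 < p ^ 2 + q ^ 2) by nra.
  apply Rmult_le_reg_r with (8 * r * (p ^ 2 + q ^ 2)); [nra|].
  replace (/ (8 * r) * (8 * r * (p ^ 2 + q ^ 2))) with (p ^ 2 + q ^ 2) by (field; lra).
  replace (p / (p ^ 2 + q ^ 2) * (8 * r * (p ^ 2 + q ^ 2))) with (8 * r * p) by (field; lra).
  assert (0 <= (p - r / 2) * (3 * r / 2 - p)) by (apply Rmult_le_pos; lra).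
  assert (q ^ 2 <= 9 * r ^ 2 / 4) by nra. nra. }
assert (B1 : / (8 * r) * (r - - r) <= RInt (fun t => Im (1 / ((t, (- r)%R) - (u, v)))%C) (- r) r).
{ apply RInt_lower_bound; try lra.
  - intros t Ht; apply (continuous_CR_h _ t (- r) (Hc t (- r) Ht ltac:(lra) ltac:(lra))).
  - intros t Ht; apply Rle_trans with ((r + v) / ((r + v) ^ 2 + (t - u) ^ 2)).
    + apply Hm; try lra; apply Rabs_le; lra.
    + right; change (((t, (- r)%R) - (u, v))%C) with (((t + - u)%R, ((- r)%R + - v)%R) : C);
      rewrite Im_Cinv_pair; edge_value. }
assert (B2 : / (8 * r) * (r - - r) <= RInt (fun t => Re (1 / ((r, t) - (u, v)))%C) (- r) r).
{ apply RInt_lower_bound; try lra.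
  - intros t Ht; apply (continuous_CR_v _ r t (Hc r t ltac:(lra) Ht ltac:(lra))).
  - intros t Ht; apply Rle_trans with ((r - u) / ((r - u) ^ 2 + (t - v) ^ 2)).
    + apply Hm; try lra; apply Rabs_le; lra.
    + right; change (((r, t) - (u, v))%C) with (((r + - u)%R, (t + - v)%R) : C);
      rewrite Re_Cinv_pair; edge_value. }
assert (B3 : / (8 * r) * (r - - r) <= RInt (fun t => opp (Im (1 / ((t, r) - (u, v)))%C)) (- r) r).
{ apply RInt_lower_bound; try lra.
  - intros t Ht; apply (continuous_opp (V := R_NormedModule)).
    apply (continuous_CR_h _ t r (Hc t r Ht ltac:(lra) ltac:(lra))).
  - intros t Ht; apply Rle_trans with ((r - v) / ((r - v) ^ 2 + (t - u) ^ 2)).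
    + apply Hm; try lra; apply Rabs_le; lra.
    + right; change (((t, r) - (u, v))%C) with (((t + - u)%R, (r + - v)%R) : C);
      rewrite Im_Cinv_pair; edge_value. }
assert (B4 : / (8 * r) * (r - - r) <= RInt (fun t => opp (Re (1 / (((- r)%R, t) - (u, v)))%C)) (- r) r).
{ apply RInt_lower_bound; try lra.
  - intros t Ht; apply (continuous_opp (V := R_NormedModule)).
    apply (continuous_CR_v _ (- r) t (Hc (- r) t ltac:(lra) Ht ltac:(lra))).
  - intros t Ht; apply Rle_trans with ((r + u) / ((r + u) ^ 2 + (t - v) ^ 2)).
    + apply Hm; try lra; apply Rabs_le; lra.
    + right; change ((((- r)%R, t) - (u, v))%C) with ((((- r)%R + - u)%R, (t + - v)%R) : C);
      rewrite Re_Cinv_pair; edge_value. }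
rewrite (RInt_opp (V := R_CompleteNormedModule)) in B3.
2: { apply (ex_CInt (fun t => 1 / ((t, r) - (u, v)))%C); [lra|].
     intros t Ht; apply (continuous_CR_h _ t r (Hc t r Ht ltac:(lra) ltac:(lra))). }
rewrite (RInt_opp (V := R_CompleteNormedModule)) in B4.
2: { apply (ex_CInt (fun t => 1 / (((- r)%R, t) - (u, v)))%C); [lra|].
     intros t Ht; apply (continuous_CR_v _ (- r) t (Hc (- r) t ltac:(lra) Ht ltac:(lra))). }
replace (/ (8 * r) * (r - - r)) with (/ 4) in * by (field; lra).
unfold opp in *; simpl in *.
set (I1 := RInt _ _ _) in B1. set (I2 := RInt _ _ _) in B2.
set (I3 := RInt _ _ _) in B3. set (I4 := RInt _ _ _) in B4.
match goal with |- 1 <= ?X => assert (X = I1 + I2 - I3 - I4) end.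
{ unfold I1, I2, I3, I4, Im, Re; simpl; unfold Cdiv, Cminus, Cplus, Copp; simpl; ring. }
lra.
Qed.

(** * Holomorphic functional calculus in a closed algebra *)

Lemma RectInt_minus (f g : C -> C) x1 x2 y1 y2 :
  x1 <= x2 -> y1 <= y2 -> on_edges (continuous_at_C (fun z => f z - g z)%C) x1 x2 y1 y2 ->
  on_edges (continuous_at_C g) x1 x2 y1 y2 ->
  RectInt (fun z => f z - g z)%C x1 x2 y1 y2 =
    (RectInt f x1 x2 y1 y2 - RectInt g x1 x2 y1 y2)%C.
Proof.
intros Hx Hy Hfg Hg.
assert (E : RectInt f x1 x2 y1 y2 = (RectInt (fun z => f z - g z)%C x1 x2 y1 y2 + RectInt g x1 x2 y1 y2)%C).
{ rewrite <- RectInt_plus; auto.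
  apply RectInt_ext; auto; intros x y _ _ _; apply Cminus_plus_cancel. }
rewrite E; ring.
Qed.

Lemma square_edge_neq (r : R) (w : C) :
  0 < r -> Cmod w <= r / 2 -> on_edges (fun z => z <> w) (- r) r (- r) r.
Proof.
intros Hr Hw x y Hx Hy Hxy E.
assert (H := square_edge_dist r w Hr Hw x y Hx Hy Hxy); simpl in H.
rewrite E in H; rewrite Cminus_diag in H.
rewrite Cmod_0 in H; lra.
Qed.

Lemma cauchy_kernel_cdiff (r : R) (f : C -> C) (w : C) :
  0 < r -> on_square r (fun z => exists l, cdiff f z l) -> Cmod w <= r / 2 ->
  on_edges (fun z => exists l, cdiff (fun z => f z / (z - w))%C z l) (- r) r (- r) r.
Proof.
intros Hr Hf Hw x y Hx Hy Hxy; destruct (Hf x y Hx Hy) as [l Hl].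
eexists; apply cdiff_div_shift; [exact Hl|].
apply (square_edge_neq r w Hr Hw x y Hx Hy Hxy).
Qed.

(** On the contour both kernels have denominators of modulus at least [r / 2], so the integrands
    differ by at most [4 M / r^2 |w - w'|]; [RectInt_bound] multiplies this by [16 r]. *)
Lemma cauchy_integral_lipschitz (r M : R) (f : C -> C) (w w' : C) :
  0 < r -> on_square r (fun z => exists l, cdiff f z l) ->
  on_square r (fun z => Cmod (f z) <= M) -> Cmod w <= r / 2 -> Cmod w' <= r / 2 ->
  Cmod (SqInt r (fun z => f z / (z - w)) - SqInt r (fun z => f z / (z - w')))%C
    <= 64 * M / r * Cmod (w - w').
Proof.
intros Hr Hf HM Hw Hw'.
assert (H1 := cauchy_kernel_cdiff r f w Hr Hf Hw).
assert (H2 := cauchy_kernel_cdiff r f w' Hr Hf Hw').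
assert (Hc : on_edges (continuous_at_C (fun z => f z / (z - w) - f z / (z - w'))%C) (- r) r (- r) r).
{ intros x y Hx Hy Hxy; destruct (H1 x y Hx Hy Hxy) as [l1 L1].
  destruct (H2 x y Hx Hy Hxy) as [l2 L2]; eapply cdiff_continuous, cdiff_minus; eauto. }
unfold SqInt; rewrite <- RectInt_minus; auto; try lra.
2: { intros x y Hx Hy Hxy; destruct (H2 x y Hx Hy Hxy) as [l2 L2]; eapply cdiff_continuous; eauto. }
apply Rle_trans with (4 * (4 * M / r ^ 2 * Cmod (w - w')) * ((r - - r) + (r - - r))).
2: { right; field; lra. }
apply RectInt_bound; auto; try lra.
intros x y Hx Hy Hxy.
assert (D1 := square_edge_dist r w Hr Hw x y Hx Hy Hxy).
assert (D2 := square_edge_dist r w' Hr Hw' x y Hx Hy Hxy).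
assert (N1 := square_edge_neq r w Hr Hw x y Hx Hy Hxy).
assert (N2 := square_edge_neq r w' Hr Hw' x y Hx Hy Hxy).
assert (B := HM x y Hx Hy); simpl in D1, D2, N1, N2, B.
revert D1 D2 N1 N2 B; generalize ((x, y) : C); intros z D1 D2 N1 N2 B.
assert (P1 : (z - w)%C <> 0%C) by (apply Cmod_gt_0; lra).
assert (P2 : (z - w')%C <> 0%C) by (apply Cmod_gt_0; lra).
replace (f z / (z - w) - f z / (z - w'))%C with (f z * (w - w') / ((z - w) * (z - w')))%C by (field; auto).
rewrite Cmod_div, 2!Cmod_mult by (apply Cmult_neq_0; auto).
assert (HP : r ^ 2 / 4 <= Cmod (z - w) * Cmod (z - w')).
{ replace (r ^ 2 / 4) with (r / 2 * (r / 2)) by field; apply Rmult_le_compat; lra. }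
assert (0 < r ^ 2) by nra.
apply Rmult_le_reg_r with (Cmod (z - w) * Cmod (z - w')); [lra|].
rewrite Rdiv_mult_cancel by lra.
apply Rle_trans with (4 * M / r ^ 2 * Cmod (w - w') * (r ^ 2 / 4)).
- replace (4 * M / r ^ 2 * Cmod (w - w') * (r ^ 2 / 4)) with (M * Cmod (w - w')) by (field; lra).
  apply Rmult_le_compat_r; [apply Cmod_ge_0|auto].
- apply Rmult_le_compat_l; auto.
  generalize (Cmod_ge_0 (f z)) (Cmod_ge_0 (w - w')); intros.
  apply Rmult_le_pos; auto; apply Rmult_le_pos; [lra|].
  apply Rlt_le, Rinv_0_lt_compat; auto.
Qed.

Lemma square_in_disc (r : R) : 0 < r -> on_square (2 * r) (fun z => Cmod z <= 3 * r).
Proof.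
intros Hr x y Hx Hy; apply Rsqr_incr_0_var; [|lra].
rewrite 2!Rsqr_pow2, Cmod_sqr; unfold Re, Im; simpl.
assert (0 <= (2 * r - x) * (2 * r + x)) by (apply Rmult_le_pos; lra).
assert (0 <= (2 * r - y) * (2 * r + y)) by (apply Rmult_le_pos; lra). nra.
Qed.

Lemma const_cdiff_on_square (r : R) (c : C) : on_square r (fun z => exists l, cdiff (fun _ => c) z l).
Proof. intros x y _ _; eexists; apply cdiff_const. Qed.

Lemma winding_Cmod_ge (r : R) (w : C) : 0 < r -> Cmod w <= r / 2 -> 1 <= Cmod (winding r w).
Proof.
intros Hr Hw; generalize (winding_Im r w Hr Hw) (Im_le_Cmod (winding r w))
  (Rle_abs (Im (winding r w))); lra.
Qed.

(** Both [f w * winding r w] and, with [f = 1], [winding r w] are Lipschitz in [w]. Dividing by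
    [winding], of modulus at least 1, costs nothing, so the constant is [64 + 64] times [M / r]. *)
Lemma cauchy_lipschitz (r M : R) (f : C -> C) (w w' : C) :
  0 < r -> on_square r (fun z => exists l, cdiff f z l) ->
  on_square r (fun z => Cmod (f z) <= M) -> Cmod w <= r / 2 -> Cmod w' <= r / 2 ->
  Cmod (f w - f w') <= 128 * M / r * Cmod (w - w').
Proof.
intros Hr Hf HM Hw Hw'.
assert (H1 := cauchy_integral_lipschitz r M f w w' Hr Hf HM Hw Hw').
rewrite (cauchy_formula r f w), (cauchy_formula r f w') in H1 by auto.
assert (H2 := cauchy_integral_lipschitz r 1 (fun _ => RtoC 1) w w' Hr
  (const_cdiff_on_square r 1) ltac:(intros x y _ _; rewrite Cmod_1; lra) Hw Hw').
change (SqInt r (fun z => 1 / (z - w)))%C with (winding r w) in *.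
change (SqInt r (fun z => 1 / (z - w')))%C with (winding r w') in *.
assert (H3 := winding_Cmod_ge r w Hr Hw).
assert (HMw : Cmod (f w') <= M).
{ destruct (Cmod_le_square _ _ Hw') as [A1 A2].
  rewrite (surjective_pairing w'); apply HM; lra. }
assert (E : ((f w - f w') * winding r w)%C =
  ((f w * winding r w - f w' * winding r w') - f w' * (winding r w - winding r w'))%C) by ring.
apply (f_equal Cmod) in E; rewrite Cmod_mult in E.
assert (H4 := Cmod_triangle (f w * winding r w - f w' * winding r w')
  (- (f w' * (winding r w - winding r w')))).
rewrite Cmod_opp, Cmod_mult in H4.
assert (Hd := Cmod_ge_0 (w - w')).
assert (H5 : Cmod (f w') * Cmod (winding r w - winding r w') <= M * (64 * 1 / r * Cmod (w - w'))).
{ apply Rmult_le_compat; auto; apply Cmod_ge_0. }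
replace (128 * M / r * Cmod (w - w')) with (64 * M / r * Cmod (w - w') + M * (64 * 1 / r * Cmod (w - w')))
  by (field; lra).
apply Rle_trans with (Cmod (f w - f w') * Cmod (winding r w)).
- generalize (Cmod_ge_0 (f w - f w')); nra.
- rewrite E; unfold Cminus at 1; lra.
Qed.

(** Left Riemann sums lie in [A], and they converge uniformly because the Lipschitz constant [L] in
    [t] is the same for all points [x]. With [n] steps the error is at most [K / n]. *)
Lemma ca_CInt {T : Type} (A : (T -> C) -> Prop) (G : R -> T -> C) (a b L : R) :
  closed_algebra A -> a < b -> (forall t, a <= t <= b -> A (G t)) ->
  (forall t x, a <= t <= b -> continuous_CR (fun s => G s x) t) ->
  (forall t s x, a <= t <= b -> a <= s <= b -> Cmod (G t x - G s x) <= L * Rabs (t - s)) ->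
  A (fun x => CInt (fun t => G t x) a b).
Proof.
intros HA Hab HG Hc HL; apply (ca_lim _ HA); intros eps Heps.
set (K := 2 * Rabs L * (b - a) * (b - a)).
destruct (INR_unbounded (K / eps)) as [n0 Hn0].
set (n := S n0).
assert (Hn : 0 < INR n) by (unfold n; apply lt_0_INR; lia).
set (d := (b - a) / INR n).
assert (Hd : 0 < d) by (apply Rdiv_lt_0_compat; lra).
assert (Hdn : INR n * d = b - a) by (unfold d; field; lra).
assert (Hm : forall m, (m <= n)%nat -> a + INR m * d <= b).
{ intros m Hm; apply le_INR in Hm.
  assert (INR m * d <= INR n * d) by (apply Rmult_le_compat_r; lra); lra. }
pose (S := fix S m := match m with O => fun _ : T => RtoC 0
   | Datatypes.S k => fun x => (S k x + RtoC d * G (a + INR k * d)%R x)%C end).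
assert (HS : forall m, (m <= n)%nat -> A (S m)).
{ induction m as [|m IH]; intros Hmn; simpl; [apply (ca_const _ HA)|].
  apply (ca_add _ HA); [apply IH; lia|]; apply ca_scal; auto; apply HG.
  split; [|apply Hm; lia]; generalize (pos_INR m); nra. }
exists (S n); split; [apply HS; lia|]; intros x.
assert (HI : forall m, (m <= n)%nat ->
  Cmod (CInt (fun t => G t x) a (a + INR m * d) - S m x) <= INR m * (2 * (Rabs L * d) * d)).
{ induction m as [|m IH]; intros Hmn.
  - simpl S; simpl INR; replace (a + 0 * d) with a by ring.
    unfold CInt; rewrite 2!RInt_point; unfold zero; simpl.
    replace ((0, 0) - 0)%C with (RtoC 0) by (unfold Cminus, Cplus, Copp, RtoC; simpl; f_equal; ring).
    rewrite Cmod_0; lra.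
  - assert (P0 := pos_INR m).
    assert (P1 := Hm (Datatypes.S m) Hmn); rewrite S_INR in P1.
    assert (P2 := Hm m ltac:(lia)).
    assert (P3 : 0 <= INR m * d) by nra.
    set (t := a + INR m * d) in *.
    replace (a + INR (Datatypes.S m) * d) with (t + d) by (rewrite S_INR; unfold t; ring).
    assert (Htd : t + d <= b) by (unfold t; lra).
    assert (Hat : a <= t) by (unfold t; lra).
    rewrite (CInt_Chasles _ a t (t + d)); [|lra|intros; apply Hc; lra].
    simpl S; fold t.
    assert (E : (RtoC d * G t x)%C = CInt (fun _ => G t x) t (t + d)).
    { rewrite CInt_const; f_equal; f_equal; ring. }
    assert (Hcs : forall s, t <= s <= t + d -> continuous_CR (fun s => G s x + - G t x)%C s).
    { intros s Hs; destruct (Hc s x ltac:(lra)) as [C1 C2]; split.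
      - apply (continuous_plus (V := R_NormedModule) (fun s => Re (G s x)) (fun _ => - Re (G t x)));
          auto; apply continuous_const.
      - apply (continuous_plus (V := R_NormedModule) (fun s => Im (G s x)) (fun _ => - Im (G t x)));
          auto; apply continuous_const. }
    assert (E2 : CInt (fun s => G s x) t (t + d) =
      (CInt (fun s => G s x + - G t x) t (t + d)%R + CInt (fun _ => G t x) t (t + d)%R)%C).
    { rewrite <- CInt_plus; auto; try lra.
      - apply CInt_ext; [lra|]; intros s _; apply Cminus_plus_cancel.
      - intros s _; split; apply continuous_const. }
    rewrite E, E2.
    replace (CInt (fun t0 => G t0 x) a t +
       (CInt (fun s => (G s x + - G t x)%C) t (t + d)%R + CInt (fun _ => G t x) t (t + d)%R) -
       (S m x + CInt (fun _ => G t x) t (t + d)%R))%C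
      with ((CInt (fun t0 => G t0 x) a t - S m x) + CInt (fun s => (G s x + - G t x)%C) t (t + d)%R)%C by ring.
    cmod_triangle.
    rewrite S_INR, Rmult_plus_distr_r, Rmult_1_l.
    apply Rplus_le_compat; [apply IH; lia|].
    replace (2 * (Rabs L * d) * d) with (2 * (Rabs L * d) * (t + d - t)) by ring.
    apply CInt_bound; auto; try lra.
    intros s Hs; apply Rle_trans with (1 := HL s t x ltac:(lra) ltac:(lra)).
    rewrite (Rabs_pos_eq (s - t)) by lra.
    generalize (Rle_abs L) (Rabs_pos L); intros.
    apply Rle_trans with (Rabs L * (s - t)); [apply Rmult_le_compat_r|apply Rmult_le_compat_l]; lra. }
specialize (HI n (le_n _)).
replace (a + INR n * d) with b in HI by lra.
apply Rle_trans with (1 := HI).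
replace (INR n * (2 * (Rabs L * d) * d)) with (K / INR n)
  by (unfold K, d; field; lra).
apply Rmult_le_reg_r with (INR n); auto.
rewrite Rdiv_mult_cancel by lra.
apply Rmult_gt_compat_r with (r := eps) in Hn0; auto.
rewrite Rdiv_mult_cancel in Hn0 by lra.
unfold n; rewrite S_INR; lra.
Qed.

Lemma Cmod_horizontal (t s y : R) : Cmod ((t, y) - (s, y)) = Rabs (t - s).
Proof.
rewrite <- Cmod_R; f_equal; unfold Cminus, Cplus, Copp, RtoC; simpl; f_equal; ring.
Qed.

Lemma Cmod_vertical (t s x : R) : Cmod ((x, t) - (x, s)) = Rabs (t - s).
Proof.
replace ((x, t) - (x, s))%C with (Ci * RtoC (t - s))%C.
- rewrite Cmod_mult, Cmod_Ci, Cmod_R; ring.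
- unfold Cminus, Cplus, Copp, Cmult, Ci, RtoC; simpl; f_equal; ring.
Qed.

Lemma ca_SqInt {T : Type} (A : (T -> C) -> Prop) (G : C -> T -> C) (r L : R) :
  closed_algebra A -> 0 < r ->
  on_edges (fun z => A (G z)) (- r) r (- r) r ->
  (forall x, on_edges (continuous_at_C (fun z => G z x)) (- r) r (- r) r) ->
  (forall x, on_edges (fun z => on_edges (fun z' => Cmod (G z x - G z' x) <= L * Cmod (z - z'))
      (- r) r (- r) r) (- r) r (- r) r) ->
  A (fun x => SqInt r (fun z => G z x)).
Proof.
intros HA Hr HG Hc HL.
assert (Hh : forall y, y = r \/ y = - r -> A (fun x => CInt (fun t => G (t, y) x) (- r) r)).
{ intros y Hy; apply (ca_CInt A (fun t => G (t, y)) (- r) r L); auto; try lra.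
  - intros t Ht; apply HG; lra.
  - intros t x Ht; apply (continuous_CR_h (fun z => G z x)), Hc; lra.
  - intros t s x Ht Hs; rewrite <- (Cmod_horizontal t s y); apply HL; lra. }
assert (Hv : forall x0, x0 = r \/ x0 = - r -> A (fun x => CInt (fun t => G (x0, t) x) (- r) r)).
{ intros x0 Hx0; apply (ca_CInt A (fun t => G (x0, t)) (- r) r L); auto; try lra.
  - intros t Ht; apply HG; lra.
  - intros t x Ht; apply (continuous_CR_v (fun z => G z x)), Hc; lra.
  - intros t s x Ht Hs; rewrite <- (Cmod_vertical t s x0); apply HL; lra. }
unfold SqInt, RectInt.
apply ca_sub; [auto| |apply ca_scal; auto].
apply ca_sub; [auto| |apply Hh; auto].
apply (ca_add _ HA); [apply Hh; auto|apply ca_scal; auto].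
Qed.

(* The larger square of half-side [3 r] is there for [cauchy_lipschitz], which makes
   [Phi] Lipschitz along the contour of integration, the square of half-side [r]. *)
Lemma ca_holomorphic_param {T : Type} (A : (T -> C) -> Prop) (Phi : C -> T -> C) (alpha : T -> C) (r M : R) :
  closed_algebra A -> 0 < r -> A alpha -> (forall x, Cmod (alpha x) <= r / 2) ->
  on_square r (fun z => A (Phi z)) ->
  (forall x, on_square (3 * r) (fun z => exists l, cdiff (fun z => Phi z x) z l)) ->
  (forall x, on_square (3 * r) (fun z => Cmod (Phi z x) <= M)) ->
  A (fun x => Phi (alpha x) x).
Proof.
intros HA Hr Halpha Hab HPhi Hd HM.
destruct (classic (inhabited T)) as [[x0]|HT]; [|apply (ca_empty A); auto].
assert (HM0 : 0 <= M).
{ apply Rle_trans with (2 := HM x0 0 0 ltac:(lra) ltac:(lra)), Cmod_ge_0. }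
assert (Hd' : forall x, on_square r (fun z => exists l, cdiff (fun z => Phi z x) z l)).
{ intros x u v Hu Hv; apply Hd; lra. }
(* Proved for a general [Psi] because it is applied twice: to [Phi], and to the constant 1, which
   puts [winding r (alpha x)] itself in [A]. *)
assert (Key : forall Psi : C -> T -> C, on_square r (fun z => A (Psi z)) ->
  (forall x, on_square (3 * r) (fun z => exists l, cdiff (fun z => Psi z x) z l)) ->
  (forall N, (forall x, on_square (3 * r) (fun z => Cmod (Psi z x) <= N)) -> 0 <= N ->
  A (fun x => Psi (alpha x) x * winding r (alpha x))%C)).
{ intros Psi HPsi HPd N HN HN0.
  assert (HPd' : forall x, on_square r (fun z => exists l, cdiff (fun z => Psi z x) z l)).
  { intros x u v Hu Hv; apply HPd; lra. }
  apply (ca_ext A (fun x => SqInt r (fun z => Psi z x / (z - alpha x))%C)); auto.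
  2: { intros x; symmetry; apply (cauchy_formula r (fun z => Psi z x)); auto. }
  (* On the contour the kernel is bounded by [2 / r] and Lipschitz with constant [4 / r^2]; the two
     summands are those of the product rule with [Psi]. *)
  apply (ca_SqInt A (fun z x => Psi z x / (z - alpha x))%C r
     (128 * N / (3 * r) * (2 / r) + N * (4 / r ^ 2))); auto.
  - intros u v Hu Hv Huv; apply (ca_mul _ HA); [apply HPsi; auto|].
    set (z := (u, v) : C).
    assert (Hz : z <> 0%C).
    { apply (square_edge_neq r 0%C Hr); [rewrite Cmod_0; lra|auto|auto|auto]. }
    assert (Hza : forall x, (z - alpha x)%C <> 0%C).
    { intros x; apply Cmod_gt_0.
      assert (H := square_edge_dist r (alpha x) Hr (Hab x) u v Hu Hv Huv); simpl in H.
      unfold z; lra. }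
    assert (Hzr : r <= Cmod z).
    { assert (H1 := re_le_Cmod z); assert (H2 := Im_le_Cmod z); unfold z, Re, Im in *; simpl in *.
      assert (r <= Rabs u \/ r <= Rabs v).
      { unfold Rabs; destruct (Rcase_abs u); destruct (Rcase_abs v); lra. }
      lra. }
    (* On the contour [|z| >= r] while [|alpha| <= r / 2], so [1 - alpha / z] is within 1/2 of 1 and
       has an inverse in [A]. *)
    apply (ca_ext A (fun x => / z * / (1 - alpha x / z))%C); auto.
    2: { intros x; field; repeat split; auto. }
    apply ca_scal; auto.
    apply ca_inv_near_1 with (k := / 2); auto; try lra.
    + apply ca_sub; auto; [apply (ca_const _ HA)|].
      apply (ca_ext A (fun x => / z * alpha x)%C); auto; [apply ca_scal; auto|].
      intros x; unfold Cdiv; ring.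
    + intros x; replace (1 - (1 - alpha x / z))%C with (alpha x / z)%C by ring.
      rewrite Cmod_div by auto.
      apply Rmult_le_reg_r with (Cmod z); [lra|].
      unfold Rdiv; rewrite Rmult_assoc, Rinv_l by lra; generalize (Hab x); lra.
  - intros x u v Hu Hv Huv.
    destruct (cauchy_kernel_cdiff r (fun z => Psi z x) (alpha x) Hr (HPd' x) (Hab x) u v Hu Hv Huv) as [l Hl].
    eapply cdiff_continuous; exact Hl.
  - intros x u v Hu Hv Huv u' v' Hu' Hv' Huv'.
    assert (D1 := square_edge_dist r (alpha x) Hr (Hab x) u v Hu Hv Huv).
    assert (D2 := square_edge_dist r (alpha x) Hr (Hab x) u' v' Hu' Hv' Huv').
    assert (B := HN x u' v' ltac:(lra) ltac:(lra)).
    assert (S0 : forall a b, - r <= a <= r -> - r <= b <= r -> Cmod (a, b) <= 3 * r / 2).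
    { intros a b Ha Hb; assert (H := square_in_disc (r / 2) ltac:(lra) a b ltac:(lra) ltac:(lra)); simpl in H; lra. }
    assert (Lp := cauchy_lipschitz (3 * r) N (fun z => Psi z x) (u, v) (u', v') ltac:(lra)
       (HPd x) (HN x) ltac:(apply S0; lra) ltac:(apply S0; lra)).
    simpl in D1, D2, B, Lp.
    revert D1 D2 B Lp; generalize ((u, v) : C) ((u', v') : C) (alpha x); intros z z' a D1 D2 B Lp.
    assert (P1 : (z - a)%C <> 0%C) by (apply Cmod_gt_0; lra).
    assert (P2 : (z' - a)%C <> 0%C) by (apply Cmod_gt_0; lra).
    assert (I1 : Cmod (/ (z - a)) <= 2 / r).
    { rewrite Cmod_inv by auto; replace (2 / r) with (/ (r / 2)) by (field; lra).
      apply Rinv_le_contravar; lra. }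
    assert (I2 : Cmod (/ (z' - a)) <= 2 / r).
    { rewrite Cmod_inv by auto; replace (2 / r) with (/ (r / 2)) by (field; lra).
      apply Rinv_le_contravar; lra. }
    replace (Psi z x / (z - a) - Psi z' x / (z' - a))%C
      with ((Psi z x - Psi z' x) * / (z - a) + - (Psi z' x * ((z - z') * (/ (z - a) * / (z' - a)))))%C
      by (field; auto).
    cmod_triangle.
    rewrite Cmod_opp, !Cmod_mult, Rmult_plus_distr_r.
    assert (0 < 2 / r) by (apply Rdiv_lt_0_compat; lra).
    apply Rplus_le_compat.
    + replace (128 * N / (3 * r) * (2 / r) * Cmod (z - z')) with (128 * N / (3 * r) * Cmod (z - z') * (2 / r)) by ring.
      apply Rmult_le_compat; auto; apply Cmod_ge_0.
    + rewrite Rmult_assoc; apply Rmult_le_compat; auto; try apply Cmod_ge_0.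
      * repeat apply Rmult_le_pos; apply Cmod_ge_0.
      * rewrite Rmult_comm; apply Rmult_le_compat_r; [apply Cmod_ge_0|].
        replace (4 / r ^ 2) with (2 / r * (2 / r)) by (field; lra).
        apply Rmult_le_compat; auto; apply Cmod_ge_0. }
assert (HAw : A (fun x => winding r (alpha x))).
{ apply (ca_ext A (fun x => 1 * winding r (alpha x))%C); auto; [|intros; ring].
  apply (Key (fun _ _ => RtoC 1)) with (N := 1); try lra.
  - intros u v _ _; apply (ca_const _ HA).
  - intros x; apply const_cdiff_on_square.
  - intros x u v _ _; rewrite Cmod_1; lra. }
(* [winding] has imaginary part at least 1, so multiplication by [- Ci] moves it into the right half
   plane, where inverses stay in [A]. *)
assert (HAi : A (fun x => / (RtoC (-1) * Ci * winding r (alpha x)))%C).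
{ apply ca_inv_half_plane with 1 (4 * (2 / r) * (r - - r + (r - - r))); auto; try lra.
  - apply ca_scal; auto.
  - intros x; apply Rle_trans with (1 := winding_Im r (alpha x) Hr (Hab x)).
    right; destruct (winding r (alpha x)) as [a b]; unfold Re, Im, Cmult, Ci, RtoC; simpl; ring.
  - intros x; rewrite 2!Cmod_mult, Cmod_Ci, Cmod_R, Rabs_left by lra.
    replace (- -1 * 1 * Cmod (winding r (alpha x))) with (Cmod (winding r (alpha x))) by ring.
    unfold winding, SqInt; apply RectInt_bound; try lra.
    + intros u v Hu Hv Huv.
      destruct (cauchy_kernel_cdiff r (fun z => RtoC 1) (alpha x) Hr (const_cdiff_on_square r 1) (Hab x) u v Hu Hv Huv) as [l Hl].
      eapply cdiff_continuous; exact Hl.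
    + intros u v Hu Hv Huv.
      assert (D1 := square_edge_dist r (alpha x) Hr (Hab x) u v Hu Hv Huv); simpl in D1.
      rewrite Cmod_div, Cmod_1 by (apply Cmod_gt_0; simpl; lra).
      replace (2 / r) with (/ (r / 2)) by (field; lra).
      unfold Rdiv at 1; rewrite Rmult_1_l; apply Rinv_le_contravar; lra. }
assert (Hci : (RtoC (-1) * Ci)%C <> 0%C).
{ intros E; injection E; lra. }
apply (ca_ext A (fun x => (Phi (alpha x) x * winding r (alpha x)) *
   (RtoC (-1) * Ci * / (RtoC (-1) * Ci * winding r (alpha x))))%C); auto.
- apply (ca_mul _ HA); [apply (Key Phi) with M; auto|apply ca_scal; auto].
- intros x; assert (W : winding r (alpha x) <> 0%C).
  { apply Cmod_gt_0; generalize (winding_Cmod_ge r (alpha x) Hr (Hab x)); lra. }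
  revert W Hci; generalize (winding r (alpha x)) (RtoC (-1) * Ci)%C; intros w c W Hci.
  field; auto.
Qed.

(** The one-variable result applied twice: with the first argument frozen at a point of the square
    it inserts [beta], and the outcome is the family into which [alpha] is inserted. The radius
    [5 r] contains the square of half-side [3 r]. *)
Lemma ca_holomorphic2 {T : Type} (A : (T -> C) -> Prop) (F : C -> C -> C) (alpha beta : T -> C) (r M : R) :
  closed_algebra A -> 0 < r -> A alpha -> A beta ->
  (forall x, Cmod (alpha x) <= r / 2) -> (forall x, Cmod (beta x) <= r / 2) ->
  (forall w, on_square (3 * r) (fun z => Cmod w <= 5 * r -> exists l, cdiff (fun z => F z w) z l)) ->
  (forall z, on_square (3 * r) (fun w => Cmod z <= 5 * r -> exists l, cdiff (F z) w l)) ->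
  (forall z w, Cmod z <= 5 * r -> Cmod w <= 5 * r -> Cmod (F z w) <= M) ->
  A (fun x => F (alpha x) (beta x)).
Proof.
intros HA Hr Ha Hb Hab Hbb H1 H2 HM.
assert (S0 : forall a b, - (3 * r) <= a <= 3 * r -> - (3 * r) <= b <= 3 * r -> Cmod (a, b) <= 5 * r).
{ intros a b Ha' Hb'.
  assert (H := square_in_disc (3 * r / 2) ltac:(lra) a b ltac:(lra) ltac:(lra)); simpl in H; lra. }
apply (ca_holomorphic_param A (fun z x => F z (beta x)) alpha r M); auto.
- intros u v Hu Hv.
  apply (ca_holomorphic_param A (fun w x => F (u, v) w) beta r M); auto.
  + intros u' v' _ _; apply (ca_const _ HA).
  + intros x u' v' Hu' Hv'; apply H2; auto; apply S0; lra.
  + intros x u' v' Hu' Hv'; apply HM; apply S0; lra.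
- intros x u v Hu Hv; apply H1; auto; generalize (Hbb x); lra.
- intros x u v Hu Hv; apply HM; [apply S0; lra|generalize (Hbb x); lra].
Qed.

(** * Small Lipschitz perturbations of conj z *)

(** Heine-Borel in the form used throughout: a positive constant that is locally uniform and may
    always be decreased can be chosen globally. *)
Lemma disc_compact (r : R) (Q : C -> R -> Prop) :
  (forall z d d', 0 < d' -> d' <= d -> Q z d -> Q z d') ->
  (forall p, Cmod p <= r -> exists d, 0 < d /\
     forall z, Cmod z <= r -> Cmod (z - p) < d -> Q z d) ->
  exists d, 0 < d /\ forall z, Cmod z <= r -> Q z d.
Proof.
intros Hmono Hloc.
assert (Hg : forall u v, exists d : posreal, forall z, Cmod z <= r ->
   Rabs (fst z - u) < d -> Rabs (snd z - v) < d -> Q z d).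
{ intros u v.
  assert (Hbox : forall (z : C) (d : R), Rabs (fst z - u) < d / 2 -> Rabs (snd z - v) < d / 2 ->
     Cmod (z - (u, v)) < d).
  { intros z d H1 H2; apply Rle_lt_trans with (1 := Cmod_le_ReIm _).
    change (Rabs (fst z - u) + Rabs (snd z - v) < d); lra. }
  destruct (Rle_or_lt (Cmod (u, v)) r) as [Hp|Hp].
  - destruct (Hloc _ Hp) as [d [Hd H]].
    assert (Hd2 : 0 < d / 2) by lra.
    exists (mkposreal _ Hd2); simpl; intros z Hz H1 H2.
    apply Hmono with d; auto; lra.
  (* A centre outside the disc gets a box that misses the disc, where nothing is to be shown. *)
  - assert (Hd2 : 0 < (Cmod (u, v) - r) / 2) by lra.
    exists (mkposreal _ Hd2); simpl; intros z Hz H1 H2; exfalso.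
    assert (H3 := Hbox z _ H1 H2).
    assert (H4 := Cmod_triangle_inv (u, v) z); rewrite Cmod_minus_sym in H4; lra. }
pose (delta := fun u v => proj1_sig (constructive_indefinite_description _ (Hg u v))).
destruct (compactness_value_2d (- r) r (- r) r delta) as [d Hd].
exists d; split; [apply cond_pos|]; intros z Hz.
(* The covering property from [compactness_value_2d] is doubly negated. *)
apply NNPP; intros HQ.
assert (H1 := re_le_Cmod z); assert (H2 := Im_le_Cmod z); unfold Re, Im in *.
apply (Hd (fst z) (snd z)); [apply Rabs_le_between; lra|apply Rabs_le_between; lra|].
intros [u [v [_ [_ [A1 [A2 A3]]]]]]; apply HQ.
apply Hmono with (delta u v); auto; [apply cond_pos|].
unfold delta in *; destruct (constructive_indefinite_description _ (Hg u v)) as [e He]; simpl in *.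
apply He; auto.
Qed.

Lemma disc_uniform_continuity (r : R) (phi : C -> C) (eps : R) :
  Defs.continuous_on (cdisk r) phi -> 0 < eps ->
  exists d, 0 < d /\ forall z w, Cmod z <= r -> Cmod w <= r ->
    Cmod (w - z) < d -> Cmod (phi w - phi z) < eps.
Proof.
intros Hphi Heps.
destruct (disc_compact r (fun z d => forall w, Cmod w <= r -> Cmod (w - z) < d ->
   Cmod (phi w - phi z) < eps)) as [d [Hd H]].
- intros z d d' _ Hdd' H w Hw Hwz; apply H; auto; lra.
- intros p Hp; destruct (Hphi p Hp (eps / 2)) as [d [Hd H]]; [lra|].
  exists (d / 2); split; [lra|]; intros z Hz Hzp w Hw Hwz.
  assert (H1 : Cmod (phi w - phi p) < eps / 2).
  { apply H; auto; generalize (Cmod_minus_triangle w z p); lra. }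
  assert (H2 : Cmod (phi z - phi p) < eps / 2) by (apply H; auto; lra).
  rewrite Cmod_minus_sym in H2; generalize (Cmod_minus_triangle (phi w) (phi p) (phi z)); lra.
- exists d; split; auto.
Qed.

Lemma disc_bounded (r : R) (phi : C -> C) :
  Defs.continuous_on (cdisk r) phi -> exists B, 0 < B /\ forall z, Cmod z <= r -> Cmod (phi z) <= B.
Proof.
intros Hphi.
(* [disc_compact] decreases constants while bounds are increased, hence the bound [/ d]. *)
destruct (disc_compact r (fun z d => Cmod (phi z) <= / d)) as [d [Hd H]].
- intros z d d' Hd' Hdd' H; apply Rle_trans with (1 := H), Rinv_le_contravar; auto.
- intros p Hp; destruct (Hphi p Hp 1 Rlt_0_1) as [d [Hd H]].
  assert (HB : 0 < / (Cmod (phi p) + 1)).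
  { apply Rinv_0_lt_compat; generalize (Cmod_ge_0 (phi p)); lra. }
  exists (Rmin d (/ (Cmod (phi p) + 1))); split; [apply Rmin_pos; auto|].
  intros z Hz Hzp.
  specialize (H z Hz (Rlt_le_trans _ _ _ Hzp (Rmin_l _ _))).
  apply Rle_trans with (/ / (Cmod (phi p) + 1)).
  + rewrite Rinv_inv; generalize (Cmod_triangle_inv (phi z) (phi p)); lra.
  + apply Rinv_le_contravar; [apply Rmin_pos; auto|apply Rmin_r].
- exists (/ d); split; auto; apply Rinv_0_lt_compat; auto.
Qed.

(** * Sums of kernels over a finite grid, and approximate partitions of unity *)

Definition csum (f : C -> C) (L : list C) : C := fold_right (fun a s => f a + s)%C (RtoC 0) L.
Definition msum (f : C -> C) (L : list C) : R := fold_right (fun a s => Cmod (f a) + s) 0 L.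

Lemma ca_csum {T : Type} (A : (T -> C) -> Prop) (K : C -> T -> C) (L : list C) :
  closed_algebra A -> (forall a, In a L -> A (K a)) -> A (fun x => csum (fun a => K a x) L).
Proof.
intros HA HK; induction L as [|a L IH]; simpl; [apply (ca_const _ HA)|].
apply (ca_add _ HA); [apply HK; left; auto|apply IH; intros; apply HK; right; auto].
Qed.

Lemma csum_Cmod_le (f : C -> C) (L : list C) : Cmod (csum f L) <= msum f L.
Proof.
induction L as [|a L IH]; simpl; [rewrite Cmod_0; lra|].
cmod_triangle; lra.
Qed.

Lemma msum_ge_term (f : C -> C) (L : list C) (a : C) : In a L -> Cmod (f a) <= msum f L.
Proof.
assert (H0 : forall L, 0 <= msum f L).
{ induction L0; simpl; [lra|generalize (Cmod_ge_0 (f a0)); lra]. }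
induction L as [|b L IH]; simpl; [tauto|].
intros [->|H]; [generalize (H0 L); lra|generalize (IH H) (Cmod_ge_0 (f b)); lra].
Qed.

Lemma msum_le_length (f : C -> C) (L : list C) (M : R) :
  (forall a, In a L -> Cmod (f a) <= M) -> msum f L <= INR (length L) * M.
Proof.
induction L as [|a L IH]; intros H; [simpl; lra|].
change (length (a :: L)) with (S (length L)); rewrite S_INR; simpl msum.
generalize (H a (or_introl eq_refl)) (IH (fun b Hb => H b (or_intror Hb))); lra.
Qed.

(** Terms in a sector about the positive axis cannot cancel. This keeps the denominator of the
    partition of unity away from 0. *)
Lemma csum_Re_ge (f : C -> C) (L : list C) :
  (forall a, In a L -> / 2 * Cmod (f a) <= Re (f a)) -> / 2 * msum f L <= Re (csum f L).
Proof.
induction L as [|a L IH]; intros H; [simpl; lra|].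
simpl msum; change (csum f (a :: L)) with (f a + csum f L)%C.
rewrite re_plus; generalize (H a (or_introl eq_refl)) (IH (fun b Hb => H b (or_intror Hb))); lra.
Qed.

(** Two kinds of centres: at near ones [phi a] is close to [c] and the total weight [msum] suffices;
    at far ones the kernel is at most [eta] and they are merely counted. *)
Lemma csum_localized (f phi : C -> C) (L : list C) (c : C) (eps B eta : R) :
  0 <= eps -> 0 <= B -> 0 <= eta ->
  (forall a, In a L -> Cmod (c - phi a) <= eps \/ (Cmod (c - phi a) <= B /\ Cmod (f a) <= eta)) ->
  Cmod (c * csum f L - csum (fun a => phi a * f a) L)%C
    <= eps * msum f L + INR (length L) * (B * eta).
Proof.
intros Heps HB Heta; induction L as [|a L IH]; intros H.
- simpl; replace (c * 0 - 0)%C with (RtoC 0) by ring; rewrite Cmod_0; lra.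
- change (length (a :: L)) with (S (length L)); rewrite S_INR; simpl csum; simpl msum.
  replace (c * (f a + csum f L) - (phi a * f a + csum (fun a => (phi a * f a)%C) L))%C
    with ((c - phi a) * f a + (c * csum f L - csum (fun a => (phi a * f a)%C) L))%C by ring.
  cmod_triangle; rewrite Cmod_mult.
  specialize (IH (fun b Hb => H b (or_intror Hb))).
  assert (Ha := H a (or_introl eq_refl)).
  assert (G1 := Cmod_ge_0 (c - phi a)); assert (G2 := Cmod_ge_0 (f a)).
  assert (0 <= B * eta) by (apply Rmult_le_pos; auto).
  assert (Cmod (c - phi a) * Cmod (f a) <= eps * Cmod (f a) + B * eta).
  { destruct Ha as [Ha|[Ha1 Ha2]].
    - assert (Cmod (c - phi a) * Cmod (f a) <= eps * Cmod (f a)) by (apply Rmult_le_compat_r; auto); lra.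
    - assert (Cmod (c - phi a) * Cmod (f a) <= B * eta) by (apply Rmult_le_compat; auto).
      assert (0 <= eps * Cmod (f a)) by (apply Rmult_le_pos; auto); lra. }
  lra.
Qed.

(* Coordinates are rounded towards 0, so that the grid point stays in the disc. *)
Lemma disc_net (r : R) (n : nat) :
  0 < r -> (0 < n)%nat -> exists L : list C,
    (length L <= (2 * n + 1) * (2 * n + 1))%nat /\
    (forall a, In a L -> Cmod a <= r) /\
    (forall z, Cmod z <= r -> exists a, In a L /\ Cmod (z - a) <= 2 * r / INR n).
Proof.
intros Hr Hn.
assert (HN : 0 < INR n) by (apply lt_0_INR; auto).
pose (y := fun i : nat => r * (INR i - INR n) / INR n).
assert (Hround : forall x, - r <= x <= r -> exists i, (i < 2 * n + 1)%nat /\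
   Rabs (y i) <= Rabs x /\ Rabs (x - y i) <= r / INR n).
{ intros x Hx.
  assert (Hax : 0 <= Rabs x * INR n / r).
  { apply Rmult_le_pos; [apply Rmult_le_pos; [apply Rabs_pos|lra]|apply Rlt_le, Rinv_0_lt_compat; auto]. }
  destruct (nfloor_ex _ Hax) as [m [Hm1 Hm2]].
  set (s := r / INR n) in *.
  assert (Hs : 0 < s) by (apply Rdiv_lt_0_compat; auto).
  assert (Es : s * (Rabs x * INR n / r) = Rabs x) by (unfold s; field; lra).
  assert (Hm1' : s * INR m <= Rabs x) by (rewrite <- Es; apply Rmult_le_compat_l; lra).
  assert (Hm2' : Rabs x <= s * (INR m + 1)) by (rewrite <- Es at 1; apply Rmult_le_compat_l; lra).
  assert (Hmn : (m <= n)%nat).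
  { apply INR_le; apply Rmult_le_reg_l with s; auto.
    apply Rle_trans with (1 := Hm1'); unfold s; replace (r / INR n * INR n) with r by (field; lra).
    apply Rabs_le; lra. }
  assert (Hms : 0 <= s * INR m) by (generalize (pos_INR m); nra).
  destruct (Rle_or_lt 0 x) as [H0|H0].
  - exists (n + m)%nat; split; [lia|].
    replace (y (n + m)%nat) with (s * INR m) by (unfold y, s; rewrite plus_INR; field; lra).
    rewrite (Rabs_pos_eq (s * INR m)) by auto.
    rewrite (Rabs_pos_eq x) in * by auto; split; auto; apply Rabs_le; lra.
  - exists (n - m)%nat; split; [lia|].
    replace (y (n - m)%nat) with (- (s * INR m)) by (unfold y, s; rewrite minus_INR by lia; field; lra).
    rewrite Rabs_Ropp, (Rabs_pos_eq (s * INR m)) by auto.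
    rewrite (Rabs_left x) in * by auto; split; auto; apply Rabs_le; lra. }
pose (I := seq 0 (2 * n + 1)).
pose (P := map (fun p => ((y (fst p), y (snd p)) : C)) (list_prod I I)).
exists (filter (fun a => if Rle_dec (Cmod a) r then true else false) P).
split; [|split].
- apply Nat.le_trans with (1 := filter_length_le _ _).
  unfold P; rewrite length_map, length_prod; unfold I; rewrite length_seq; auto.
- intros a Ha; apply filter_In in Ha; destruct Ha as [_ Ha].
  destruct (Rle_dec (Cmod a) r); [auto|discriminate].
- intros z Hz.
  assert (H1 := re_le_Cmod z); assert (H2 := Im_le_Cmod z).
  destruct (Hround (Re z)) as [i [Hi [Hi1 Hi2]]]; [apply Rabs_le_between; lra|].
  destruct (Hround (Im z)) as [j [Hj [Hj1 Hj2]]]; [apply Rabs_le_between; lra|].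
  exists (y i, y j); split.
  + apply filter_In; split.
    * unfold P; apply in_map_iff; exists (i, j); split; auto.
      apply in_prod; apply in_seq; lia.
    * destruct (Rle_dec (Cmod (y i, y j)) r) as [|Hno]; auto; exfalso; apply Hno.
      apply Rle_trans with (2 := Hz).
      apply Rsqr_incr_0_var; [|apply Cmod_ge_0].
      rewrite 2!Rsqr_pow2, 2!Cmod_sqr; unfold Re at 1, Im at 1; simpl fst; simpl snd.
      rewrite <- (pow2_abs (y i)), <- (pow2_abs (y j)), <- (pow2_abs (Re z)), <- (pow2_abs (Im z)).
      apply Rplus_le_compat; apply pow_incr; split; auto using Rabs_pos.
  + apply Rle_trans with (1 := Cmod_le_ReIm _).
    change (Rabs (Re z - y i) + Rabs (Im z - y j) <= 2 * r / INR n).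
    replace (2 * r / INR n) with (r / INR n + r / INR n) by (field; lra); lra.
Qed.

(** A subset type, so that estimates at all points of [T] are estimates on the disc. *)
Definition closed_disc (r : R) : Type := {z : C | Cmod z <= r}.
Definition dval {r : R} (x : closed_disc r) : C := proj1_sig x.

(* [u (conj u + e)] stands for [(z - a) (q z - q a)] with [u = z - a]; it lies in a
   sector about the positive axis that is narrow enough for [s ^ -2] to have
   positive real part. *)
Lemma sector_bound (u e : C) (N : R) :
  0 < N -> Cmod e <= / 4 * Cmod u ->
  let s := (1 + RtoC N * (u * (Cconj u + e)))%C in
  1 + N * (3 / 4 * Cmod u ^ 2) <= Re s /\ Cmod s <= 1 + N * (5 / 4 * Cmod u ^ 2) /\
  / 2 * Cmod ((/ s) ^ 2)%C <= Re ((/ s) ^ 2)%C.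
Proof.
intros HN He s.
set (m := Cmod u ^ 2).
assert (Hm : 0 <= m) by (apply pow_le, Cmod_ge_0).
assert (Hue : Cmod (u * e) <= m / 4).
{ rewrite Cmod_mult; unfold m; generalize (Cmod_ge_0 u); nra. }
assert (Es : s = (RtoC (1 + N * m) + RtoC N * (u * e))%C).
{ unfold s, m; rewrite RtoC_plus, RtoC_mult, Cmod2_conj; ring. }
assert (Hre := re_le_Cmod (u * e)); assert (Him := Im_le_Cmod (u * e)).
assert (Er : Re s = 1 + N * m + N * Re (u * e)).
{ rewrite Es, re_plus, re_RtoC, re_scal_l; auto. }
assert (Ei : Im s = N * Im (u * e)).
{ rewrite Es; destruct (u * e)%C as [p q]; unfold Im, Cplus, Cmult, RtoC; simpl; ring. }
apply Rabs_le_between in Hre; apply Rabs_le_between in Him.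
assert (H1 : 1 + N * (3 / 4 * m) <= Re s) by (rewrite Er; nra).
assert (H2 : Rabs (Im s) <= N * (m / 4)) by (rewrite Ei; apply Rabs_le; nra).
split; [exact H1|split].
- rewrite Es; cmod_triangle.
  rewrite Cmod_mult, 2!Cmod_R, (Rabs_pos_eq N), Rabs_pos_eq by nra; nra.
(* The real part of [s ^ -2] is [(a^2 - b^2) / |s|^4], and [9 b^2 <= a^2] makes [a^2 - b^2] at least
   half of [|s|^2]. *)
- assert (H3 : 3 * Rabs (Im s) <= Re s) by nra.
  assert (Hs0 : 0 < Re s) by nra.
  rewrite Cmod_pow, Cmod_inv.
  2: { intros E; rewrite E in Hs0; simpl in Hs0; lra. }
  rewrite pow_inv.
  generalize (Cmod_sqr s); destruct s as [a b]; unfold Re, Im in *; simpl in *.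
  intros Eab; rewrite Eab.
  apply Rabs_le_between in H2.
  assert (Hab : 9 * (b * b) <= a * a).
  { unfold Rabs in H3; destruct (Rcase_abs b); nra. }
  assert (Hp : 0 < a * a + b * b) by nra.
  match goal with |- _ <= ?X => replace X with ((a * a - b * b) / (a * a + b * b) ^ 2) by (field; lra) end.
  replace (/ 2 * / (a * (a * 1) + b * (b * 1))) with ((/ 2 * (a * a + b * b)) / (a * a + b * b) ^ 2) by (field; lra).
  apply Rmult_le_compat_r; [apply Rlt_le, Rinv_0_lt_compat; nra|nra].
Qed.

(* Partition of unity [K_a / sum K_a] with [K_a z = (1 + N (z - a) (q z - q a)) ^ -2],
   [a] ranging over a grid of step about [1 / sqrt N]. *)
Lemma ca_small_perturbation_conj (r : R) (q : C -> C) (A : (closed_disc r -> C) -> Prop) (phi : C -> C) :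
  0 < r -> closed_algebra A -> A dval -> A (fun x => q (dval x)) ->
  (forall z w, Cmod z <= r -> Cmod w <= r ->
     Cmod (q z - q w - Cconj (z - w)) <= / 4 * Cmod (z - w)) ->
  Defs.continuous_on (cdisk r) phi -> A (fun x => phi (dval x)).
Proof.
intros Hr HA Az Aq Hq Hphi; apply (ca_lim _ HA); intros eps Heps.
destruct (disc_uniform_continuity r phi (eps / 4) Hphi) as [d [Hd Hunif]]; [lra|].
destruct (disc_bounded r phi Hphi) as [B [HB HBphi]].
(* Collects the constants of the far part, which comes out as [c0 / (288 n^2)]; the [+ 1] on the
   next line gives [1 <= INR n]. *)
set (c0 := 8 * 72 * B * 2 * 9 * r ^ 4 / d ^ 4).
destruct (INR_unbounded (c0 / eps + 1)) as [n Hn].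
assert (Hr4 : 0 < r ^ 4) by (apply pow_lt; auto).
assert (Hd4 : 0 < d ^ 4) by (apply pow_lt; auto).
assert (Hc0 : 0 < c0) by (apply Rdiv_lt_0_compat; auto; nra).
assert (Hn1 : 1 <= INR n).
{ assert (0 < c0 / eps) by (apply Rdiv_lt_0_compat; auto); lra. }
assert (Hn0 : (0 < n)%nat) by (apply INR_lt; simpl; lra).
destruct (disc_net r n Hr Hn0) as [L [HL1 [HL2 HL3]]].
(* Matched to the grid: a centre within [2 r / n] of [z] has [|S| <= 1 + 5/4 * 4 = 6], so its kernel
   has modulus at least [1 / 36]. *)
set (N := INR n ^ 2 / r ^ 2).
assert (HN : 0 < N) by (apply Rdiv_lt_0_compat; nra).
pose (S := fun (a z : C) => (1 + RtoC N * ((z - a) * (q z - q a)))%C).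
(* Why the exponent is -2: there are of the order of [n^2] centres, and the far kernels must be
   [O(n^-4)] for their sum to tend to 0; with exponent -1 they would only be [O(n^-2)]. *)
pose (K := fun (a z : C) => ((/ S a z) ^ 2)%C).
assert (HS : forall a z, Cmod a <= r -> Cmod z <= r ->
  1 + N * (3 / 4 * Cmod (z - a) ^ 2) <= Re (S a z) /\
  Cmod (S a z) <= 1 + N * (5 / 4 * Cmod (z - a) ^ 2) /\
  / 2 * Cmod (K a z) <= Re (K a z)).
{ intros a z Ha Hz.
  assert (E : S a z = (1 + RtoC N * ((z - a) * (Cconj (z - a) + (q z - q a - Cconj (z - a)))))%C)
    by (unfold S; ring).
  unfold K; rewrite E; apply sector_bound; auto. }
assert (HSr : forall a z, Cmod a <= r -> Cmod z <= r -> 1 + N * (3 / 4 * Cmod (z - a) ^ 2) <= Cmod (S a z)).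
{ intros a z Ha Hz; generalize (proj1 (HS a z Ha Hz)) (re_le_Cmod (S a z)) (Rle_abs (Re (S a z))); lra. }
assert (HS1 : forall a z, Cmod a <= r -> Cmod z <= r -> 1 <= Cmod (S a z)).
{ intros a z Ha Hz; assert (0 <= N * (3 / 4 * Cmod (z - a) ^ 2)) by (generalize (pow2_ge_0 (Cmod (z - a))); nra).
  generalize (HSr a z Ha Hz); lra. }
assert (HK : forall a z, Cmod a <= r -> Cmod z <= r -> Cmod (K a z) = / Cmod (S a z) ^ 2).
{ intros a z Ha Hz; unfold K; rewrite Cmod_pow, Cmod_inv, pow_inv; auto.
  apply Cmod_gt_0; generalize (HS1 a z Ha Hz); lra. }
assert (AS : forall a, A (fun x => S a (dval x))).
{ intros a; apply (ca_add _ HA); [apply (ca_const _ HA)|]; apply ca_scal; auto.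
  apply (ca_mul _ HA); apply ca_sub; auto; apply (ca_const _ HA). }
assert (AK : forall a, In a L -> A (fun x => K a (dval x))).
{ intros a Ha; apply ca_pow; auto.
  apply ca_inv_half_plane with 1 (1 + N * (5 / 4 * (2 * r) ^ 2)); auto; try lra.
  - intros [z Hz]; simpl dval; destruct (HS a z (HL2 a Ha) Hz) as [H1 _].
    assert (0 <= N * (3 / 4 * Cmod (z - a) ^ 2)).
    { apply Rmult_le_pos; [lra|]; generalize (pow2_ge_0 (Cmod (z - a))); lra. }
    lra.
  - intros [z Hz]; simpl dval; destruct (HS a z (HL2 a Ha) Hz) as [_ [H2 _]].
    apply Rle_trans with (1 := H2); apply Rplus_le_compat_l, Rmult_le_compat_l; [lra|].
    apply Rmult_le_compat_l; [lra|]; apply pow_incr; split; [apply Cmod_ge_0|].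
    cmod_triangle; rewrite Cmod_opp; generalize (HL2 a Ha); lra. }
assert (Hmsum : forall z, Cmod z <= r -> / 36 <= msum (fun a => K a z) L).
{ intros z Hz; destruct (HL3 z Hz) as [a [Ha Haz]].
  apply Rle_trans with (2 := msum_ge_term (fun a => K a z) L a Ha).
  rewrite HK by auto; destruct (HS a z (HL2 a Ha) Hz) as [_ [H2 _]].
  generalize (HS1 a z (HL2 a Ha) Hz); intros H1.
  apply Rinv_le_contravar; [nra|].
  replace 36 with (6 ^ 2) by ring; apply pow_incr; split; [lra|].
  apply Rle_trans with (1 := H2).
  assert (Cmod (z - a) ^ 2 <= (2 * r / INR n) ^ 2) by (apply pow_incr; split; [apply Cmod_ge_0|auto]).
  assert (N * Cmod (z - a) ^ 2 <= 4).
  { replace 4 with (N * (2 * r / INR n) ^ 2) by (unfold N; field; lra).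
    apply Rmult_le_compat_l; lra. }
  lra. }
assert (Hcsum : forall z, Cmod z <= r -> / 2 * msum (fun a => K a z) L <= Re (csum (fun a => K a z) L)).
{ intros z Hz; apply csum_Re_ge; intros a Ha; apply HS; auto. }
exists (fun x => csum (fun a => phi a * K a (dval x)) L * / csum (fun a => K a (dval x)) L)%C.
split.
- apply (ca_mul _ HA).
  + apply (ca_csum A (fun a x => phi a * K a (dval x))%C); auto.
    intros a Ha; apply ca_scal; auto.
  + apply ca_inv_half_plane with (/ 72) (INR (length L) * 1); auto; try lra.
    * apply (ca_csum A (fun a x => K a (dval x))); auto.
    * intros [z Hz]; simpl dval; generalize (Hmsum z Hz) (Hcsum z Hz); lra.
    * intros [z Hz]; simpl dval; apply Rle_trans with (1 := csum_Cmod_le _ _).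
      apply msum_le_length; intros a Ha; rewrite HK by auto.
      generalize (HS1 a z (HL2 a Ha) Hz); intros H1.
      rewrite <- Rinv_1; apply Rinv_le_contravar; nra.
- intros [z Hz]; simpl dval.
  assert (H1 := Hmsum z Hz); assert (H2 := Hcsum z Hz).
  set (Sg := csum (fun a => K a z) L) in *.
  set (mu := msum (fun a => K a z) L) in *.
  assert (HSg : / 2 * mu <= Cmod Sg) by (generalize (re_le_Cmod Sg) (Rle_abs (Re Sg)); lra).
  assert (Sg0 : Sg <> 0%C) by (apply Cmod_gt_0; lra).
  set (eta := 2 * r ^ 4 / (INR n ^ 4 * d ^ 4)).
  assert (Hn4 : 0 < INR n ^ 4) by (apply pow_lt; lra).
  assert (Heta : 0 <= eta) by (apply Rlt_le, Rdiv_lt_0_compat; nra).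
  assert (Hloc := csum_localized (fun a => K a z) phi L (phi z) (eps / 4) (2 * B) eta
     ltac:(lra) ltac:(lra) Heta).
  replace (phi z - csum (fun a => phi a * K a z)%C L * / Sg)%C
    with ((phi z * Sg - csum (fun a => phi a * K a z)%C L) / Sg)%C by (field; auto).
  rewrite Cmod_div by auto.
  apply Rmult_le_reg_r with (Cmod Sg); [lra|].
  rewrite Rdiv_mult_cancel by lra.
  eapply Rle_trans; [apply Hloc|].
  { intros a Ha; destruct (Rlt_or_le (Cmod (z - a)) d) as [Hnear|Hfar].
    - left; apply Rlt_le, Hunif; auto.
    - right; split.
      + cmod_triangle; rewrite Cmod_opp.
        generalize (HBphi z Hz) (HBphi a (HL2 a Ha)); lra.
      + rewrite HK by auto.
        assert (Hb := HSr a z (HL2 a Ha) Hz).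
        assert (Hdd : d ^ 2 <= Cmod (z - a) ^ 2) by (apply pow_incr; lra).
        assert (Hb2 : N * (3 / 4 * d ^ 2) <= Cmod (S a z)).
        { assert (N * (3 / 4 * d ^ 2) <= N * (3 / 4 * Cmod (z - a) ^ 2)) by (apply Rmult_le_compat_l; lra); lra. }
        assert (Hd2 : 0 < d ^ 2) by (apply pow_lt; auto).
        assert (Hpos : 0 < N * (3 / 4 * d ^ 2)) by (apply Rmult_lt_0_compat; lra).
        apply Rle_trans with (/ (N * (3 / 4 * d ^ 2)) ^ 2).
        * apply Rinv_le_contravar; [apply pow_lt; auto|apply pow_incr; lra].
        * replace (/ (N * (3 / 4 * d ^ 2)) ^ 2) with (16 / 9 * (r ^ 4 / (INR n ^ 4 * d ^ 4)))
            by (unfold N; field; lra).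
          unfold eta; replace (2 * r ^ 4 / (INR n ^ 4 * d ^ 4)) with (2 * (r ^ 4 / (INR n ^ 4 * d ^ 4))) by (field; lra).
          apply Rmult_le_compat_r; [|lra]; apply Rlt_le, Rdiv_lt_0_compat; auto; apply Rmult_lt_0_compat; auto. }
  fold mu.
  assert (HLn : INR (length L) <= 9 * INR n ^ 2).
  { apply le_INR in HL1; apply Rle_trans with (1 := HL1).
    rewrite mult_INR, plus_INR, mult_INR; simpl INR; nra. }
  (* The target is [eps / 4] times the lower bound [1 / 36] of [mu], so near and far parts together
     are at most [eps * mu / 2 <= eps * |Sg|]. *)
  assert (Hfar : INR (length L) * (2 * B * eta) <= eps / 2 * / 72).
  { apply Rle_trans with (9 * INR n ^ 2 * (2 * B * eta)).
    - apply Rmult_le_compat_r; auto; apply Rmult_le_pos; lra.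
    - replace (9 * INR n ^ 2 * (2 * B * eta)) with (c0 / INR n ^ 2 / (2 * 2 * 72 * 2 / 2))
        by (unfold c0, eta; field; lra).
      assert (Hcn : c0 / INR n ^ 2 <= eps).
      { apply Rmult_le_reg_r with (INR n ^ 2); [nra|].
        rewrite Rdiv_mult_cancel by nra.
        assert (c0 <= eps * INR n).
        { apply Rmult_le_reg_r with (/ eps); [apply Rinv_0_lt_compat; auto|].
          replace (eps * INR n * / eps) with (INR n) by (field; lra).
          change (c0 * / eps) with (c0 / eps); lra. }
        apply Rle_trans with (1 := H); simpl; nra. }
      lra. }
  nra.
Qed.

(** * Derivatives of functions holomorphic in two variables *)

Definition separately_holomorphic (G : C -> C -> C) (r : R) : Prop :=
  forall z w, Cmod z <= r -> Cmod w <= r ->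
    (exists l, cdiff (fun s => G s w) z l) /\ (exists l, cdiff (G z) w l).

(** One variable is moved at a time. The square of half-side [2 r] lies in the disc of radius [3 r],
    and [128 N / (2 r) = 64 N / r]. *)
Lemma separately_holomorphic_lipschitz (G : C -> C -> C) (r N : R) (z w z' w' : C) :
  0 < r -> separately_holomorphic G (3 * r) ->
  (forall z w, Cmod z <= 3 * r -> Cmod w <= 3 * r -> Cmod (G z w) <= N) ->
  Cmod z <= r -> Cmod w <= r -> Cmod z' <= r -> Cmod w' <= r ->
  Cmod (G z w - G z' w') <= 64 * N / r * (Cmod (z - z') + Cmod (w - w')).
Proof.
intros Hr HG HN Hz Hw Hz' Hw'.
assert (Hsq := square_in_disc r Hr).
assert (L1 := cauchy_lipschitz (2 * r) N (fun s => G s w) z z' ltac:(lra)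
  ltac:(intros x y Hx Hy; apply HG; [apply Hsq; auto|lra])
  ltac:(intros x y Hx Hy; apply HN; [apply Hsq; auto|lra]) ltac:(lra) ltac:(lra)).
assert (L2 := cauchy_lipschitz (2 * r) N (G z') w w' ltac:(lra)
  ltac:(intros x y Hx Hy; apply HG; [lra|apply Hsq; auto])
  ltac:(intros x y Hx Hy; apply HN; [lra|apply Hsq; auto]) ltac:(lra) ltac:(lra)).
assert (T := Cmod_minus_triangle (G z w) (G z' w) (G z' w')).
replace (128 * N / (2 * r)) with (64 * N / r) in * by (field; lra).
simpl in *; lra.
Qed.

Lemma norm2_le (z w : C) : norm2 z w <= Cmod z + Cmod w.
Proof.
unfold norm2; rewrite <- (sqrt_pow2 (Cmod z + Cmod w)).
- apply sqrt_le_1_alt; generalize (Cmod_ge_0 z) (Cmod_ge_0 w); nra.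
- generalize (Cmod_ge_0 z) (Cmod_ge_0 w); lra.
Qed.

Lemma norm2_ge_0 (z w : C) : 0 <= norm2 z w.
Proof. apply sqrt_pos. Qed.

(** [cdiff2_at] with the partial derivatives as parameters and the sum of the moduli as norm. *)
Definition cdiff2 (F : C -> C -> C) (z w a b : C) : Prop :=
  forall eps, 0 < eps -> exists delta, 0 < delta /\ forall k l,
    Cmod k + Cmod l < delta ->
    Cmod (F (z + k) (w + l) - F z w - (a * k + b * l))%C <= eps * (Cmod k + Cmod l).

Lemma cdiff2_at_cdiff2 (F : C -> C -> C) (z w : C) :
  cdiff2_at F z w -> exists a b, cdiff2 F z w a b.
Proof.
intros [a [b H]]; exists a, b; intros eps Heps.
destruct (H eps Heps) as [d [Hd H1]]; exists d; split; auto.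
intros k l Hkl; apply Rle_trans with (1 := H1 k l (Rle_lt_trans _ _ _ (norm2_le k l) Hkl)).
apply Rmult_le_compat_l; [lra|apply norm2_le].
Qed.

Lemma cdiff2_fst (F : C -> C -> C) (z w a b : C) :
  cdiff2 F z w a b -> cdiff (fun s => F s w) z a.
Proof.
intros H eps Heps; destruct (H eps Heps) as [d [Hd H1]]; exists d; split; auto.
intros k Hk; specialize (H1 k 0%C); rewrite Cmod_0, Rplus_0_r in H1.
replace (w + 0)%C with w in H1 by ring.
replace (a * k + b * 0)%C with (a * k)%C in H1 by ring; auto.
Qed.

Lemma cdiff2_snd (F : C -> C -> C) (z w a b : C) :
  cdiff2 F z w a b -> cdiff (F z) w b.
Proof.
intros H eps Heps; destruct (H eps Heps) as [d [Hd H1]]; exists d; split; auto.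
intros k Hk; specialize (H1 0%C k); rewrite Cmod_0, Rplus_0_l in H1.
replace (z + 0)%C with z in H1 by ring.
replace (a * 0 + b * k)%C with (b * k)%C in H1 by ring; auto.
Qed.

Lemma cdiff_shift (f : C -> C) (z k l : C) : cdiff f (z + k) l -> cdiff (fun s => f (s + k)%C) z l.
Proof.
intros H eps Heps; destruct (H eps Heps) as [d [Hd H1]]; exists d; split; auto.
intros s Hs; specialize (H1 s Hs).
replace (z + s + k)%C with (z + k + s)%C by ring; auto.
Qed.

(** Complex derivatives can be compared along a single small real increment [t], which turns bounds
    on increments into bounds on derivatives. *)
Lemma cdiff_difference_bound (f g : C -> C) (z w a b : C) (L d : R) :
  0 < d -> cdiff f z a -> cdiff g w b ->
  (forall k, Cmod k < d -> Cmod ((f (z + k) - f z) - (g (w + k) - g w))%C <= L * Cmod k) ->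
  Cmod (a - b) <= L.
Proof.
intros Hd Hf Hg H; apply le_epsilon; intros eps Heps.
destruct (Hf (eps / 2)) as [d1 [Hd1 H1]]; [lra|].
destruct (Hg (eps / 2)) as [d2 [Hd2 H2]]; [lra|].
set (t := Rmin d (Rmin d1 d2) / 2).
assert (Ht : 0 < t) by (unfold t; assert (0 < Rmin d (Rmin d1 d2)) by (repeat apply Rmin_pos; auto); lra).
assert (Ht' : t < Rmin d (Rmin d1 d2)) by (unfold t in *; lra).
assert (Hmod : Cmod (RtoC t) = t) by (rewrite Cmod_R, Rabs_pos_eq; lra).
specialize (H (RtoC t)); specialize (H1 (RtoC t)); specialize (H2 (RtoC t)); rewrite Hmod in *.
assert (T1 := Rmin_l d (Rmin d1 d2)); assert (T2 := Rmin_r d (Rmin d1 d2)).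
assert (T3 := Rmin_l d1 d2); assert (T4 := Rmin_r d1 d2).
specialize (H ltac:(lra)); specialize (H1 ltac:(lra)); specialize (H2 ltac:(lra)).
apply Rmult_le_reg_r with t; auto.
rewrite <- Hmod at 1; rewrite <- Cmod_mult.
replace ((a - b) * RtoC t)%C with
  (((f (z + RtoC t) - f z) - (g (w + RtoC t) - g w))
   + (- (f (z + RtoC t) - f z - a * RtoC t) + (g (w + RtoC t) - g w - b * RtoC t)))%C by ring.
cmod_triangle.
assert (T := Cmod_triangle (- (f (z + RtoC t)%C - f z - a * RtoC t)) (g (w + RtoC t)%C - g w - b * RtoC t)).
rewrite Cmod_opp in T; lra.
Qed.

(* The partial derivatives are Lipschitz: apply the Lipschitz bound to the
   increments [F (z + k) w - F z w], which are themselves [O(k)]. *)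
Lemma partial_derivative_lipschitz (F : C -> C -> C) (r L : R) (z w z' w' a b a' b' : C) :
  0 < r -> separately_holomorphic F (4 * r) ->
  (forall z w z' w', Cmod z <= 4 * r -> Cmod w <= 4 * r -> Cmod z' <= 4 * r -> Cmod w' <= 4 * r ->
     Cmod (F z w - F z' w') <= L * (Cmod (z - z') + Cmod (w - w'))) ->
  Cmod z <= r -> Cmod w <= r -> Cmod z' <= r -> Cmod w' <= r ->
  cdiff2 F z w a b -> cdiff2 F z' w' a' b' ->
  Cmod (a - a') <= 64 * L / r * (Cmod (z - z') + Cmod (w - w')) /\
  Cmod (b - b') <= 64 * L / r * (Cmod (z - z') + Cmod (w - w')).
Proof.
intros Hr HF HL Hz Hw Hz' Hw' D D'; split.
- apply (cdiff_difference_bound (fun s => F s w) (fun s => F s w') z z' a a' _ r Hr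
    (cdiff2_fst _ _ _ _ _ D) (cdiff2_fst _ _ _ _ _ D')).
  intros k Hk.
  assert (Hs : forall s, Cmod s <= 3 * r -> Cmod (s + k) <= 4 * r).
  { intros s Hs; generalize (Cmod_triangle s k); lra. }
  replace (64 * L / r * (Cmod (z - z') + Cmod (w - w')) * Cmod k)
    with (64 * (L * Cmod k) / r * (Cmod (z - z') + Cmod (w - w'))) by (field; lra).
  apply (separately_holomorphic_lipschitz (fun s t => F (s + k) t - F s t)%C); auto.
  + intros s t H1 H2.
    destruct (HF (s + k)%C t (Hs s H1) ltac:(lra)) as [[l1 D1] [l2 D2]].
    destruct (HF s t ltac:(lra) ltac:(lra)) as [[l3 D3] [l4 D4]].
    split; eexists; apply cdiff_minus; eauto.
    apply (cdiff_shift (fun s => F s t)); eauto.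
  + intros s t H1 H2; eapply Rle_trans; [apply HL; auto; lra|].
    replace (s + k - s)%C with k by ring; rewrite Cminus_diag.
    rewrite Cmod_0; lra.
- apply (cdiff_difference_bound (F z) (F z') w w' b b' _ r Hr
    (cdiff2_snd _ _ _ _ _ D) (cdiff2_snd _ _ _ _ _ D')).
  intros k Hk.
  assert (Hs : forall s, Cmod s <= 3 * r -> Cmod (s + k) <= 4 * r).
  { intros s Hs; generalize (Cmod_triangle s k); lra. }
  replace (64 * L / r * (Cmod (z - z') + Cmod (w - w')) * Cmod k)
    with (64 * (L * Cmod k) / r * (Cmod (z - z') + Cmod (w - w'))) by (field; lra).
  apply (separately_holomorphic_lipschitz (fun s t => F s (t + k) - F s t)%C); auto.
  + intros s t H1 H2.
    destruct (HF s (t + k)%C ltac:(lra) (Hs t H2)) as [[l1 D1] [l2 D2]].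
    destruct (HF s t ltac:(lra) ltac:(lra)) as [[l3 D3] [l4 D4]].
    split; eexists; apply cdiff_minus; eauto.
    apply (cdiff_shift (fun t => F s t)); eauto.
  + intros s t H1 H2; eapply Rle_trans; [apply HL; auto; lra|].
    replace (t + k - t)%C with k by ring; rewrite Cminus_diag.
    rewrite Cmod_0; lra.
Qed.

Lemma partial_derivative_bound (f : C -> C) (z l : C) (L d : R) :
  0 < d -> cdiff f z l -> (forall k, Cmod k < d -> Cmod (f (z + k)%C - f z) <= L * Cmod k) ->
  Cmod l <= L.
Proof.
intros Hd Hf H; replace l with (l - 0)%C by ring.
apply (cdiff_difference_bound f (fun _ => RtoC 0) z 0%C l 0%C L d Hd Hf (cdiff_const _ _)).
intros k Hk; replace (f (z + k) - f z - (0 - 0))%C with (f (z + k) - f z)%C by ring; auto.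
Qed.

(** Cauchy's estimate trades one power of the radius for a Lipschitz constant: [|F| <= N (6 r)^3] on
    the polydisc of radius [3 r] yields the constant [64 * 216 N r^2]. From here on the cubic bound
    acts through this quadratic smallness. *)
Lemma odd_holo_cubic_polydisc (F : C -> C -> C) :
  odd_holo_cubic_near0 F -> exists r0 K, 0 < r0 /\ 0 < K /\
    (forall z w, Cmod z <= r0 -> Cmod w <= r0 ->
       (exists a b, cdiff2 F z w a b) /\ F (- z)%C (- w)%C = (- F z w)%C /\
       Cmod (F z w) <= K * (Cmod z + Cmod w)) /\
    (forall r z w z' w', 0 < r -> r <= r0 ->
       Cmod z <= r -> Cmod w <= r -> Cmod z' <= r -> Cmod w' <= r ->
       Cmod (F z w - F z' w') <= K * r ^ 2 * (Cmod (z - z') + Cmod (w - w'))).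
Proof.
intros [r [Hr [HF [M [d [Hd HM]]]]]].
(* A third makes [|z| + |w| <= 2 s] strictly less than the minimum; the 1 allows [x^3 <= x] for
   [x = |z| + |w|]. *)
set (s := Rmin (Rmin r d) 1 / 3).
assert (Hmin : 0 < Rmin (Rmin r d) 1) by (repeat apply Rmin_pos; auto; lra).
assert (T1 := Rmin_l (Rmin r d) 1); assert (T4 := Rmin_r (Rmin r d) 1).
assert (T2 := Rmin_l r d); assert (T3 := Rmin_r r d).
assert (Hs : 0 < s) by (unfold s; lra).
set (N := Rabs M + 1).
assert (HN : 0 < N) by (unfold N; generalize (Rabs_pos M); lra).
assert (Hn : forall z w, Cmod z <= s -> Cmod w <= s -> norm2 z w < Rmin (Rmin r d) 1).
{ intros z w Hz Hw; generalize (norm2_le z w); unfold s in *; lra. }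
assert (Hb : forall z w, Cmod z <= s -> Cmod w <= s -> Cmod (F z w) <= N * (Cmod z + Cmod w) ^ 3).
{ intros z w Hz Hw; specialize (Hn z w Hz Hw); specialize (HM z w ltac:(lra)).
  apply Rle_trans with (1 := HM).
  assert (0 <= norm2 z w ^ 3) by (apply pow_le, norm2_ge_0).
  apply Rle_trans with (N * norm2 z w ^ 3).
  - apply Rmult_le_compat_r; auto; unfold N; generalize (Rle_abs M); lra.
  - apply Rmult_le_compat_l; [lra|]; apply pow_incr; split; [apply norm2_ge_0|apply norm2_le]. }
assert (Hsh : separately_holomorphic F s).
{ intros z w Hz Hw; destruct (HF z w) as [Hc _]; [specialize (Hn z w Hz Hw); lra|].
  destruct (cdiff2_at_cdiff2 _ _ _ Hc) as [a [b Hab]]; split.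
  - exists a; apply cdiff2_fst with b; auto.
  - exists b; apply cdiff2_snd with a; auto. }
exists (s / 3), (64 * 216 * N); repeat split; try lra.
- apply cdiff2_at_cdiff2, HF; specialize (Hn z w ltac:(lra) ltac:(lra)); lra.
- apply HF; specialize (Hn z w ltac:(lra) ltac:(lra)); lra.
- apply Rle_trans with (1 := Hb z w ltac:(lra) ltac:(lra)).
  generalize (Cmod_ge_0 z) (Cmod_ge_0 w); intros.
  assert (Hx : 0 <= Cmod z + Cmod w <= 1) by (unfold s in *; lra).
  revert Hx; generalize (Cmod z + Cmod w); intros x Hx.
  assert (0 <= x ^ 3 <= x).
  { split; [apply pow_le; lra|]; simpl; nra. }
  nra.
- intros p z w z' w' Hp Hps Hz Hw Hz' Hw'.
  replace (64 * 216 * N * p ^ 2) with (64 * (N * (6 * p) ^ 3) / p) by (field; lra).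
  apply separately_holomorphic_lipschitz; auto.
  + intros u v Hu Hv; apply Hsh; lra.
  + intros u v Hu Hv; apply Rle_trans with (1 := Hb u v ltac:(lra) ltac:(lra)).
    apply Rmult_le_compat_l; [lra|]; apply pow_incr.
    generalize (Cmod_ge_0 u) (Cmod_ge_0 v); lra.
Qed.

(** * Real differentiability and implicit functions *)

(** Convergence is obtained separately for [Re] and [Im]: consecutive iterates differ by at most
    [2^-n * 2 r], so the intervals of radius [2^-n * 4 r] about the iterates are nested. *)
Lemma contraction_fixed_point (T : C -> C) (r : R) :
  0 <= r -> (forall v, Cmod v <= r -> Cmod (T v) <= r) ->
  (forall v w, Cmod v <= r -> Cmod w <= r -> Cmod (T v - T w) <= / 2 * Cmod (v - w)) ->
  exists v, Cmod v <= r /\ T v = v.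
Proof.
intros Hr HT HL.
pose (u := fix u n := match n with O => RtoC 0 | S m => T (u m) end).
assert (Hu : forall n, Cmod (u n) <= r).
{ induction n; simpl; [rewrite Cmod_0; auto|auto]. }
assert (Hstep : forall n, Cmod (u (S n) - u n) <= (/ 2) ^ n * (2 * r)).
{ induction n as [|n IH].
  - simpl pow; cmod_triangle; rewrite Cmod_opp.
    generalize (Hu 1%nat) (Hu 0%nat); lra.
  - change (u (S (S n))) with (T (u (S n))); change (u (S n)) with (T (u n)) at 2.
    apply Rle_trans with (1 := HL _ _ (Hu _) (Hu _)); simpl pow; lra. }
assert (Hp : forall n, 0 <= (/ 2) ^ n) by (intros n; apply pow_le; lra).
assert (Hlim : forall p : C -> R, (forall z, Rabs (p z) <= Cmod z) ->
  (forall z w, p (z - w)%C = p z - p w) ->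
  exists x, forall n, Rabs (p (u n) - x) <= (/ 2) ^ n * (4 * r)).
{ intros p Hp1 Hp2.
  assert (Hd : forall n, Rabs (p (u (S n)) - p (u n)) <= (/ 2) ^ n * (2 * r)).
  { intros n; rewrite <- Hp2; apply Rle_trans with (1 := Hp1 _), Hstep. }
  destruct (nested_intervals (fun n => p (u n) - (/ 2) ^ n * (4 * r))
    (fun n => p (u n) + (/ 2) ^ n * (4 * r))) as [x Hx].
  - intros n; specialize (Hd n); apply Rabs_le_between in Hd; simpl pow; lra.
  - intros n; specialize (Hd n); apply Rabs_le_between in Hd; simpl pow; lra.
  - intros n; specialize (Hp n); nra.
  - exists x; intros n; specialize (Hx n); apply Rabs_le; lra. }
destruct (Hlim Re re_le_Cmod) as [x Hx].
{ intros z w; unfold Cminus; rewrite re_plus, re_opp; ring. }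
destruct (Hlim Im Im_le_Cmod) as [y Hy].
{ intros z w; unfold Cminus, Cplus, Copp, Im; simpl; ring. }
set (l := (x, y) : C).
assert (Hl : forall n, Cmod (u n - l) <= (/ 2) ^ n * (8 * r)).
{ intros n; apply Rle_trans with (1 := Cmod_le_ReIm _).
  change (Rabs (Re (u n) - x) + Rabs (Im (u n) - y) <= (/ 2) ^ n * (8 * r)).
  generalize (Hx n) (Hy n); lra. }
assert (Hlr : Cmod l <= r).
{ apply le_epsilon; intros eps Heps.
  destruct (pow_small (/ 2) (8 * r) eps) as [n Hn]; try lra.
  generalize (Hl n) (Hu n) (Cmod_triangle_inv l (u n)).
  rewrite Cmod_minus_sym; lra. }
exists l; split; auto.
assert (E : (T l - l)%C = 0%C).
{ apply Cmod_eq_0, Rle_antisym; [|apply Cmod_ge_0].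
  apply le_epsilon; intros eps Heps.
  destruct (pow_small (/ 2) (8 * r) (eps / 2)) as [n Hn]; try lra.
  generalize (Cmod_minus_triangle (T l) (u (S n)) l) (HL l (u n) Hlr (Hu n)) (Hl n) (Hl (S n)).
  change (u (S n)) with (T (u n)).
  rewrite (Cmod_minus_sym l (u n)); simpl pow.
  assert (0 <= (/ 2) ^ n * (8 * r)) by (apply Rmult_le_pos; [auto|lra]); lra. }
replace (T l) with ((T l - l) + l)%C by ring; rewrite E; ring.
Qed.

Definition rlin (a b k : C) : C := (RtoC (Re k) * a + RtoC (Im k) * b)%C.

Lemma rlin_bound (a b k : C) : Cmod (rlin a b k) <= (Cmod a + Cmod b) * Cmod k.
Proof.
unfold rlin; cmod_triangle.
rewrite 2!Cmod_mult, 2!Cmod_R.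
generalize (re_le_Cmod k) (Im_le_Cmod k) (Cmod_ge_0 a) (Cmod_ge_0 b); nra.
Qed.

Lemma real_diff_locally_lipschitz (f : C -> C) (z a b : C) :
  real_diff_at f z a b -> exists d, 0 < d /\ forall k, Cmod k < d ->
    Cmod (f (z + k)%C - f z) <= (Cmod a + Cmod b + 1) * Cmod k.
Proof.
intros H; destruct (H 1 Rlt_0_1) as [d [Hd H1]]; exists d; split; auto.
intros k Hk; specialize (H1 k Hk); fold (rlin a b k) in H1.
generalize (rlin_bound a b k) (Cmod_triangle_inv (f (z + k)%C - f z) (rlin a b k)); lra.
Qed.

Lemma real_diff_plus (f g : C -> C) (z a b a' b' : C) :
  real_diff_at f z a b -> real_diff_at g z a' b' ->
  real_diff_at (fun z => f z + g z)%C z (a + a')%C (b + b')%C.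
Proof.
intros Hf Hg eps Heps.
destruct (Hf (eps / 2)) as [d1 [Hd1 H1]]; [lra|].
destruct (Hg (eps / 2)) as [d2 [Hd2 H2]]; [lra|].
exists (Rmin d1 d2); split; [apply Rmin_pos; auto|].
intros k Hk.
specialize (H1 k (Rlt_le_trans _ _ _ Hk (Rmin_l _ _))).
specialize (H2 k (Rlt_le_trans _ _ _ Hk (Rmin_r _ _))).
match goal with |- Cmod ?X <= _ => replace X with
  ((f (z + k) - f z - (RtoC (Re k) * a + RtoC (Im k) * b)) +
   (g (z + k) - g z - (RtoC (Re k) * a' + RtoC (Im k) * b')))%C by ring end.
cmod_triangle; lra.
Qed.

Lemma real_diff_opp (f : C -> C) (z a b : C) :
  real_diff_at f z a b -> real_diff_at (fun z => - f z)%C z (- a)%C (- b)%C.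
Proof.
intros Hf eps Heps; destruct (Hf eps Heps) as [d [Hd H]]; exists d; split; auto.
intros k Hk; specialize (H k Hk).
match goal with |- Cmod ?X <= _ => replace X with
  (- (f (z + k) - f z - (RtoC (Re k) * a + RtoC (Im k) * b)))%C by ring end.
rewrite Cmod_opp; auto.
Qed.

Lemma real_diff_reflect (f : C -> C) (z a b : C) :
  real_diff_at f (- z)%C a b -> real_diff_at (fun z => - f (- z)%C)%C z a b.
Proof.
intros Hf eps Heps; destruct (Hf eps Heps) as [d [Hd H]]; exists d; split; auto.
intros k Hk; specialize (H (- k)%C); rewrite Cmod_opp in H; specialize (H Hk).
replace (- z + - k)%C with (- (z + k))%C in H by ring.
rewrite re_opp in H; replace (Im (- k)) with (- Im k) in H by reflexivity.
rewrite 2!RtoC_opp in H; rewrite <- Cmod_opp in H.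
match goal with |- Cmod ?X <= _ => match type of H with Cmod ?Y <= _ =>
  replace X with Y by ring end end; auto.
Qed.

Lemma real_diff_conj (z : C) : real_diff_at Cconj z 1 (- Ci)%C.
Proof.
intros eps Heps; exists 1; split; [lra|]; intros k _.
match goal with |- Cmod ?X <= _ => replace X with (RtoC 0) end.
- rewrite Cmod_0; generalize (Cmod_ge_0 k); nra.
- destruct z as [x y]; destruct k as [s t]; unfold Cconj, Cminus, Cplus, Copp, Cmult, Ci, RtoC, Re, Im; simpl; f_equal; ring.
Qed.

Lemma Re_Im_split (k : C) : k = (RtoC (Re k) + Ci * RtoC (Im k))%C.
Proof.
destruct k as [s t]; unfold Cplus, Cmult, Ci, RtoC, Re, Im; simpl; f_equal; ring.
Qed.

(** Chain rule along the graph of [beta]. The first variable moves by [Ci] in the second real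
    direction, and [F] is complex linear to first order, whence [Ci * A]. *)
Lemma real_diff_comp2 (F : C -> C -> C) (beta : C -> C) (z A B a b : C) :
  cdiff2 F z (beta z) A B -> real_diff_at beta z a b ->
  real_diff_at (fun z => F z (beta z)) z (A + B * a)%C (Ci * A + B * b)%C.
Proof.
intros HF Hb eps Heps.
set (c := Cmod a + Cmod b + 1).
assert (Hc : 1 <= c) by (unfold c; generalize (Cmod_ge_0 a) (Cmod_ge_0 b); lra).
set (m := Cmod B + 1).
assert (Hm : 1 <= m) by (unfold m; generalize (Cmod_ge_0 B); lra).
destruct (real_diff_locally_lipschitz beta z a b Hb) as [d1 [Hd1 H1]].
destruct (HF (eps / (2 * (1 + c)))) as [d2 [Hd2 H2]]; [apply Rdiv_lt_0_compat; lra|].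
destruct (Hb (eps / (2 * m))) as [d3 [Hd3 H3]]; [apply Rdiv_lt_0_compat; lra|].
assert (Hd2' : 0 < d2 / (1 + c)) by (apply Rdiv_lt_0_compat; lra).
exists (Rmin d1 (Rmin (d2 / (1 + c)) d3)); split; [repeat apply Rmin_pos; auto|].
intros k Hk.
assert (K1 : Cmod k < d1) by (apply (Rlt_le_trans _ _ _ Hk); le_Rmin).
assert (K2 : Cmod k < d2 / (1 + c)) by (apply (Rlt_le_trans _ _ _ Hk); le_Rmin).
assert (K3 : Cmod k < d3) by (apply (Rlt_le_trans _ _ _ Hk); le_Rmin).
specialize (H1 k K1); specialize (H3 k K3); fold c in H1.
set (l := (beta (z + k) - beta z)%C) in *.
assert (Hkl : Cmod k + Cmod l <= (1 + c) * Cmod k) by lra.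
assert (Hkl2 : Cmod k + Cmod l < d2).
{ apply Rle_lt_trans with (1 := Hkl).
  apply Rmult_lt_compat_l with (r := 1 + c) in K2; [|lra].
  replace ((1 + c) * (d2 / (1 + c))) with d2 in K2 by (field; lra); auto. }
specialize (H2 k l Hkl2).
replace (beta z + l)%C with (beta (z + k)%C) in H2 by (unfold l; ring).
match goal with |- Cmod ?X <= _ => replace X with
  ((F (z + k)%C (beta (z + k)%C) - F z (beta z) - (A * k + B * l)) +
   B * (l - (RtoC (Re k) * a + RtoC (Im k) * b)))%C end.
2: { rewrite (Re_Im_split k) at 3; ring. }
(* The two summands are the remainder of [F], measured against [|k| + |l| <= (1 + c) |k|], and [B]
   times the remainder of [beta]; each gets [eps / 2]. *)
cmod_triangle; rewrite Cmod_mult.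
assert (E1 : eps / (2 * (1 + c)) * (Cmod k + Cmod l) <= eps / 2 * Cmod k).
{ replace (eps / 2 * Cmod k) with (eps / (2 * (1 + c)) * ((1 + c) * Cmod k)) by (field; lra).
  apply Rmult_le_compat_l; auto; apply Rlt_le, Rdiv_lt_0_compat; lra. }
assert (E2 : Cmod B * Cmod (l - (RtoC (Re k) * a + RtoC (Im k) * b)) <= eps / 2 * Cmod k).
{ replace (eps / 2 * Cmod k) with (m * (eps / (2 * m) * Cmod k)) by (field; lra).
  apply Rmult_le_compat; auto; try apply Cmod_ge_0; unfold m; lra. }
lra.
Qed.

(** Differentiate [v + F w v = q] and divide by [1 + B], of modulus at least 1/2. The Lipschitz
    bound on [v], assumed beforehand, makes the remainder of [F] a remainder in [k] alone:
    [|k| + |l| <= 3 |k|]. *)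
Lemma real_diff_implicit (F : C -> C -> C) (v q : C -> C) (z A B a b : C) (d : R) :
  0 < d -> (forall w, Cmod (w - z) < d -> (v w + F w (v w) = q w)%C) ->
  (forall k, Cmod k < d -> Cmod (v (z + k)%C - v z) <= 2 * Cmod k) ->
  cdiff2 F z (v z) A B -> Cmod B <= / 2 -> real_diff_at q z a b ->
  real_diff_at v z ((a - A) / (1 + B))%C ((b - Ci * A) / (1 + B))%C.
Proof.
intros Hd Hv Hlip HF HB Hq eps Heps.
assert (HB2 : / 2 <= Cmod (1 + B)).
{ generalize (Cmod_triangle_inv 1 (- B)); rewrite Cmod_opp, Cmod_1.
  replace (1 - - B)%C with (1 + B)%C by ring; lra. }
assert (HB0 : (1 + B)%C <> 0%C) by (apply Cmod_gt_0; lra).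
destruct (HF (eps / 12)) as [d2 [Hd2 H2]]; [lra|].
destruct (Hq (eps / 4)) as [d3 [Hd3 H3]]; [lra|].
exists (Rmin d (Rmin (d2 / 3) d3)); split; [repeat apply Rmin_pos; lra|].
intros k Hk.
assert (K1 : Cmod k < d) by (apply (Rlt_le_trans _ _ _ Hk); le_Rmin).
assert (K2 : Cmod k < d2 / 3) by (apply (Rlt_le_trans _ _ _ Hk); le_Rmin).
assert (K3 : Cmod k < d3) by (apply (Rlt_le_trans _ _ _ Hk); le_Rmin).
specialize (Hlip k K1); specialize (H3 k K3).
set (l := (v (z + k) - v z)%C) in *.
specialize (H2 k l ltac:(lra)).
replace (v z + l)%C with (v (z + k)%C) in H2 by (unfold l; ring).
assert (Q1 := Hv (z + k)%C); replace (z + k - z)%C with k in Q1 by ring; specialize (Q1 K1).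
assert (Q0 := Hv z); rewrite Cminus_diag in Q0; rewrite Cmod_0 in Q0; specialize (Q0 Hd).
rewrite <- Q1, <- Q0 in H3.
assert (EA : (A * k)%C = (A * RtoC (Re k) + A * Ci * RtoC (Im k))%C)
  by (rewrite (Re_Im_split k) at 1; ring).
match goal with |- Cmod ?X <= _ => replace X with
  (((v (z + k)%C + F (z + k)%C (v (z + k)%C) - (v z + F z (v z)) - (RtoC (Re k) * a + RtoC (Im k) * b))
   - (F (z + k)%C (v (z + k)%C) - F z (v z) - (A * k + B * l))) / (1 + B))%C end.
2: { rewrite EA; unfold l; field; auto. }
rewrite Cmod_div by auto.
apply Rmult_le_reg_r with (Cmod (1 + B)); [lra|].
rewrite Rdiv_mult_cancel by lra.
cmod_triangle; rewrite Cmod_opp.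
generalize (Cmod_ge_0 k); intros.
assert (eps * Cmod k * / 2 <= eps * Cmod k * Cmod (1 + B)) by (apply Rmult_le_compat_l; nra).
assert (eps / 12 * (Cmod k + Cmod l) <= eps / 12 * (3 * Cmod k)) by (apply Rmult_le_compat_l; lra).
lra.
Qed.

(** * Continuity of sums, products and inverses *)

Lemma continuous_at_plus (f g : C -> C) (z : C) :
  continuous_at_C f z -> continuous_at_C g z -> continuous_at_C (fun z => f z + g z)%C z.
Proof.
intros Hf Hg eps Heps.
destruct (Hf (eps / 2)) as [d1 [Hd1 H1]]; [lra|].
destruct (Hg (eps / 2)) as [d2 [Hd2 H2]]; [lra|].
exists (Rmin d1 d2); split; [apply Rmin_pos; auto|].
intros w Hw.
specialize (H1 w (Rlt_le_trans _ _ _ Hw (Rmin_l _ _))).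
specialize (H2 w (Rlt_le_trans _ _ _ Hw (Rmin_r _ _))).
replace (f w + g w - (f z + g z))%C with ((f w - f z) + (g w - g z))%C by ring.
apply Rle_lt_trans with (1 := Cmod_triangle _ _); lra.
Qed.

Lemma continuous_at_const (c z : C) : continuous_at_C (fun _ => c) z.
Proof.
intros eps Heps; exists 1; split; [lra|]; intros w _.
rewrite Cminus_diag; rewrite Cmod_0; auto.
Qed.

Lemma continuous_at_opp (f : C -> C) (z : C) :
  continuous_at_C f z -> continuous_at_C (fun z => - f z)%C z.
Proof.
intros Hf eps Heps; destruct (Hf eps Heps) as [d [Hd H]]; exists d; split; auto.
intros w Hw; replace (- f w - - f z)%C with (- (f w - f z))%C by ring.
rewrite Cmod_opp; auto.
Qed.

Lemma continuous_at_reflect (f : C -> C) (z : C) :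
  continuous_at_C f (- z)%C -> continuous_at_C (fun z => f (- z)%C) z.
Proof.
intros Hf eps Heps; destruct (Hf eps Heps) as [d [Hd H]]; exists d; split; auto.
intros w Hw; apply H; replace (- w - - z)%C with (- (w - z))%C by ring.
rewrite Cmod_opp; auto.
Qed.

Definition continuous_within (D : C -> Prop) (f : C -> C) (z : C) : Prop :=
  forall eps, 0 < eps -> exists delta, 0 < delta /\
    forall w, D w -> Cmod (w - z) < delta -> Cmod (f w - f z) < eps.

Lemma continuous_at_within (D : C -> Prop) (f : C -> C) (z : C) :
  continuous_at_C f z -> continuous_within D f z.
Proof.
intros H eps Heps; destruct (H eps Heps) as [d [Hd H1]]; exists d; split; auto.
Qed.

Lemma continuous_within_mult (D : C -> Prop) (f g : C -> C) (z : C) :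
  continuous_within D f z -> continuous_within D g z ->
  continuous_within D (fun z => f z * g z)%C z.
Proof.
intros Hf Hg eps Heps.
set (p := Cmod (f z) + 1); set (q := Cmod (g z) + 1).
assert (Hp : 1 <= p) by (unfold p; generalize (Cmod_ge_0 (f z)); lra).
assert (Hq : 1 <= q) by (unfold q; generalize (Cmod_ge_0 (g z)); lra).
destruct (Hf (Rmin 1 (eps / (2 * q)))) as [d1 [Hd1 H1]].
{ apply Rmin_pos; [lra|apply Rdiv_lt_0_compat; lra]. }
destruct (Hg (eps / (2 * p))) as [d2 [Hd2 H2]]; [apply Rdiv_lt_0_compat; lra|].
exists (Rmin d1 d2); split; [apply Rmin_pos; auto|].
intros w HD Hw.
specialize (H1 w HD (Rlt_le_trans _ _ _ Hw (Rmin_l _ _))).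
specialize (H2 w HD (Rlt_le_trans _ _ _ Hw (Rmin_r _ _))).
assert (H3 := Rlt_le_trans _ _ _ H1 (Rmin_l _ _)).
assert (H4 := Rlt_le_trans _ _ _ H1 (Rmin_r _ _)).
replace (f w * g w - f z * g z)%C with (f w * (g w - g z) + (f w - f z) * g z)%C by ring.
apply Rle_lt_trans with (1 := Cmod_triangle _ _); rewrite 2!Cmod_mult.
assert (Hfw : Cmod (f w) <= p) by (generalize (Cmod_triangle_inv (f w) (f z)); unfold p; lra).
assert (E1 : Cmod (f w) * Cmod (g w - g z) <= p * Cmod (g w - g z)).
{ apply Rmult_le_compat_r; auto; apply Cmod_ge_0. }
assert (E2 : p * Cmod (g w - g z) < p * (eps / (2 * p))) by (apply Rmult_lt_compat_l; lra).
assert (E3 : Cmod (f w - f z) * Cmod (g z) <= eps / (2 * q) * q).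
{ apply Rmult_le_compat; [apply Cmod_ge_0|apply Cmod_ge_0|lra|unfold q; lra]. }
replace (p * (eps / (2 * p))) with (eps / 2) in E2 by (field; lra).
replace (eps / (2 * q) * q) with (eps / 2) in E3 by (field; lra).
lra.
Qed.

Lemma continuous_at_mult (f g : C -> C) (z : C) :
  continuous_at_C f z -> continuous_at_C g z -> continuous_at_C (fun z => f z * g z)%C z.
Proof.
intros Hf Hg eps Heps.
destruct (continuous_within_mult (fun _ => True) f g z) with (eps := eps) as [d [Hd H]];
  auto using continuous_at_within.
exists d; split; auto.
Qed.

Lemma continuous_at_inv (f : C -> C) (z : C) :
  continuous_at_C f z -> f z <> 0%C -> continuous_at_C (fun z => / f z)%C z.
Proof.
intros Hf H0 eps Heps.
set (m := Cmod (f z)); assert (Hm : 0 < m) by (apply Cmod_gt_0; auto).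
destruct (Hf (Rmin (m / 2) (eps * (m * m) / 4))) as [d [Hd H]].
{ apply Rmin_pos; [lra|]; apply Rdiv_lt_0_compat; [|lra]; repeat apply Rmult_lt_0_compat; auto. }
exists d; split; auto; intros w Hw; specialize (H w Hw).
assert (H1 := Rlt_le_trans _ _ _ H (Rmin_l _ _)).
assert (H2 := Rlt_le_trans _ _ _ H (Rmin_r _ _)).
assert (Hw2 : m / 2 <= Cmod (f w)).
{ rewrite Cmod_minus_sym in H1; generalize (Cmod_triangle_inv (f z) (f w)).
  generalize (Cmod_triangle_inv (f z) (f z - f w)).
  replace (f z - (f z - f w))%C with (f w) by ring; fold m; lra. }
assert (Hw0 : f w <> 0%C) by (apply Cmod_gt_0; lra).
replace (/ f w - / f z)%C with (- (f w - f z) / (f w * f z))%C by (field; auto).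
rewrite Cmod_div, Cmod_opp, Cmod_mult by (apply Cmult_neq_0; auto); fold m.
assert (0 < Cmod (f w) * m) by (apply Rmult_lt_0_compat; lra).
apply Rmult_lt_reg_r with (Cmod (f w) * m); auto.
rewrite Rdiv_mult_cancel by lra.
apply Rlt_le_trans with (1 := H2).
assert (eps * (m / 2 * m) <= eps * (Cmod (f w) * m)).
{ apply Rmult_le_compat_l; [lra|]; apply Rmult_le_compat_r; lra. }
nra.
Qed.

(** * Continuously differentiable functions that are [o(z)] *)

Lemma little_o0_trans (u v w : C -> C) : little_o0 u v -> little_o0 v w -> little_o0 u w.
Proof.
intros Huv Hvw eps Heps.
destruct (Huv 1 Rlt_0_1) as [d1 [Hd1 H1]]; destruct (Hvw eps Heps) as [d2 [Hd2 H2]].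
exists (Rmin d1 d2); split; [apply Rmin_pos; auto|]; intros z Hz.
specialize (H1 z (Rlt_le_trans _ _ _ Hz (Rmin_l _ _))).
specialize (H2 z (Rlt_le_trans _ _ _ Hz (Rmin_r _ _))); lra.
Qed.

Lemma real_diff_o_id (u : C -> C) (a b : C) :
  real_diff_at u 0%C a b -> little_o0 u (fun z => z) -> a = 0%C /\ b = 0%C.
Proof.
intros Hu Ho.
assert (u0 : u 0%C = 0%C).
{ destruct (Ho 1 Rlt_0_1) as [d [Hd H]]; specialize (H 0%C); rewrite Cmod_0 in H.
  apply Cmod_eq_0; generalize (H Hd) (Cmod_ge_0 (u 0%C)); lra. }
assert (Hlin : forall eps, 0 < eps -> exists t, 0 < t /\ forall k, Cmod k = t ->
   Cmod (rlin a b k) <= eps * t).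
{ intros eps Heps.
  destruct (Hu (eps / 2)) as [d1 [Hd1 H1]]; [lra|].
  destruct (Ho (eps / 2)) as [d2 [Hd2 H2]]; [lra|].
  assert (Hmin : 0 < Rmin d1 d2) by (apply Rmin_pos; auto).
  exists (Rmin d1 d2 / 2); split; [lra|]; intros k Hk.
  assert (T1 := Rmin_l d1 d2); assert (T2 := Rmin_r d1 d2).
  specialize (H1 k ltac:(lra)); specialize (H2 k ltac:(lra)).
  replace (0 + k)%C with k in H1 by ring; rewrite u0 in H1.
  fold (rlin a b k) in H1.
  replace (rlin a b k) with (u k - (u k - 0 - rlin a b k))%C by ring.
  cmod_triangle; rewrite Cmod_opp.
  rewrite Hk in *; lra. }
assert (Hz : forall c : C, (forall eps, 0 < eps -> Cmod c <= eps) -> c = 0%C).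
{ intros c Hc; apply Cmod_eq_0, Rle_antisym; [|apply Cmod_ge_0].
  apply le_epsilon; intros eps Heps; generalize (Hc eps Heps); lra. }
split; apply Hz; intros eps Heps; destruct (Hlin eps Heps) as [t [Ht H]];
  apply Rmult_le_reg_r with t; auto.
- specialize (H (RtoC t)); rewrite Cmod_R, Rabs_pos_eq in H by lra.
  apply Rle_trans with (2 := H eq_refl); right.
  replace (rlin a b (RtoC t)) with (RtoC t * a)%C.
  + rewrite Cmod_mult, Cmod_R, Rabs_pos_eq; lra.
  + unfold rlin; rewrite re_RtoC; replace (Im (RtoC t)) with 0 by reflexivity; ring.
- specialize (H (Ci * RtoC t)%C); rewrite Cmod_mult, Cmod_Ci, Cmod_R, Rabs_pos_eq, Rmult_1_l in H by lra.
  apply Rle_trans with (2 := H eq_refl); right.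
  replace (rlin a b (Ci * RtoC t)) with (RtoC t * b)%C.
  + rewrite Cmod_mult, Cmod_R, Rabs_pos_eq; lra.
  + unfold rlin; replace (Re (Ci * RtoC t)) with 0 by (unfold Re, Cmult, Ci, RtoC; simpl; ring).
    replace (Im (Ci * RtoC t)) with t by (unfold Im, Cmult, Ci, RtoC; simpl; ring); ring.
Qed.

(** [p] stands for [Re] or [Im]: along a segment this reduces the mean value inequality for [u] to
    real functions of one real variable. *)
Lemma real_diff_is_derive (u : C -> C) (p : C -> R) (w e a b : C) (t : R) :
  (forall z, Rabs (p z) <= Cmod z) -> (forall z z', p (z - z')%C = p z - p z') ->
  (forall (s : R) z, p (RtoC s * z)%C = s * p z) ->
  real_diff_at u (w + RtoC t * e)%C a b ->
  is_derive (fun s => p (u (w + RtoC s * e)%C)) t (p (rlin a b e)).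
Proof.
intros Hp1 Hp2 Hp3 Hu; split; [apply is_linear_scal_l|].
intros x Hx eps; assert (Hx' := is_filter_lim_locally_unique (V := R_NormedModule) t x Hx); subst x.
set (c := Cmod e + 1); assert (Hc : 1 <= c) by (unfold c; generalize (Cmod_ge_0 e); lra).
destruct (Hu (eps / c)) as [d [Hd H]]; [apply Rdiv_lt_0_compat; [apply cond_pos|lra]|].
assert (Hdc : 0 < d / c) by (apply Rdiv_lt_0_compat; lra).
exists (mkposreal _ Hdc); intros s Hs.
change (Rabs (s - t) < d / c) in Hs.
change (Rabs (p (u (w + RtoC s * e)%C) - p (u (w + RtoC t * e)%C) - (s - t) * p (rlin a b e)) <= eps * Rabs (s - t)).
assert (Hk : Cmod (RtoC (s - t) * e) <= Rabs (s - t) * c).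
{ rewrite Cmod_mult, Cmod_R; apply Rmult_le_compat_l; [apply Rabs_pos|unfold c; lra]. }
specialize (H (RtoC (s - t) * e)%C).
assert (Hlt : Rabs (s - t) * c < d).
{ apply Rmult_lt_compat_r with (r := c) in Hs; [|lra].
  rewrite Rdiv_mult_cancel in Hs by lra; auto. }
specialize (H ltac:(lra)).
replace (w + RtoC t * e + RtoC (s - t) * e)%C with (w + RtoC s * e)%C in H by (rewrite RtoC_minus; ring).
fold (rlin a b (RtoC (s - t) * e)) in H.
replace (rlin a b (RtoC (s - t) * e)) with (RtoC (s - t) * rlin a b e)%C in H.
2: { unfold rlin; rewrite re_scal_l.
     replace (Im (RtoC (s - t) * e)) with ((s - t) * Im e)
       by (destruct e; unfold Im, Cmult, RtoC; simpl; ring).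
     rewrite 2!RtoC_mult; ring. }
rewrite <- Hp2, <- Hp3, <- Hp2.
apply Rle_trans with (1 := Hp1 _), Rle_trans with (1 := H).
apply Rle_trans with (eps / c * (Rabs (s - t) * c)).
- apply Rmult_le_compat_l; auto; apply Rlt_le, Rdiv_lt_0_compat; [apply cond_pos|lra].
- right; field; lra.
Qed.

(** The differential vanishes at 0 because [u = o(z)], hence is small nearby by continuity; the mean
    value inequality is then applied to [Re] and [Im], each with [eps / 2]. *)
Lemma C1_o_id_small_lipschitz (u : C -> C) (eps : R) :
  C1_near0 u -> little_o0 u (fun z => z) -> 0 < eps ->
  exists r, 0 < r /\ forall z w, Cmod z <= r -> Cmod w <= r ->
    Cmod (u z - u w) <= eps * Cmod (z - w).
Proof.
intros [r [Hr [a [b H]]]] Ho Heps.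
destruct (H 0%C) as [H0 [Ha Hb]]; [rewrite Cmod_0; auto|].
destruct (real_diff_o_id u _ _ H0 Ho) as [Ea Eb].
destruct (Ha (eps / 4)) as [d1 [Hd1 H1]]; [lra|].
destruct (Hb (eps / 4)) as [d2 [Hd2 H2]]; [lra|].
set (s := Rmin r (Rmin d1 d2)).
assert (Hs : 0 < s) by (unfold s; repeat apply Rmin_pos; auto).
assert (S1 : s <= r) by (unfold s; le_Rmin).
assert (S2 : s <= d1) by (unfold s; le_Rmin).
assert (S3 : s <= d2) by (unfold s; le_Rmin).
exists (s / 4); split; [lra|]; intros z w Hz Hw.
set (e := (z - w)%C).
assert (He : Cmod e <= s / 2).
{ cmod_triangle; rewrite Cmod_opp; lra. }
(* [bounded_variation] also looks at negative [t], so the point may leave the segment from [w] to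
   [z]; the radius [s / 4] leaves room for this. *)
assert (Hin : forall t, Rabs t <= 1 -> Cmod (w + RtoC t * e) < s).
{ intros t Ht; apply Rle_lt_trans with (1 := Cmod_triangle _ _).
  rewrite Cmod_mult, Cmod_R; generalize (Cmod_ge_0 e) (Rabs_pos t); nra. }
assert (Key : forall p : C -> R, (forall z, Rabs (p z) <= Cmod z) ->
  (forall z z', p (z - z')%C = p z - p z') -> (forall (s : R) z, p (RtoC s * z)%C = s * p z) ->
  Rabs (p (u z - u w)%C) <= eps / 2 * Cmod e).
{ intros p Hp1 Hp2 Hp3.
  assert (B := bounded_variation (fun t => p (u (w + RtoC t * e)%C))
    (fun t => p (rlin (a (w + RtoC t * e)%C) (b (w + RtoC t * e)%C) e)) (eps / 2 * Cmod e) 0 1).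
  cbv beta in B.
  rewrite Rminus_0_r, Rabs_R1, Rmult_1_r in B.
  replace (w + RtoC 1 * e)%C with z in B by (unfold e; ring).
  replace (w + RtoC 0 * e)%C with w in B by ring.
  rewrite <- Hp2 in B; apply B.
  intros t Ht; rewrite Rminus_0_r in Ht; specialize (Hin t Ht); split.
  - apply real_diff_is_derive; auto; apply H; lra.
  - apply Rle_trans with (1 := Hp1 _), Rle_trans with (1 := rlin_bound _ _ _).
    apply Rmult_le_compat_r; [apply Cmod_ge_0|].
    specialize (H1 (w + RtoC t * e)%C); specialize (H2 (w + RtoC t * e)%C).
    rewrite Ea in H1; rewrite Eb in H2.
    rewrite (Cminus_0_r (w + RtoC t * e)) in H1, H2.
    replace (a (w + RtoC t * e) - 0)%C with (a (w + RtoC t * e)%C) in H1 by ring.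
    replace (b (w + RtoC t * e) - 0)%C with (b (w + RtoC t * e)%C) in H2 by ring.
    specialize (H1 ltac:(lra)); specialize (H2 ltac:(lra)); lra. }
apply Rle_trans with (1 := Cmod_le_ReIm _).
assert (K1 := Key Re re_le_Cmod
  ltac:(intros; unfold Cminus; rewrite re_plus, re_opp; ring) re_scal_l).
assert (K2 := Key Im Im_le_Cmod
  ltac:(intros; unfold Cminus, Cplus, Copp, Im; simpl; ring)
  ltac:(intros; unfold Im, Cmult, RtoC; simpl; ring)).
lra.
Qed.

(** * Straightening the holomorphic term *)

Lemma C1_near0_reflect (f : C -> C) : C1_near0 f -> C1_near0 (fun z => - f (- z)%C)%C.
Proof.
intros [r [Hr [a [b H]]]]; exists r; split; auto.
exists (fun z => a (- z)%C), (fun z => b (- z)%C); intros z Hz.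
destruct (H (- z)%C) as [H1 [H2 H3]]; [rewrite Cmod_opp; auto|].
split; [apply real_diff_reflect; auto|].
split; apply continuous_at_reflect; auto.
Qed.

Lemma little_o0_reflect (f g : C -> C) :
  even_near0 g -> little_o0 f g -> little_o0 (fun z => - f (- z)%C)%C g.
Proof.
intros [r [Hr Hg]] H eps Heps; destruct (H eps Heps) as [d [Hd H1]].
exists (Rmin r d); split; [apply Rmin_pos; auto|]; intros z Hz.
rewrite Cmod_opp, <- Hg by (apply (Rlt_le_trans _ _ _ Hz), Rmin_l).
apply H1; rewrite Cmod_opp; apply (Rlt_le_trans _ _ _ Hz), Rmin_r.
Qed.

Lemma little_o0_at_0 (u : C -> C) : little_o0 u (fun z => z) -> u 0%C = 0%C.
Proof.
intros Ho; destruct (Ho 1 Rlt_0_1) as [d [Hd H]]; specialize (H 0%C); rewrite Cmod_0 in H.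
apply Cmod_eq_0; generalize (H Hd) (Cmod_ge_0 (u 0%C)); lra.
Qed.

(* Straightening: in the coordinates [(z, w) |-> (z, w + F z w)], the graph of
   [conj z + f + g + h] becomes the graph of [v = conj z + g + o(g)]. *)
Lemma straightening (F : C -> C -> C) (g h : C -> C) (r0 K : R) :
  0 < r0 -> 0 < K ->
  (forall z w, Cmod z <= r0 -> Cmod w <= r0 -> (exists a b, cdiff2 F z w a b)) ->
  (forall z w, Cmod z <= r0 -> Cmod w <= r0 -> Cmod (F z w) <= K * (Cmod z + Cmod w)) ->
  (forall r z w z' w', 0 < r -> r <= r0 ->
     Cmod z <= r -> Cmod w <= r -> Cmod z' <= r -> Cmod w' <= r ->
     Cmod (F z w - F z' w') <= K * r ^ 2 * (Cmod (z - z') + Cmod (w - w'))) ->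
  C1_near0 g -> little_o0 g (fun z => z) -> C1_near0 h -> little_o0 h g ->
  let q := fun z => (Cconj z + F z (Cconj z) + g z + h z)%C in
  exists (v : C -> C) (s : R), 0 < s /\
    (forall z, Cmod z <= s -> Cmod (v z) <= 2 * Cmod z /\ (v z + F z (v z) = q z)%C) /\
    (forall z w, Cmod z <= s -> Cmod w <= s -> Cmod (v z - v w) <= 2 * Cmod (z - w)) /\
    (forall z w, Cmod z <= s -> Cmod w <= s ->
       Cmod (q z - q w - Cconj (z - w)) <= / 4 * Cmod (z - w)) /\
    C1_near0 (fun z => v z + - Cconj z + - g z)%C /\
    little_o0 (fun z => v z + - Cconj z + - g z)%C g.
Proof.
intros Hr0 HK HF HF0 HL Cg og Ch oh q.
assert (oh' := little_o0_trans _ _ _ oh og).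
assert (g0 := little_o0_at_0 g og); assert (h0 := little_o0_at_0 h oh').
assert (F00 : F 0%C 0%C = 0%C).
{ apply Cmod_eq_0, Rle_antisym; [|apply Cmod_ge_0].
  apply Rle_trans with (1 := HF0 0%C 0%C ltac:(rewrite Cmod_0; lra) ltac:(rewrite Cmod_0; lra)).
  rewrite Cmod_0; lra. }
(* Chosen so that [F] has Lipschitz constant [L = K (4 rho)^2 <= 1/16] on the polydisc of radius
   [4 rho], which lies in the given one. *)
set (rho := Rmin (r0 / 4) (/ (16 * (K + 1)))).
assert (HK1 : 0 < / (16 * (K + 1))) by (apply Rinv_0_lt_compat; lra).
assert (Hrho : 0 < rho) by (apply Rmin_pos; lra).
assert (Hrho1 : rho <= r0 / 4) by apply Rmin_l.
assert (Hrho2 : rho * (16 * (K + 1)) <= 1).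
{ apply Rle_trans with (/ (16 * (K + 1)) * (16 * (K + 1))).
  - apply Rmult_le_compat_r; [lra|apply Rmin_r].
  - right; field; lra. }
set (L := K * (4 * rho) ^ 2).
assert (HL0 : 0 < L) by (unfold L; apply Rmult_lt_0_compat; auto; apply pow_lt; lra).
assert (HL16 : L <= / 16) by (unfold L; nra).
assert (Lip : forall z w z' w', Cmod z <= 4 * rho -> Cmod w <= 4 * rho ->
  Cmod z' <= 4 * rho -> Cmod w' <= 4 * rho ->
  Cmod (F z w - F z' w') <= L * (Cmod (z - z') + Cmod (w - w'))).
{ intros; apply HL; auto; lra. }
assert (Hsh : separately_holomorphic F (4 * rho)).
{ intros z w Hz Hw; destruct (HF z w) as [a [b D]]; try lra; split;
    [exists a; apply cdiff2_fst with b|exists b; apply cdiff2_snd with a]; auto. }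
destruct (C1_o_id_small_lipschitz g (/ 16) Cg og ltac:(lra)) as [sg [Hsg Lg]].
destruct (C1_o_id_small_lipschitz h (/ 16) Ch oh' ltac:(lra)) as [sh [Hsh' Lh]].
destruct Cg as [rg [Hrg [ag [bg Dg]]]]; destruct Ch as [rh [Hrh [ah [bh Dh]]]].
set (s := Rmin (rho / 2) (Rmin (Rmin sg sh) (Rmin rg rh))).
assert (Hs : 0 < s) by (unfold s; repeat apply Rmin_pos; auto; lra).
assert (S1 : s <= rho / 2) by (unfold s; le_Rmin).
assert (S2 : s <= sg) by (unfold s; le_Rmin).
assert (S3 : s <= sh) by (unfold s; le_Rmin).
assert (S4 : s <= rg) by (unfold s; le_Rmin).
assert (S5 : s <= rh) by (unfold s; le_Rmin).
clearbody s.
assert (Bd : forall u : C -> C, u 0%C = 0%C -> (forall z w, Cmod z <= s -> Cmod w <= s ->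
   Cmod (u z - u w) <= / 16 * Cmod (z - w)) -> forall z, Cmod z <= s -> Cmod (u z) <= / 16 * Cmod z).
{ intros u u0 Lu z Hz; specialize (Lu z 0%C Hz ltac:(rewrite Cmod_0; lra)).
  rewrite u0 in Lu; rewrite (Cminus_0_r (u z)) in Lu.
  rewrite (Cminus_0_r z) in Lu; auto. }
assert (Bg := Bd g g0 (fun z w Hz Hw => Lg z w ltac:(lra) ltac:(lra))).
assert (Bh := Bd h h0 (fun z w Hz Hw => Lh z w ltac:(lra) ltac:(lra))).
assert (BF : forall z w, Cmod z <= 4 * rho -> Cmod w <= 4 * rho -> Cmod (F z w) <= / 16 * (Cmod z + Cmod w)).
{ intros z w Hz Hw; specialize (Lip z w 0%C 0%C Hz Hw ltac:(rewrite Cmod_0; lra) ltac:(rewrite Cmod_0; lra)).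
  rewrite F00 in Lip; rewrite (Cminus_0_r (F z w)) in Lip.
  rewrite (Cminus_0_r z) in Lip; rewrite (Cminus_0_r w) in Lip.
  apply Rle_trans with (1 := Lip); apply Rmult_le_compat_r; auto.
  generalize (Cmod_ge_0 z) (Cmod_ge_0 w); lra. }
assert (Bq : forall z, Cmod z <= s -> Cmod (q z) <= 5 / 4 * Cmod z).
{ intros z Hz; unfold q.
  generalize (Cmod_triangle (Cconj z + F z (Cconj z) + g z) (h z))
    (Cmod_triangle (Cconj z + F z (Cconj z)) (g z)) (Cmod_triangle (Cconj z) (F z (Cconj z)))
    (Bg z Hz) (Bh z Hz) (BF z (Cconj z)).
  rewrite Cmod_conj; intros T1 T2 T3 T4 T5 T6; specialize (T6 ltac:(lra) ltac:(lra)); lra. }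
assert (Lq : forall z w, Cmod z <= s -> Cmod w <= s ->
       Cmod (q z - q w - Cconj (z - w)) <= / 4 * Cmod (z - w)).
{ intros z w Hz Hw; unfold q; rewrite Cminus_conj.
  replace (Cconj z + F z (Cconj z) + g z + h z - (Cconj w + F w (Cconj w) + g w + h w) - (Cconj z - Cconj w))%C
    with ((F z (Cconj z) - F w (Cconj w)) + (g z - g w) + (h z - h w))%C by ring.
  generalize (Cmod_triangle (F z (Cconj z) - F w (Cconj w) + (g z - g w)) (h z - h w))
    (Cmod_triangle (F z (Cconj z) - F w (Cconj w)) (g z - g w))
    (Lg z w ltac:(lra) ltac:(lra)) (Lh z w ltac:(lra) ltac:(lra))
    (Lip z (Cconj z) w (Cconj w)).
  rewrite !Cmod_conj, <- Cminus_conj, Cmod_conj; intros T1 T2 T3 T4 T5.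
  specialize (T5 ltac:(lra) ltac:(lra) ltac:(lra) ltac:(lra)).
  generalize (Cmod_ge_0 (z - w)); intros; nra. }
(* [v z] is the fixed point of [w |-> q z - F z w] on the disc of radius [2 |z|], which is preserved
   because [5/4 + 3/16 <= 2]. For choice, the hypothesis on [z] stands under the existential, with
   default value 0 outside the disc. *)
assert (Ev : forall z, exists w, Cmod z <= s -> Cmod w <= 2 * Cmod z /\ (w + F z w = q z)%C).
{ intros z; destruct (Rle_dec (Cmod z) s) as [Hz|Hz]; [|exists 0%C; tauto].
  destruct (contraction_fixed_point (fun w => q z - F z w)%C (2 * Cmod z)) as [w [Hw1 Hw2]].
  - generalize (Cmod_ge_0 z); lra.
  - intros w Hw; cmod_triangle; rewrite Cmod_opp.
    generalize (Bq z Hz) (BF z w ltac:(lra) ltac:(lra)); generalize (Cmod_ge_0 z); lra.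
  - intros w w' Hw Hw'; replace (q z - F z w - (q z - F z w'))%C with (F z w' - F z w)%C by ring.
    rewrite Cmod_minus_sym; apply Rle_trans with (1 := Lip z w z w' ltac:(lra) ltac:(lra) ltac:(lra) ltac:(lra)).
    rewrite Cminus_diag; rewrite Cmod_0, Rplus_0_l.
    apply Rmult_le_compat_r; [apply Cmod_ge_0|lra].
  - exists w; intros _; split; auto; rewrite <- Hw2 at 1; ring. }
pose (v := fun z => proj1_sig (constructive_indefinite_description _ (Ev z))).
assert (Hv : forall z, Cmod z <= s -> Cmod (v z) <= 2 * Cmod z /\ (v z + F z (v z) = q z)%C).
{ intros z; unfold v; destruct (constructive_indefinite_description _ (Ev z)); auto. }
clearbody v.
assert (Lv : forall z w, Cmod z <= s -> Cmod w <= s -> Cmod (v z - v w) <= 2 * Cmod (z - w)).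
{ intros z w Hz Hw; destruct (Hv z Hz) as [V1 V2]; destruct (Hv w Hw) as [W1 W2].
  assert (E : (v z - v w)%C = ((q z - q w - Cconj (z - w)) + Cconj (z - w) + - (F z (v z) - F w (v w)))%C).
  { rewrite <- V2, <- W2; ring. }
  generalize (Cmod_triangle ((q z - q w - Cconj (z - w)) + Cconj (z - w)) (- (F z (v z) - F w (v w))))
    (Cmod_triangle (q z - q w - Cconj (z - w)) (Cconj (z - w))) (Lq z w Hz Hw)
    (Lip z (v z) w (v w) ltac:(lra) ltac:(lra) ltac:(lra) ltac:(lra)).
  rewrite <- E, Cmod_opp, Cmod_conj; intros.
  generalize (Cmod_ge_0 (z - w)) (Cmod_ge_0 (v z - v w)); intros; nra. }
exists v, s; split; [auto|split; [auto|split; [auto|split; [auto|split]]]].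
- assert (HAB : forall z w, exists ab : C * C, Cmod z <= r0 -> Cmod w <= r0 -> cdiff2 F z w (fst ab) (snd ab)).
  { intros z w; destruct (classic (Cmod z <= r0 /\ Cmod w <= r0)) as [[Hz Hw]|Hn].
    - destruct (HF z w Hz Hw) as [a [b D]]; exists (a, b); auto.
    - exists (RtoC 0, RtoC 0); tauto. }
  pose (AB := fun z w => proj1_sig (constructive_indefinite_description _ (HAB z w))).
  assert (DAB : forall z w, Cmod z <= r0 -> Cmod w <= r0 -> cdiff2 F z w (fst (AB z w)) (snd (AB z w))).
  { intros z w; unfold AB; destruct (constructive_indefinite_description _ (HAB z w)); auto. }
  clearbody AB; pose (A := fun z w => fst (AB z w)); pose (B := fun z w => snd (AB z w)).
  assert (D : forall z w, Cmod z <= r0 -> Cmod w <= r0 -> cdiff2 F z w (A z w) (B z w)) by auto.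
  clearbody A B.
  (* The partial derivatives of [F] are needed along two graphs, that of [Cconj] for the derivative
     of [q] and that of [v] for the implicit function. *)
  assert (contAB : forall (beta : C -> C) z, Cmod z < s -> (forall w, Cmod w <= s -> Cmod (beta w) <= 2 * Cmod w) ->
    (forall w, Cmod w <= s -> Cmod (beta w - beta z) <= 2 * Cmod (w - z)) ->
    continuous_at_C (fun w => A w (beta w)) z /\ continuous_at_C (fun w => B w (beta w)) z).
  { intros beta z Hz Hb Hlb.
    assert (Hnear : forall w, Cmod (w - z) < s - Cmod z -> Cmod w <= s).
    { intros w Hw; generalize (Cmod_triangle_inv w z); lra. }
    assert (Key : forall w, Cmod (w - z) < s - Cmod z ->
      Cmod (A w (beta w) - A z (beta z)) <= 64 * L / rho * 3 * Cmod (w - z) /\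
      Cmod (B w (beta w) - B z (beta z)) <= 64 * L / rho * 3 * Cmod (w - z)).
    { intros w Hw; specialize (Hnear w Hw).
      generalize (Hb w Hnear) (Hb z ltac:(lra)) (Hlb w Hnear); intros.
      destruct (partial_derivative_lipschitz F rho L w (beta w) z (beta z) (A w (beta w)) (B w (beta w))
        (A z (beta z)) (B z (beta z))) as [P1 P2]; auto; try lra; try (apply D; lra).
      assert (0 < 64 * L / rho) by (apply Rdiv_lt_0_compat; lra).
      assert (64 * L / rho * (Cmod (w - z) + Cmod (beta w - beta z)) <= 64 * L / rho * (3 * Cmod (w - z)))
        by (apply Rmult_le_compat_l; lra).
      lra. }
    split; apply locally_lipschitz_continuous with (64 * L / rho * 3) (s - Cmod z); try lra;
      intros w Hw; apply Key; auto. }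
  pose (aq := fun z => (1 + (A z (Cconj z) + B z (Cconj z) * 1) + ag z + ah z)%C).
  pose (bq := fun z => (- Ci + (Ci * A z (Cconj z) + B z (Cconj z) * - Ci) + bg z + bh z)%C).
  (* The derivative in the second variable is bounded by the Lipschitz constant [L], so [1 + B] is
     invertible. *)
  assert (HB : forall z, Cmod z <= s -> Cmod (B z (v z)) <= / 2).
  { intros z Hz; destruct (Hv z Hz) as [V1 V2].
    apply Rle_trans with L; [|lra].
    apply (partial_derivative_bound (F z) (v z) _ L rho Hrho).
    - apply cdiff2_snd with (A z (v z)); apply D; lra.
    - intros k Hk; generalize (Cmod_triangle (v z) k); intros.
      apply Rle_trans with (1 := Lip z (v z + k)%C z (v z) ltac:(lra) ltac:(lra) ltac:(lra) ltac:(lra)).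
      rewrite Cminus_diag; replace (v z + k - v z)%C with k by ring.
      rewrite Cmod_0; lra. }
  assert (HB0 : forall z, Cmod z <= s -> (1 + B z (v z))%C <> 0%C).
  { intros z Hz; apply Cmod_gt_0; generalize (Cmod_triangle_inv 1 (- B z (v z))) (HB z Hz).
    rewrite Cmod_opp, Cmod_1; replace (1 - - B z (v z))%C with (1 + B z (v z))%C by ring; lra. }
  exists s; split; auto.
  exists (fun z => (aq z - A z (v z)) / (1 + B z (v z)) + - RtoC 1 + - ag z)%C.
  exists (fun z => (bq z - Ci * A z (v z)) / (1 + B z (v z)) + - - Ci + - bg z)%C.
  intros z Hz.
  destruct (Dg z ltac:(lra)) as [Dg1 [Dg2 Dg3]]; destruct (Dh z ltac:(lra)) as [Dh1 [Dh2 Dh3]].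
  assert (Hnear : forall k, Cmod k < s - Cmod z -> Cmod (z + k) <= s).
  { intros k Hk; generalize (Cmod_triangle z k); lra. }
  destruct (contAB Cconj z Hz) as [cA cB].
  { intros w Hw; rewrite Cmod_conj; generalize (Cmod_ge_0 w); lra. }
  { intros w Hw; rewrite <- Cminus_conj, Cmod_conj; generalize (Cmod_ge_0 (w - z)); lra. }
  destruct (contAB v z Hz) as [cA' cB'].
  { intros w Hw; apply Hv; auto. }
  { intros w Hw; apply Lv; auto; lra. }
  split; [|split].
  + apply real_diff_plus; [apply real_diff_plus|]; [|apply real_diff_opp, real_diff_conj|apply real_diff_opp; auto].
    destruct (Hv z ltac:(lra)) as [V1 V2].
    apply (real_diff_implicit F v q z (A z (v z)) (B z (v z)) (aq z) (bq z) (s - Cmod z)); try lra.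
    * intros w Hw; apply Hv; generalize (Cmod_triangle_inv w z); lra.
    * intros k Hk; replace k with (z + k - z)%C at 2 by ring.
      apply Lv; [auto|lra].
    * apply D; lra.
    * apply HB; lra.
    * unfold aq, bq, q.
      apply real_diff_plus; [apply real_diff_plus; [apply real_diff_plus|]|]; auto.
      -- apply real_diff_conj.
      -- apply (real_diff_comp2 F Cconj); [apply D; rewrite ?Cmod_conj; lra|apply real_diff_conj].
  + apply continuous_at_plus; [apply continuous_at_plus|].
    * apply continuous_at_mult; [|apply continuous_at_inv; [|apply HB0; lra]].
      -- apply continuous_at_plus; [|apply continuous_at_opp; auto].
         unfold aq; repeat apply continuous_at_plus; auto; try apply continuous_at_const.
         apply continuous_at_mult; auto; apply continuous_at_const.
      -- apply continuous_at_plus; auto; apply continuous_at_const.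
    * apply continuous_at_const.
    * apply continuous_at_opp; auto.
  + apply continuous_at_plus; [apply continuous_at_plus|].
    * apply continuous_at_mult; [|apply continuous_at_inv; [|apply HB0; lra]].
      -- apply continuous_at_plus; [|apply continuous_at_opp; apply continuous_at_mult; auto; apply continuous_at_const].
         unfold bq; repeat apply continuous_at_plus; auto; try apply continuous_at_const.
         ++ apply continuous_at_mult; auto; apply continuous_at_const.
         ++ apply continuous_at_mult; auto; apply continuous_at_const.
      -- apply continuous_at_plus; auto; apply continuous_at_const.
    * apply continuous_at_const.
    * apply continuous_at_opp; auto.
- intros eps Heps.
  (* [R = h + (F z (conj z) - F z v)] and [|conj z - v| <= |g| + |R|]. Close to 0 the Lipschitz
     constant [K (2 |z|)^2] of [F] is at most [mu], so [|R| <= |h| + mu (|g| + |R|)]; with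
     [mu <= 1/2] the last [|R|] is absorbed, and [mu <= eps / 4] then gives [|R| <= eps |g|]. *)
  set (mu := Rmin (/ 2) (eps / 4)).
  assert (Hmu : 0 < mu) by (apply Rmin_pos; lra).
  assert (M1 : mu <= / 2) by apply Rmin_l; assert (M2 : mu <= eps / 4) by apply Rmin_r.
  destruct (oh (eps / 4)) as [d [Hd Hh]]; [lra|].
  assert (HmK : 0 < mu / (4 * K)) by (apply Rdiv_lt_0_compat; lra).
  exists (Rmin (Rmin s d) (Rmin 1 (mu / (4 * K)))); split; [repeat apply Rmin_pos; auto; lra|].
  intros z Hz.
  assert (Z3 : Cmod z < s) by (apply (Rlt_le_trans _ _ _ Hz); le_Rmin).
  assert (Z4 : Cmod z < d) by (apply (Rlt_le_trans _ _ _ Hz); le_Rmin).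
  assert (Z5 : Cmod z < 1) by (apply (Rlt_le_trans _ _ _ Hz); le_Rmin).
  assert (Z6 : Cmod z < mu / (4 * K)) by (apply (Rlt_le_trans _ _ _ Hz); le_Rmin).
  destruct (Hv z ltac:(lra)) as [V1 V2]; specialize (Hh z Z4).
  set (Rz := (v z + - Cconj z + - g z)%C).
  destruct (Req_dec (Cmod z) 0) as [Hz0|Hz0].
  + apply Cmod_eq_0 in Hz0.
    assert (E : Rz = 0%C).
    { unfold Rz; replace (v z) with (0%C : C).
      - rewrite Hz0, g0; unfold Cplus, Copp, Cconj, RtoC; simpl; f_equal; ring.
      - symmetry; apply Cmod_eq_0; rewrite Hz0, Cmod_0 in V1; rewrite Hz0.
        generalize (Cmod_ge_0 (v 0%C)); lra. }
    rewrite E, Cmod_0; apply Rmult_le_pos; [lra|apply Cmod_ge_0].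
  + assert (Hzp : 0 < Cmod z) by (generalize (Cmod_ge_0 z); lra).
    assert (HLz := HL (2 * Cmod z) z (Cconj z) z (v z) ltac:(lra) ltac:(lra) ltac:(lra)
      ltac:(rewrite Cmod_conj; lra) ltac:(lra) ltac:(lra)).
    rewrite Cminus_diag in HLz; rewrite Cmod_0, Rplus_0_l in HLz.
    assert (Hmuz : K * (2 * Cmod z) ^ 2 <= mu).
    { apply Rmult_lt_compat_r with (r := 4 * K) in Z6; [|lra].
      rewrite Rdiv_mult_cancel in Z6 by lra.
      apply Rle_trans with (Cmod z * (Cmod z * (4 * K))); [right; ring|].
      apply Rle_trans with (1 * (Cmod z * (4 * K))); [apply Rmult_le_compat_r; nra|lra]. }
    assert (Evz : Cmod (Cconj z - v z) <= Cmod (g z) + Cmod Rz).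
    { replace (Cconj z - v z)%C with (- (g z + Rz))%C by (unfold Rz; ring).
      rewrite Cmod_opp; apply Cmod_triangle. }
    assert (ER : Rz = (h z + (F z (Cconj z) - F z (v z)))%C).
    { unfold Rz; replace (v z) with (q z - F z (v z))%C at 1 by (rewrite <- V2; ring).
      unfold q; ring. }
    assert (HR : Cmod Rz <= Cmod (h z) + mu * (Cmod (g z) + Cmod Rz)).
    { rewrite ER at 1; cmod_triangle; apply Rplus_le_compat_l.
      apply Rle_trans with (1 := HLz); apply Rmult_le_compat; auto; try apply Cmod_ge_0.
      apply Rmult_le_pos; [lra|apply pow2_ge_0]. }
    generalize (Cmod_ge_0 Rz) (Cmod_ge_0 (g z)); intros; nra.
Qed.

(** * Polynomial closures and even polynomials *)

Definition poly_closure {T : Type} (f1 f2 : T -> C) (f : T -> C) : Prop :=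
  forall eps, 0 < eps -> exists P : poly2,
    forall x, Cmod (f x - peval2 P (f1 x) (f2 x)) <= eps.

Lemma peval2_cons (c : C) (i j : nat) (P : poly2) (z w : C) :
  peval2 ((c, i, j) :: P) z w = (c * (z ^ i * w ^ j) + peval2 P z w)%C.
Proof. reflexivity. Qed.

Lemma peval2_app (P Q : poly2) (z w : C) :
  peval2 (P ++ Q) z w = (peval2 P z w + peval2 Q z w)%C.
Proof.
induction P as [|[[c i] j] P IH]; [simpl; ring|].
change (((c, i, j) :: P) ++ Q) with ((c, i, j) :: (P ++ Q)).
rewrite 2!peval2_cons, IH; ring.
Qed.

Lemma peval2_mul_exists (P Q : poly2) :
  exists U : poly2, forall z w, peval2 U z w = (peval2 P z w * peval2 Q z w)%C.
Proof.
induction P as [|[[c i] j] P [U HU]].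
- exists []; intros z w; simpl; ring.
- assert (HV : exists V : poly2, forall z w, peval2 V z w = (c * (z ^ i * w ^ j) * peval2 Q z w)%C).
  { clear; induction Q as [|[[d k] l] Q [V HV]].
    - exists []; intros z w; simpl; ring.
    - exists ((Cmult c d, (i + k)%nat, (j + l)%nat) :: V); intros z w.
      rewrite 2!peval2_cons, HV, 2!Cpow_add_r; ring. }
  destruct HV as [V HV]; exists (V ++ U); intros z w.
  rewrite peval2_app, HV, HU, peval2_cons; ring.
Qed.

Lemma peval2_bounded (P : poly2) (M : R) :
  exists B, 0 <= B /\ forall z w, Cmod z <= M -> Cmod w <= M -> Cmod (peval2 P z w) <= B.
Proof.
induction P as [|[[c i] j] P [B [HB H]]].
- exists 0; split; [lra|]; intros; simpl; rewrite Cmod_0; lra.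
- exists (Cmod c * (Rabs M ^ i * Rabs M ^ j) + B); split.
  + apply Rplus_le_le_0_compat; auto.
    repeat apply Rmult_le_pos; try apply Cmod_ge_0; apply pow_le, Rabs_pos.
  + intros z w Hz Hw; rewrite peval2_cons.
    cmod_triangle; apply Rplus_le_compat; auto.
    rewrite 2!Cmod_mult, 2!Cmod_pow.
    apply Rmult_le_compat_l; [apply Cmod_ge_0|].
    generalize (Rle_abs M) (Cmod_ge_0 z) (Cmod_ge_0 w); intros.
    apply Rmult_le_compat; try (apply pow_le; auto); apply pow_incr; lra.
Qed.

Lemma poly_closure_algebra {T : Type} (f1 f2 : T -> C) (M : R) :
  (forall x, Cmod (f1 x) <= M) -> (forall x, Cmod (f2 x) <= M) ->
  closed_algebra (poly_closure f1 f2).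
Proof.
intros H1 H2; constructor.
- intros c eps Heps; exists [(c, 0%nat, 0%nat)]; intros x; rewrite peval2_cons; simpl.
  match goal with |- Cmod ?X <= _ => replace X with (RtoC 0) by ring end; rewrite Cmod_0; lra.
- intros f g Hf Hg eps Heps.
  destruct (Hf (eps / 2)) as [P HP]; [lra|]; destruct (Hg (eps / 2)) as [Q HQ]; [lra|].
  exists (P ++ Q); intros x; rewrite peval2_app.
  replace (f x + g x - (peval2 P (f1 x) (f2 x) + peval2 Q (f1 x) (f2 x)))%C
    with ((f x - peval2 P (f1 x) (f2 x)) + (g x - peval2 Q (f1 x) (f2 x)))%C by ring.
  cmod_triangle; generalize (HP x) (HQ x); lra.
- intros f g Hf Hg eps Heps.
  (* Order of the choices: a rough approximation bounds [f], this fixes the precision required for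
     [g], and the bound of the resulting [Q] fixes the precision required for [f]. *)
  destruct (Hf 1 Rlt_0_1) as [P0 HP0].
  destruct (peval2_bounded P0 M) as [B0 [HB0 HB0']].
  assert (Bf : forall x, Cmod (f x) <= B0 + 1).
  { intros x; generalize (HP0 x) (HB0' _ _ (H1 x) (H2 x))
      (Cmod_triangle_inv (f x) (peval2 P0 (f1 x) (f2 x))); lra. }
  destruct (Hg (eps / (2 * (B0 + 1)))) as [Q HQ]; [apply Rdiv_lt_0_compat; lra|].
  destruct (peval2_bounded Q M) as [B [HB HB']].
  destruct (Hf (eps / (2 * (B + 1)))) as [P HP]; [apply Rdiv_lt_0_compat; lra|].
  destruct (peval2_mul_exists P Q) as [U HU]; exists U; intros x; rewrite HU.
  specialize (HP x); specialize (HQ x); specialize (Bf x); specialize (HB' _ _ (H1 x) (H2 x)).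
  revert HP HQ HB'; generalize (peval2 P (f1 x) (f2 x)) (peval2 Q (f1 x) (f2 x)); intros a b Ha Hb HbB.
  replace (f x * g x - a * b)%C with (f x * (g x - b) + (f x - a) * b)%C by ring.
  cmod_triangle; rewrite 2!Cmod_mult.
  assert (E1 : Cmod (f x) * Cmod (g x - b) <= (B0 + 1) * (eps / (2 * (B0 + 1))))
    by (apply Rmult_le_compat; auto; apply Cmod_ge_0).
  assert (E2 : Cmod (f x - a) * Cmod b <= eps / (2 * (B + 1)) * (B + 1))
    by (apply Rmult_le_compat; try apply Cmod_ge_0; lra).
  replace ((B0 + 1) * (eps / (2 * (B0 + 1)))) with (eps / 2) in E1 by (field; lra).
  replace (eps / (2 * (B + 1)) * (B + 1)) with (eps / 2) in E2 by (field; lra).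
  lra.
- intros f Hf eps Heps.
  destruct (Hf (eps / 2)) as [g [Hg Hfg]]; [lra|].
  destruct (Hg (eps / 2)) as [P HP]; [lra|]; exists P; intros x.
  generalize (Hfg x) (HP x) (Cmod_minus_triangle (f x) (g x) (peval2 P (f1 x) (f2 x))); lra.
Qed.

Lemma poly_closure_peval2 {T : Type} (f1 f2 : T -> C) (P : poly2) :
  poly_closure f1 f2 (fun x => peval2 P (f1 x) (f2 x)).
Proof.
intros eps Heps; exists P; intros x.
replace (peval2 P (f1 x) (f2 x) - peval2 P (f1 x) (f2 x))%C with (RtoC 0) by ring.
rewrite Cmod_0; lra.
Qed.

Lemma poly_closure_fst {T : Type} (f1 f2 : T -> C) : poly_closure f1 f2 f1.
Proof.
intros eps Heps; exists [(RtoC 1, 1%nat, 0%nat)]; intros x; rewrite peval2_cons; simpl.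
match goal with |- Cmod ?X <= _ => replace X with (RtoC 0) by ring end; rewrite Cmod_0; lra.
Qed.

Lemma poly_closure_snd {T : Type} (f1 f2 : T -> C) : poly_closure f1 f2 f2.
Proof.
intros eps Heps; exists [(RtoC 1, 0%nat, 1%nat)]; intros x; rewrite peval2_cons; simpl.
match goal with |- Cmod ?X <= _ => replace X with (RtoC 0) by ring end; rewrite Cmod_0; lra.
Qed.

Lemma ca_peval2 {T : Type} (A : (T -> C) -> Prop) (f1 f2 : T -> C) (P : poly2) :
  closed_algebra A -> A f1 -> A f2 -> A (fun x => peval2 P (f1 x) (f2 x)).
Proof.
intros HA H1 H2; induction P as [|[[c i] j] P IH].
- exact (ca_const _ HA 0%C).
- apply (ca_ext A (fun x => c * (f1 x ^ i * f2 x ^ j) + peval2 P (f1 x) (f2 x))%C); auto.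
  apply (ca_add _ HA); auto; apply ca_scal; auto; apply (ca_mul _ HA); apply ca_pow; auto.
Qed.

(** The sum is twice the monomial or 0 according to the parity of [i + j]. Induction by steps of two
    in each exponent reduces it to exponents 0 and 1, where [f1 * f2] is the one case that the two
    squares do not supply. *)
Lemma ca_even_monomial {T : Type} (A : (T -> C) -> Prop) (f1 f2 : T -> C) (i j : nat) :
  closed_algebra A -> A (fun x => f1 x ^ 2)%C -> A (fun x => f2 x ^ 2)%C ->
  A (fun x => f1 x * f2 x)%C ->
  A (fun x => f1 x ^ i * f2 x ^ j + (- f1 x) ^ i * (- f2 x) ^ j)%C.
Proof.
intros HA H1 H2 H12.
assert (H2' : forall i, A (fun x => f1 x ^ i * f2 x ^ 0 + (- f1 x) ^ i * (- f2 x) ^ 0)%C ->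
  A (fun x => f1 x ^ i * f2 x ^ 1 + (- f1 x) ^ i * (- f2 x) ^ 1)%C ->
  A (fun x => f1 x ^ i * f2 x ^ j + (- f1 x) ^ i * (- f2 x) ^ j)%C).
{ intros k A0 A1.
  assert (H : forall n, A (fun x => f1 x ^ k * f2 x ^ n + (- f1 x) ^ k * (- f2 x) ^ n)%C /\
     A (fun x => f1 x ^ k * f2 x ^ S n + (- f1 x) ^ k * (- f2 x) ^ S n)%C).
  { induction n as [|n [IH1 IH2]]; split; auto.
    apply (ca_ext A (fun x => f2 x ^ 2 * (f1 x ^ k * f2 x ^ n + (- f1 x) ^ k * (- f2 x) ^ n))%C); auto.
    - apply (ca_mul _ HA); auto.
    - intros x; simpl; ring. }
  apply H. }
assert (H : forall n, A (fun x => f1 x ^ n * f2 x ^ j + (- f1 x) ^ n * (- f2 x) ^ j)%C /\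
     A (fun x => f1 x ^ S n * f2 x ^ j + (- f1 x) ^ S n * (- f2 x) ^ j)%C).
{ induction n as [|n [IH1 IH2]]; split; auto.
  - apply H2'.
    + apply (ca_ext A (fun _ => RtoC 2)); auto; [apply (ca_const _ HA)|].
      intros x; simpl; ring.
    + apply (ca_ext A (fun _ => RtoC 0)); auto; [apply (ca_const _ HA)|].
      intros x; simpl; ring.
  - apply H2'.
    + apply (ca_ext A (fun _ => RtoC 0)); auto; [apply (ca_const _ HA)|].
      intros x; simpl; ring.
    + apply (ca_ext A (fun x => RtoC 2 * (f1 x * f2 x))%C); auto; [apply ca_scal; auto|].
      intros x; simpl; ring.
  - apply (ca_ext A (fun x => f1 x ^ 2 * (f1 x ^ n * f2 x ^ j + (- f1 x) ^ n * (- f2 x) ^ j))%C); auto.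
    + apply (ca_mul _ HA); auto.
    + intros x; simpl; ring. }
apply H.
Qed.

Lemma ca_even_part {T : Type} (A : (T -> C) -> Prop) (f1 f2 : T -> C) (P : poly2) :
  closed_algebra A -> A (fun x => f1 x ^ 2)%C -> A (fun x => f2 x ^ 2)%C ->
  A (fun x => f1 x * f2 x)%C ->
  A (fun x => peval2 P (f1 x) (f2 x) + peval2 P (- f1 x) (- f2 x))%C.
Proof.
intros HA H1 H2 H12; induction P as [|[[c i] j] P IH].
- apply (ca_ext A (fun _ => RtoC 0)); auto; [apply (ca_const _ HA)|]; intros x; simpl; ring.
- apply (ca_ext A (fun x => c * (f1 x ^ i * f2 x ^ j + (- f1 x) ^ i * (- f2 x) ^ j) +
     (peval2 P (f1 x) (f2 x) + peval2 P (- f1 x) (- f2 x)))%C); auto.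
  + apply (ca_add _ HA); auto; apply ca_scal; auto; apply ca_even_monomial; auto.
  + intros x; rewrite 2!peval2_cons; ring.
Qed.

(** * Functions on the disc with positive imaginary part off 0 *)

Lemma continuous_at_id (z : C) : continuous_at_C (fun z => z) z.
Proof. intros eps Heps; exists eps; split; auto. Qed.

Lemma continuous_at_peval2 (P : poly2) (f g : C -> C) (z : C) :
  continuous_at_C f z -> continuous_at_C g z ->
  continuous_at_C (fun z => peval2 P (f z) (g z)) z.
Proof.
intros Hf Hg.
assert (Hpow : forall (u : C -> C) n, continuous_at_C u z -> continuous_at_C (fun z => u z ^ n)%C z).
{ intros u n Hu; induction n as [|n IH]; simpl; [apply continuous_at_const|].
  apply continuous_at_mult; auto. }
induction P as [|[[c i] j] P IH]; [exact (continuous_at_const 0%C z)|].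
apply (continuous_at_plus (fun z => c * (f z ^ i * g z ^ j))%C (fun z => peval2 P (f z) (g z))); auto.
repeat apply continuous_at_mult; auto; apply continuous_at_const.
Qed.

Lemma continuous_at_conj (f : C -> C) (z : C) :
  continuous_at_C f z -> continuous_at_C (fun z => Cconj (f z)) z.
Proof.
intros H eps Heps; destruct (H eps Heps) as [d [Hd H1]]; exists d; split; auto.
intros w Hw; rewrite <- Cminus_conj, Cmod_conj; auto.
Qed.

Lemma disc_Im_positive (r : R) (sigma : C -> C) (d : R) :
  (forall z, Cmod z <= r -> continuous_at_C sigma z) ->
  (forall z, Cmod z <= r -> z <> 0%C -> 0 < Im (sigma z)) -> 0 < d ->
  exists m, 0 < m /\ forall z, Cmod z <= r -> d <= Cmod z -> m <= Im (sigma z).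
Proof.
intros Hc Hpos Hd.
apply (disc_compact r (fun z m => d <= Cmod z -> m <= Im (sigma z))).
- intros z m m' _ Hm H Hz; specialize (H Hz); lra.
- intros p Hp; destruct (classic (p = 0%C)) as [Hp0|Hp0].
  + exists d; split; auto; intros z Hz Hzp Hdz; exfalso.
    rewrite Hp0 in Hzp; rewrite (Cminus_0_r z) in Hzp; lra.
  + specialize (Hpos p Hp Hp0); set (i := Im (sigma p)) in *.
    destruct (Hc p Hp (i / 2)) as [e [He H]]; [lra|].
    exists (Rmin e (i / 2)); split; [apply Rmin_pos; lra|].
    intros z Hz Hzp _; specialize (H z (Rlt_le_trans _ _ _ Hzp (Rmin_l _ _))).
    apply Rle_trans with (1 := Rmin_r _ _).
    assert (B := Rle_lt_trans _ _ _ (Im_le_Cmod (sigma z - sigma p)) H).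
    replace (Im (sigma z - sigma p)) with (Im (sigma z) - i) in B by (unfold i, Im, Cminus, Cplus, Copp; simpl; ring).
    apply Rabs_lt_between in B; lra.
Qed.

(** Multiplication by [- Ci] turns the upper half plane into the right one, where [ca_sqrt] applies.
    Its lower bound comes from compactness: [|sigma z| >= eta] keeps [z] away from 0 by continuity,
    and there [Im sigma] has a positive minimum. *)
Lemma ca_positive_Im_root (r : R) (A : (closed_disc r -> C) -> Prop) (sigma : C -> C) :
  0 <= r -> closed_algebra A ->
  (forall z, Cmod z <= r -> continuous_at_C sigma z) -> sigma 0%C = 0%C ->
  (forall z, Cmod z <= r -> z <> 0%C -> 0 < Im (sigma z)) ->
  A (fun x => sigma (dval x) ^ 2)%C -> A (fun x => sigma (dval x)).
Proof.
intros Hr HA Hc H0 Hpos H2.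
assert (Hcon : Defs.continuous_on (cdisk r) sigma).
{ intros z Hz; apply continuous_at_within, Hc, Hz. }
destruct (disc_bounded r sigma Hcon) as [B [HB HBs]].
assert (HRe : forall w, Re (- Ci * w) = Im w).
{ intros [a b]; unfold Re, Im, Cmult, Copp, Ci; simpl; ring. }
assert (Hmod : forall w, Cmod (- Ci * w) = Cmod w).
{ intros w; rewrite Cmod_mult, Cmod_opp, Cmod_Ci; ring. }
assert (Hs : A (fun x => - Ci * sigma (dval x))%C).
{ apply ca_sqrt with B; auto.
  - apply (ca_ext A (fun x => RtoC (-1) * sigma (dval x) ^ 2)%C); auto; [apply ca_scal; auto|].
    intros x; simpl; replace (RtoC (-1)) with (Ci * Ci)%C by (unfold Ci, Cmult, RtoC; simpl; f_equal; ring); ring.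
  - intros [z Hz]; rewrite Hmod; auto.
  - intros [z Hz]; rewrite HRe; simpl; destruct (classic (z = 0%C)) as [E|E].
    + rewrite E, H0; simpl; lra.
    + apply Rlt_le; auto.
  - intros eta Heta.
    destruct (Hc 0%C ltac:(rewrite Cmod_0; auto) eta Heta) as [d [Hd H]].
    destruct (disc_Im_positive r sigma d Hc Hpos Hd) as [m [Hm Him]].
    exists m; split; auto; intros [z Hz]; rewrite Hmod, HRe; simpl; intros Hz2.
    apply Him; auto; apply Rnot_lt_le; intros Hlt.
    specialize (H z); rewrite H0 in H; rewrite (Cminus_0_r z) in H.
    rewrite (Cminus_0_r (sigma z)) in H; specialize (H Hlt); lra. }
apply (ca_ext A (fun x => Ci * (- Ci * sigma (dval x)))%C); auto; [apply ca_scal; auto|].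
intros x; replace (Ci * (- Ci * sigma (dval x)))%C with (- (Ci * Ci) * sigma (dval x))%C by ring.
replace (Ci * Ci)%C with (- RtoC 1)%C by (unfold Ci, Cmult, Copp, RtoC; simpl; f_equal; ring); ring.
Qed.

(* Since [sigma] vanishes only at 0, [phi - phi 0] is the limit of [sigma u]
   with [u = (phi - phi 0) conj sigma / (|sigma| ^ 2 + e)]. *)
Lemma ca_ideal_full (r : R) (A : (closed_disc r -> C) -> Prop) (sigma phi : C -> C) :
  0 <= r -> closed_algebra A ->
  (forall z, Cmod z <= r -> continuous_at_C sigma z) ->
  (forall z, Cmod z <= r -> z <> 0%C -> 0 < Im (sigma z)) ->
  (forall u, Defs.continuous_on (cdisk r) u -> A (fun x => sigma (dval x) * u (dval x))%C) ->
  Defs.continuous_on (cdisk r) phi -> A (fun x => phi (dval x)).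
Proof.
intros Hr HA Hc Hpos HI Hphi; apply (ca_lim _ HA); intros eps Heps.
assert (D0 : cdisk r 0%C) by (unfold cdisk; rewrite Cmod_0; auto).
destruct (Hphi 0%C D0 eps Heps) as [d [Hd Hnear]].
destruct (disc_Im_positive r sigma d Hc Hpos Hd) as [m [Hm Him]].
destruct (disc_bounded r phi Hphi) as [B [HB HBp]].
(* The error is [(phi - phi 0) * e / (|sigma|^2 + e)]. For [|z| < d] the fraction is at most 1 and
   the first factor is small; otherwise [|sigma| >= m], and this [e] offsets the bound [2 B] on the
   first factor. *)
set (e := m ^ 2 * eps / (2 * B)).
assert (He : 0 < e) by (apply Rdiv_lt_0_compat; [apply Rmult_lt_0_compat; auto; apply pow_lt; auto|lra]).
pose (den := fun z => (sigma z * Cconj (sigma z) + RtoC e)%C).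
assert (Eden : forall z, den z = RtoC (Cmod (sigma z) ^ 2 + e)).
{ intros z; unfold den; rewrite RtoC_plus, Cmod2_conj; auto. }
assert (Pden : forall z, 0 < Cmod (sigma z) ^ 2 + e) by (intros z; generalize (pow2_ge_0 (Cmod (sigma z))); lra).
assert (Nden : forall z, den z <> 0%C).
{ intros z E; rewrite Eden in E; apply RtoC_inj in E; generalize (Pden z); lra. }
exists (fun x => phi 0%C + sigma (dval x) * ((phi (dval x) + - phi 0%C) * (Cconj (sigma (dval x)) * / den (dval x))))%C.
split.
- apply (ca_add _ HA); [apply (ca_const _ HA)|].
  apply (HI (fun z => (phi z + - phi 0%C) * (Cconj (sigma z) * / den z))%C).
  intros z Hz.
  apply (continuous_within_mult (cdisk r) (fun z => phi z + - phi 0)%C (fun z => Cconj (sigma z) * / den z)%C).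
  + intros eps' Heps'; destruct (Hphi z Hz eps' Heps') as [d' [Hd' H]]; exists d'; split; auto.
    intros w Hw Hwz; replace (phi w + - phi 0%C - (phi z + - phi 0%C))%C with (phi w - phi z)%C by ring; auto.
  + apply continuous_at_within, (continuous_at_mult (fun z => Cconj (sigma z)) (fun z => / den z)%C); [apply continuous_at_conj; auto|].
    apply continuous_at_inv; auto.
    apply continuous_at_plus; [|apply continuous_at_const].
    apply continuous_at_mult; auto; apply continuous_at_conj; auto.
- intros [z Hz]; simpl dval.
  replace (phi z - (phi 0%C + sigma z * ((phi z + - phi 0%C) * (Cconj (sigma z) * / den z))))%C
    with ((phi z - phi 0%C) * RtoC e * / den z)%C.
  2: { transitivity ((phi z - phi 0%C) * (den z - sigma z * Cconj (sigma z)) * / den z)%C.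
       - unfold den at 2; ring.
       - field; auto. }
  rewrite 2!Cmod_mult, Cmod_inv, Eden, 2!Cmod_R, (Rabs_pos_eq e), (Rabs_pos_eq (_ + _)) by auto with real.
  specialize (Pden z).
  apply Rmult_le_reg_r with (Cmod (sigma z) ^ 2 + e); auto.
  rewrite Rmult_assoc, Rinv_l, Rmult_1_r by lra.
  destruct (Rlt_or_le (Cmod z) d) as [Hlt|Hge].
  + specialize (Hnear z Hz); rewrite (Cminus_0_r z) in Hnear; specialize (Hnear Hlt).
    generalize (pow2_ge_0 (Cmod (sigma z))); nra.
  + specialize (Him z Hz Hge).
    assert (Hms : m <= Cmod (sigma z)) by (generalize (Im_le_Cmod (sigma z)) (Rle_abs (Im (sigma z))); lra).
    assert (Hm2 : m ^ 2 <= Cmod (sigma z) ^ 2) by (apply pow_incr; lra).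
    assert (Hp2 : Cmod (phi z - phi 0%C) <= 2 * B).
    { cmod_triangle; rewrite Cmod_opp.
      generalize (HBp z Hz) (HBp 0%C D0); lra. }
    apply Rle_trans with (2 * B * e); [apply Rmult_le_compat_r; lra|].
    unfold e at 1; replace (2 * B * (m ^ 2 * eps / (2 * B))) with (eps * m ^ 2) by (field; lra).
    apply Rmult_le_compat_l; lra.
Qed.

(** * Conclusion *)

Definition sheet (b : bool) (z : C) : C := if b then z else (- z)%C.

Lemma sheet_Cmod (b : bool) (z : C) : Cmod (sheet b z) = Cmod z.
Proof. destruct b; simpl; auto using Cmod_opp. Qed.

(* [closed_disc r * bool] is the union of the graph of [q] and its image under
   [- id]; both are the graph over the disc of a function near [conj z]. *)
Lemma two_sheets_solution (F : C -> C -> C) (q v : C -> C) (r r0 K : R)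
  (B : (closed_disc r * bool -> C) -> Prop) :
  0 < r -> 20 * r <= r0 -> 0 < K -> K * (2 * r) ^ 2 <= / 8 ->
  (forall z w, Cmod z <= r0 -> Cmod w <= r0 ->
     (exists a b, cdiff2 F z w a b) /\ F (- z)%C (- w)%C = (- F z w)%C /\
     Cmod (F z w) <= K * (Cmod z + Cmod w)) ->
  (forall r z w z' w', 0 < r -> r <= r0 ->
     Cmod z <= r -> Cmod w <= r -> Cmod z' <= r -> Cmod w' <= r ->
     Cmod (F z w - F z' w') <= K * r ^ 2 * (Cmod (z - z') + Cmod (w - w'))) ->
  (forall z, Cmod z <= r -> Cmod (v z) <= 2 * Cmod z /\ (v z + F z (v z) = q z)%C) ->
  (forall z, Cmod z <= r -> Cmod (q z) <= 5 / 4 * r) ->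
  closed_algebra B ->
  B (fun x => sheet (snd x) (dval (fst x))) -> B (fun x => sheet (snd x) (q (dval (fst x)))) ->
  B (fun x => sheet (snd x) (v (dval (fst x)))).
Proof.
intros Hr Hr0 HK HKr HF HL Hv Hq HB B1 B2.
assert (F00 : F 0%C 0%C = 0%C).
{ destruct (HF 0%C 0%C) as [_ [_ H]]; rewrite ?Cmod_0 in *; try lra.
  apply Cmod_eq_0; generalize (Cmod_ge_0 (F 0%C 0%C)); lra. }
assert (Lip : forall z w w', Cmod z <= 2 * r -> Cmod w <= 2 * r -> Cmod w' <= 2 * r ->
  Cmod (F z w - F z w') <= / 2 * Cmod (w - w')).
{ intros z w w' Hz Hw Hw'; apply Rle_trans with (1 := HL (2 * r) z w z w' ltac:(lra) ltac:(lra) Hz Hw Hz Hw').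
  rewrite Cminus_diag; rewrite Cmod_0, Rplus_0_l.
  apply Rmult_le_compat_r; [apply Cmod_ge_0|lra]. }
pose (Z := fun x : closed_disc r * bool => sheet (snd x) (dval (fst x))).
pose (Q := fun x : closed_disc r * bool => sheet (snd x) (q (dval (fst x)))).
pose (V := fun x : closed_disc r * bool => sheet (snd x) (v (dval (fst x)))).
assert (HZ : forall x, Cmod (Z x) <= r) by (intros [[z Hz] b]; unfold Z; rewrite sheet_Cmod; auto).
assert (HQ : forall x, Cmod (Q x) <= 5 / 4 * r).
{ intros [[z Hz] b]; unfold Q; rewrite sheet_Cmod; simpl; auto. }
assert (HV : forall x, Cmod (V x) <= 2 * r).
{ intros [[z Hz] b]; unfold V; rewrite sheet_Cmod; simpl; generalize (proj1 (Hv z Hz)); lra. }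
(* On the reflected sheet the equation keeps its form because [F] is odd; thus one iteration solves
   it on both sheets at once. *)
assert (EV : forall x, V x = (Q x - F (Z x) (V x))%C).
{ intros [[z Hz] b]; unfold V, Q, Z; simpl.
  destruct (Hv z Hz) as [V1 V2]; destruct b; simpl.
  - rewrite <- V2; ring.
  - destruct (HF z (v z)) as [_ [Hodd _]]; try lra; rewrite Hodd, <- V2; ring. }
assert (Self : forall w x, Cmod w <= 2 * r -> Cmod (Q x - F (Z x) w) <= 2 * r).
{ intros w x Hw; cmod_triangle; rewrite Cmod_opp.
  assert (H := HL (2 * r) (Z x) w 0%C 0%C ltac:(lra) ltac:(lra) ltac:(generalize (HZ x); lra) Hw
    ltac:(rewrite Cmod_0; lra) ltac:(rewrite Cmod_0; lra)).
  rewrite F00 in H; rewrite (Cminus_0_r (F (Z x) w)) in H.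
  rewrite (Cminus_0_r (Z x)) in H; rewrite (Cminus_0_r w) in H.
  generalize (HZ x) (HQ x) (Cmod_ge_0 (Z x)) (Cmod_ge_0 w); intros.
  assert (K * (2 * r) ^ 2 * (Cmod (Z x) + Cmod w) <= / 8 * (3 * r)).
  { apply Rmult_le_compat; try lra; apply Rmult_le_pos; [lra|apply pow2_ge_0]. }
  lra. }
pose (y := fix y n := match n with O => fun _ => RtoC 0
     | S n => fun x => (Q x - F (Z x) (y n x))%C end).
assert (Hy : forall n x, Cmod (y n x) <= 2 * r).
{ induction n as [|n IH]; intros x; simpl; [rewrite Cmod_0; lra|apply Self; auto]. }
apply (ca_geometric_limit B (/ 2) (2 * r) y V HB); [lra| |].
- induction n as [|n IH]; simpl; [apply (ca_const _ HB)|].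
  apply ca_sub; auto.
  (* The half-side [r0 / 5] makes the radius [5 * (r0 / 5)] equal to [r0], and [20 * r <= r0] puts
     the iterates, bounded by [2 * r], within half of it. *)
  apply (ca_holomorphic2 B F Z (y n) (r0 / 5) (K * (2 * r0))); auto; try lra.
  + intros x; generalize (HZ x); lra.
  + intros x; generalize (Hy n x); lra.
  + intros w a b Ha Hb Hw.
    assert (H3 := square_in_disc (3 * (r0 / 5) / 2) ltac:(lra) a b ltac:(lra) ltac:(lra)).
    destruct (HF (a, b) w) as [[l [l' D]] _]; [lra|lra|].
    exists l; apply cdiff2_fst with l'; auto.
  + intros z a b Ha Hb Hz.
    assert (H3 := square_in_disc (3 * (r0 / 5) / 2) ltac:(lra) a b ltac:(lra) ltac:(lra)).
    destruct (HF z (a, b)) as [[l [l' D]] _]; [lra|lra|].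
    exists l'; apply cdiff2_snd with l; auto.
  + intros z w Hz Hw; destruct (HF z w) as [_ [_ H]]; try lra.
    apply Rle_trans with (1 := H); apply Rmult_le_compat_l; lra.
- induction n as [|n IH]; intros x.
  + simpl; rewrite (Cminus_0_r (V x)); generalize (HV x); lra.
  + rewrite EV; simpl.
    replace (Q x - F (Z x) (V x) - (Q x - F (Z x) (y n x)))%C with (F (Z x) (y n x) - F (Z x) (V x))%C by ring.
    apply Rle_trans with (1 := Lip (Z x) (y n x) (V x) ltac:(generalize (HZ x); lra) (Hy n x) (HV x)).
    rewrite Cmod_minus_sym; generalize (IH x); lra.
Qed.

Theorem theorem2p5 (F : C -> C -> C) (g h : C -> C) :
  odd_holo_cubic_near0 F ->
  C1_near0 g -> even_near0 g -> little_o0 g (fun z => z) ->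
  (exists p : poly2, polynomial_condition g p) ->
  C1_near0 h -> little_o0 h g ->
  exists r0, 0 < r0 /\ forall r, 0 < r -> r < r0 ->
    uniform_poly_dense
      (fun z => Cpow z 2)
      (fun z => Cpow (Cplus (Cplus (Cplus (Cconj z) (F z (Cconj z))) (g z)) (h z)) 2)
      (cdisk r).
Proof.
intros HF Cg Eg og [p Hp] Ch oh.
destruct (odd_holo_cubic_polydisc F HF) as [r0 [K [Hr0 [HK [HFp HL]]]]].
destruct (straightening F g h r0 K Hr0 HK (fun z w Hz Hw => proj1 (HFp z w Hz Hw))
  (fun z w Hz Hw => proj2 (proj2 (HFp z w Hz Hw))) HL Cg og Ch oh)
  as [v [s [Hs [Hv [Lv [Lq [CR oR]]]]]]].
set (q := fun z => (Cconj z + F z (Cconj z) + g z + h z)%C).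
change (forall z, Cmod z <= s -> Cmod (v z) <= 2 * Cmod z /\ (v z + F z (v z))%C = q z) in Hv.
change (forall z w, Cmod z <= s -> Cmod w <= s ->
  Cmod (q z - q w - Cconj (z - w)) <= / 4 * Cmod (z - w)) in Lq.
set (Rf := fun z => (v z + - Cconj z + - g z)%C) in *.
destruct (Hp Rf CR oR) as [d1 [Hd1 P1]].
destruct (Hp _ (C1_near0_reflect _ CR) (little_o0_reflect _ _ Eg oR)) as [d2 [Hd2 P2]].
destruct Eg as [re [Hre Eg]].
(* The first two terms meet the requirements of [two_sheets_solution]; the others are the radii for
   [v], for the evenness of [g], and for the two uses of the polynomial condition. *)
set (m := Rmin (Rmin (r0 / 20) (/ (32 * (K + 1)))) (Rmin s (Rmin re (Rmin d1 d2)))).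
assert (HK1 : 0 < / (32 * (K + 1))) by (apply Rinv_0_lt_compat; lra).
exists m; split; [unfold m; repeat apply Rmin_pos; auto; lra|].
intros r Hr Hrm.
assert (M3 : m <= r0 / 20) by (unfold m; le_Rmin).
assert (M4 : m <= / (32 * (K + 1))) by (unfold m; le_Rmin).
assert (M5 : m <= s) by (unfold m; le_Rmin).
assert (M7 : m <= re) by (unfold m; le_Rmin).
assert (M9 : m <= d1) by (unfold m; le_Rmin).
assert (M10 : m <= d2) by (unfold m; le_Rmin).
clearbody m.
assert (HKr : K * (2 * r) ^ 2 <= / 8).
{ assert (M4' : r < / (32 * (K + 1))) by lra.
  apply Rmult_lt_compat_r with (r := 32 * (K + 1)) in M4'; [|lra].
  rewrite Rinv_l in M4' by lra.
  assert (r <= 1) by nra. nra. }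
assert (v0 : v 0%C = 0%C).
{ destruct (Hv 0%C ltac:(rewrite Cmod_0; lra)) as [H _]; rewrite Cmod_0 in H.
  apply Cmod_eq_0; generalize (Cmod_ge_0 (v 0%C)); lra. }
assert (F00 : F 0%C 0%C = 0%C).
{ destruct (HFp 0%C 0%C) as [_ [_ H]]; rewrite ?Cmod_0 in *; try lra.
  apply Cmod_eq_0; generalize (Cmod_ge_0 (F 0%C 0%C)); lra. }
assert (q0 : q 0%C = 0%C).
{ destruct (Hv 0%C ltac:(rewrite Cmod_0; lra)) as [_ H]; rewrite <- H, v0, F00; ring. }
assert (qc : forall z, Cmod z <= r -> Cmod (q z - Cconj z) <= / 4 * Cmod z).
{ intros z Hz; specialize (Lq z 0%C ltac:(lra) ltac:(rewrite Cmod_0; lra)).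
  rewrite q0 in Lq; rewrite (Cminus_0_r z) in Lq.
  replace (q z - 0 - Cconj z)%C with (q z - Cconj z)%C in Lq by ring; auto. }
assert (qb : forall z, Cmod z <= r -> Cmod (q z) <= 5 / 4 * r).
{ intros z Hz; generalize (qc z Hz) (Cmod_triangle_inv (q z) (Cconj z)); rewrite Cmod_conj; lra. }
pose (A := poly_closure (fun x : closed_disc r => dval x ^ 2)%C (fun x => q (dval x) ^ 2)%C).
assert (HA : closed_algebra A).
{ apply poly_closure_algebra with (Rmax (r ^ 2) ((5 / 4 * r) ^ 2)); intros [z Hz]; simpl dval; rewrite Cmod_pow.
  - apply Rle_trans with (2 := Rmax_l _ _), pow_incr; split; [apply Cmod_ge_0|auto].
  - apply Rle_trans with (2 := Rmax_r _ _), pow_incr; split; [apply Cmod_ge_0|auto]. }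
assert (AZ2 : A (fun x => dval x ^ 2)%C) by apply poly_closure_fst.
assert (AQ2 : A (fun x => q (dval x) ^ 2)%C) by apply poly_closure_snd.
assert (AZQ : A (fun x => dval x * q (dval x))%C).
{ assert (HzqRe : forall z, Cmod z <= r -> 3 / 4 * Cmod z ^ 2 <= Re (z * q z)).
  { intros z Hz.
    assert (E : (z * q z)%C = (RtoC (Cmod z ^ 2) + z * (q z - Cconj z))%C) by (rewrite Cmod2_conj; ring).
    rewrite E, re_plus, re_RtoC.
    assert (H := re_le_Cmod (z * (q z - Cconj z))); rewrite Cmod_mult in H.
    apply Rabs_le_between in H; generalize (qc z Hz) (Cmod_ge_0 z); nra. }
  assert (HzqC : forall z, Cmod z <= r -> Cmod (z * q z) <= 5 / 4 * Cmod z ^ 2).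
  { intros z Hz; rewrite Cmod_mult.
    assert (Cmod (q z) <= 5 / 4 * Cmod z).
    { generalize (qc z Hz) (Cmod_triangle_inv (q z) (Cconj z)); rewrite Cmod_conj; lra. }
    generalize (Cmod_ge_0 z); nra. }
  apply ca_sqrt with (5 / 4 * r ^ 2); auto.
  - apply (ca_ext A (fun x => dval x ^ 2 * q (dval x) ^ 2)%C); auto; [apply (ca_mul _ HA); auto|].
    intros x; simpl; ring.
  - intros [z Hz]; simpl dval; apply Rle_trans with (1 := HzqC z Hz).
    apply Rmult_le_compat_l; [lra|]; apply pow_incr; split; [apply Cmod_ge_0|auto].
  - intros [z Hz]; simpl dval; generalize (HzqRe z Hz) (pow2_ge_0 (Cmod z)); lra.
  (* From [Re (z q) >= 3/4 |z|^2] and [|z q| <= 5/4 |z|^2]. *)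
  - intros eta Heta; exists (3 / 5 * eta); split; [lra|]; intros [z Hz]; simpl dval; intros H.
    generalize (HzqRe z Hz) (HzqC z Hz); lra. }
pose (Z := fun x : closed_disc r * bool => sheet (snd x) (dval (fst x))).
pose (Q := fun x : closed_disc r * bool => sheet (snd x) (q (dval (fst x)))).
pose (V := fun x : closed_disc r * bool => sheet (snd x) (v (dval (fst x)))).
(* In [B] a single polynomial approximates on both sheets, which is how parity is recorded. *)
pose (B := poly_closure Z Q).
assert (HB : closed_algebra B).
{ apply poly_closure_algebra with (5 / 4 * r); intros [[z Hz] b]; unfold Z, Q; rewrite sheet_Cmod; simpl; auto; lra. }
assert (BV : B V).
{ apply (two_sheets_solution F q v r r0 K B); auto; try lra.
  - intros z Hz; apply Hv; lra.
  - apply poly_closure_fst.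
  - apply poly_closure_snd. }
(* Summation over the sheets symmetrizes the approximating polynomials, and even polynomials in
   [(z, q)] belong to [A]. *)
assert (Even : forall psi, B psi -> A (fun x => psi (x, true) + psi (x, false))%C).
{ intros psi Hpsi; apply (ca_lim _ HA); intros eps Heps.
  destruct (Hpsi (eps / 2)) as [P HP]; [lra|].
  exists (fun x => peval2 P (dval x) (q (dval x)) + peval2 P (- dval x) (- q (dval x)))%C.
  split; [apply (ca_even_part A dval (fun x => q (dval x))); auto|].
  intros x; assert (E1 := HP (x, true)); assert (E2 := HP (x, false)).
  unfold Z, Q in E1, E2; simpl in E1, E2.
  replace (psi (x, true) + psi (x, false) - (peval2 P (dval x) (q (dval x)) + peval2 P (- dval x) (- q (dval x))))%C
    with ((psi (x, true) - peval2 P (dval x) (q (dval x))) + (psi (x, false) - peval2 P (- dval x) (- q (dval x))))%C by ring.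
  cmod_triangle; lra. }
pose (sigma := fun z => (peval2 p z (v z) + - peval2 p (- z) (- v z))%C).
(* The extension of [sigma] to both sheets as an odd function: [sigma] on the first, [- sigma] on
   the second. *)
pose (sigma2 := fun x : closed_disc r * bool => (peval2 p (Z x) (V x) - peval2 p (RtoC (-1) * Z x) (RtoC (-1) * V x))%C).
assert (Bs : B sigma2).
{ apply ca_sub; auto; apply ca_peval2; auto; try apply ca_scal; auto; apply poly_closure_fst. }
assert (Es1 : forall x, sigma2 (x, true) = sigma (dval x)).
{ intros x; unfold sigma2, sigma, Z, V; simpl.
  replace (RtoC (-1) * dval x)%C with (- dval x)%C by ring.
  replace (RtoC (-1) * v (dval x))%C with (- v (dval x))%C by ring; ring. }
assert (Es2 : forall x, sigma2 (x, false) = (- sigma (dval x))%C).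
{ intros x; unfold sigma2, sigma, Z, V; simpl.
  replace (RtoC (-1) * - dval x)%C with (dval x)%C by ring.
  replace (RtoC (-1) * - v (dval x))%C with (v (dval x))%C by ring; ring. }
assert (vcont : forall z, Cmod z <= r -> continuous_at_C v z).
{ intros z Hz; apply locally_lipschitz_continuous with 2 (s - r); [lra|].
  intros w Hw; apply Lv; [generalize (Cmod_triangle_inv w z); lra|lra]. }
assert (scont : forall z, Cmod z <= r -> continuous_at_C sigma z).
{ intros z Hz; apply continuous_at_plus.
  - apply continuous_at_peval2; auto; apply continuous_at_id.
  - apply continuous_at_opp, (continuous_at_peval2 p (fun z => - z)%C (fun z => - v z)%C);
      apply continuous_at_opp; auto; apply continuous_at_id. }
assert (spos : forall z, Cmod z <= r -> z <> 0%C -> 0 < Im (sigma z)).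
{ intros z Hz Hz0.
  destruct (P1 z Hz0 ltac:(lra)) as [I1 _].
  assert (Hmz0 : (- z)%C <> 0%C).
  { intros E; apply Hz0; replace z with (- - z)%C by ring; rewrite E; ring. }
  (* At [- z] with the reflected remainder, and [g] even, the second argument of [p] in the lower
     inequality is exactly [- v z]. *)
  destruct (P2 (- z)%C Hmz0 ltac:(rewrite Cmod_opp; lra)) as [_ I2].
  unfold Rf in I1, I2; rewrite Eg in I2 by lra.
  replace (Cconj z + g z + (v z + - Cconj z + - g z))%C with (v z) in I1 by ring.
  replace (- - z)%C with z in I2 by ring.
  rewrite Copp_conj in I2.
  replace (- Cconj z - g z + - (v z + - Cconj z + - g z))%C with (- v z)%C in I2 by ring.
  unfold sigma; replace (Im (peval2 p z (v z) + - peval2 p (- z) (- v z)))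
    with (Im (peval2 p z (v z)) - Im (peval2 p (- z) (- v z)))
    by (unfold Im, Cplus, Copp; simpl; ring).
  lra. }
assert (s0 : sigma 0%C = 0%C).
{ unfold sigma; rewrite v0; replace (- 0)%C with (RtoC 0) by ring; ring. }
assert (RtoC 2 <> 0%C) by (intros E; apply RtoC_inj in E; lra).
assert (As : A (fun x => sigma (dval x))).
{ apply ca_positive_Im_root; auto; [lra|].
  (* The two values of [sigma2 ^ 2] agree, so half their sum is [sigma ^ 2], and it lies in [A] by
     [Even]. *)
  apply (ca_ext A (fun x => / 2 * (sigma2 (x, true) ^ 2 + sigma2 (x, false) ^ 2))%C); auto.
  - apply ca_scal; auto; apply (Even (fun x => sigma2 x ^ 2)%C), ca_pow; auto.
  - intros x; rewrite Es1, Es2; simpl; field; auto. }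
(* Writing [psi] as half the sum plus half the difference of its values on the two sheets: the
   difference times [sigma] is the sheet sum of [sigma2 * psi], and the sum already lies in [A], as
   does [sigma]. *)
assert (Ideal : forall psi, B psi -> A (fun x => sigma (dval x) * psi (x, true))%C).
{ intros psi Hpsi.
  apply (ca_ext A (fun x => / 2 * ((sigma2 (x, true) * psi (x, true) + sigma2 (x, false) * psi (x, false))
     + sigma (dval x) * (psi (x, true) + psi (x, false))))%C); auto.
  - apply ca_scal; auto; apply (ca_add _ HA).
    + apply (Even (fun x => sigma2 x * psi x)%C), (ca_mul _ HB); auto.
    + apply (ca_mul _ HA); auto.
  - intros x; rewrite Es1, Es2; field; auto. }
assert (Ideal2 : forall u, Defs.continuous_on (cdisk r) u -> A (fun x => sigma (dval x) * u (dval x))%C).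
{ intros u Hu.
  destruct (disc_bounded r sigma) as [S [HS HSb]].
  { intros z Hz; apply continuous_at_within, scont, Hz. }
  assert (HZQ : closed_algebra (poly_closure (@dval r) (fun x => q (dval x)))).
  { apply poly_closure_algebra with (5 / 4 * r); intros [z Hz]; simpl; auto; lra. }
  assert (HuP : poly_closure (@dval r) (fun x => q (dval x)) (fun x => u (dval x))).
  { apply (ca_small_perturbation_conj r q (poly_closure (@dval r) (fun x => q (dval x)))); auto.
    - apply poly_closure_fst.
    - apply (poly_closure_snd (@dval r) (fun x => q (dval x))).
    - intros z w Hz Hw; apply Lq; lra. }
  apply (ca_lim _ HA); intros eps Heps.
  destruct (HuP (eps / S)) as [P HP]; [apply Rdiv_lt_0_compat; auto|].
  exists (fun x => sigma (dval x) * peval2 P (dval x) (q (dval x)))%C; split.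
  - apply (Ideal (fun x => peval2 P (Z x) (Q x))), poly_closure_peval2.
  - intros x; replace (sigma (dval x) * u (dval x) - sigma (dval x) * peval2 P (dval x) (q (dval x)))%C
      with (sigma (dval x) * (u (dval x) - peval2 P (dval x) (q (dval x))))%C by ring.
    rewrite Cmod_mult; replace eps with (S * (eps / S)) by (field; lra).
    apply Rmult_le_compat; auto; try apply Cmod_ge_0.
    destruct x as [z Hz]; simpl; auto. }
intros phi Hphi eps Heps.
destruct (ca_ideal_full r A sigma phi ltac:(lra) HA scont spos Ideal2 Hphi (eps / 2)) as [P HP]; [lra|].
exists P; intros z Hz.
apply Rle_lt_trans with (1 := HP (exist _ z Hz)); lra.
Qed.
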